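(* Let $m\ge 1$ be an integer. There exists $\varepsilon>0$ such that the following holds: if $q_1,q_2\in B(0,\varepsilon)$ and $\lambda_n(q_1)=\lambda_n(q_2)$ and $\mu_n(q_1)=\mu_n(q_2)$ for all $n\ge 1$, then $q_1(x)=q_2(x)$ for a.e. $x\in(0,\pi)$.
   Context: Fix an integer $m\ge 1$. $L^2(0,\pi)$ is the space of square-integrable complex-valued functions on $(0,\pi)$, with its usual norm, and $B(0,\varepsilon)$ is the ball of radius $\varepsilon$ about $0$ in $L^2(0,\pi)$. For $q\in L^2(0,\pi)$ consider the differential equation $(-1)^m y^{(2m)}(x)+q(x)y(x)=\lambda y(x)$, $x\in(0,\pi)$, with spectral parameter $\lambda\in\mathbb{C}$. $L_1(q)$ denotes the operator in $L^2(0,\pi)$ generated by $(-1)^m y^{(2m)}+qy$ with the Dirichlet boundary conditions $y^{(2i)}(0)=y^{(2i)}(\pi)=0$, $0\le i\le m-1$. $L_2(q)$ denotes the operator generated by the same expression with the Dirichlet-Neumann boundary conditions $y^{(2i)}(0)=y^{(2i+1)}(\pi)=0$, $0\le i\le m-1$. $\{\lambda_n(q)\}_{n\ge1}$ and $\{\mu_n(q)\}_{n\ge1}$ are the spectra (sequences of eigenvalues) of $L_1(q)$ and $L_2(q)$, respectively, each enumerated with algebraic multiplicity in order of nondecreasing modulus; for $q=0$ one has $\lambda_n(0)=n^{2m}$ and $\mu_n(0)=(n-\tfrac12)^{2m}$. *)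

(* Defs.v *)
From HB Require Import structures.
From mathcomp Require Import all_boot all_order all_algebra.
From mathcomp Require Import all_classical all_reals all_analysis.
From mathcomp Require Import complex.

Set Implicit Arguments.
Unset Strict Implicit.
Unset Printing Implicit Defensive.

Import Order.TTheory GRing.Theory Num.Theory.
Import numFieldNormedType.Exports.

Local Open Scope classical_set_scope.
Local Open Scope ring_scope.

(* Complex-valued functions on (0, pi) are represented by functions
   [R -> R[i]] whose values outside (0, pi) are irrelevant; elements of
   L^2(0, pi) are compared with [ae_eq0pi]. *)
Section SpectralProblem.
Variable R : realType.
Local Notation C := R[i].
Local Notation mu := (@lebesgue_measure R).
Implicit Types (f g y w q : R -> C) (Y : nat -> R -> C) (z : C).

Definition cmod z : R := ComplexField.Normc.normc z.

Definition I0pi : set R := `]0, pi[.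

Definition ae_eq0pi f g : Prop := f = g %[ae mu in I0pi].

Definition L2norm f : \bar R :=
  'N[mu]_(2%:E)[(fun x => (cmod (f x))%:E) \_ I0pi]%E.

Definition inL2 f : Prop :=
  [/\ measurable_fun I0pi (fun x => complex.Re (f x)),
      measurable_fun I0pi (fun x => complex.Im (f x))
    & (L2norm f < +oo)%E].

Definition L2ball (eps : R) f : Prop := inL2 f /\ (L2norm f < eps%:E)%E.

Definition Cintegrable (D : set R) f : Prop :=
  mu.-integrable D (fun x => (complex.Re (f x))%:E) /\
  mu.-integrable D (fun x => (complex.Im (f x))%:E).

Definition Cintegral (D : set R) f : C :=
  Complex (\int[mu]_(x in D) complex.Re (f x))
          (\int[mu]_(x in D) complex.Im (f x)).

(* f is absolutely continuous on [0, pi], i.e. an indefinite integral, and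
   f' = g a.e. *)
Definition AC_deriv f g : Prop :=
  Cintegrable `[0, pi] g /\
  forall x : R, x \in `[0, pi] -> f x = f 0 + Cintegral `[0, x] g.

(* Y 0 lies in the Sobolev space W^{n,2}(0, pi) and Y k is its k-th derivative:
   the AC representative on [0, pi] for k < n, so that boundary values make
   sense, and an L^2 function for k = n. *)
Definition sobolev_jet (n : nat) Y : Prop :=
  (forall k, (k < n)%N -> AC_deriv (Y k) (Y k.+1)) /\ inL2 (Y n).

Definition dirichlet (m : nat) Y : Prop :=
  forall i, (i < m)%N -> Y (2 * i)%N 0 = 0 /\ Y (2 * i)%N pi = 0.

Definition dirichlet_neumann (m : nat) Y : Prop :=
  forall i, (i < m)%N -> Y (2 * i)%N 0 = 0 /\ Y (2 * i).+1 pi = 0.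

(* Unbounded operators on L^2(0, pi) are given by their graphs: [T y w] means
   that y is in the domain of T and T y = w. *)
Definition operator := (R -> C) -> (R -> C) -> Prop.

Definition diff_operator (bc : nat -> (nat -> R -> C) -> Prop) (m : nat) q :
    operator := fun y w =>
  [/\ inL2 y, inL2 w & exists Y,
    [/\ sobolev_jet (2 * m) Y, bc m Y, ae_eq0pi y (Y 0%N)
      & ae_eq0pi w (fun x => (-1) ^+ m * Y (2 * m)%N x + q x * Y 0%N x)]].

Definition opL1 (m : nat) q : operator := diff_operator dirichlet m q.

Definition opL2 (m : nat) q : operator := diff_operator dirichlet_neumann m q.

(* The kernel of (T - z)^k. *)
Fixpoint ker_pow (T : operator) z (k : nat) y : Prop :=
  if k is k'.+1 then
    exists w, T y w /\ ker_pow T z k' (fun x => w x - z * y x)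
  else inL2 y /\ ae_eq0pi y (fun=> 0).

Definition root_vector (T : operator) z y : Prop := exists k, ker_pow T z k y.

Definition lin_comb (d : nat) (c : 'I_d -> C) (e : 'I_d -> R -> C) : R -> C :=
  fun x => \sum_(i < d) c i * e i x.

(* The algebraic multiplicity of z is the dimension of the root subspace, the
   union over k of the kernels of (T - z)^k; it is 0 iff z is not an
   eigenvalue. *)
Definition alg_multiplicity (T : operator) z (d : nat) : Prop :=
  exists e : 'I_d -> R -> C,
    [/\ forall i, root_vector T z (e i),
        forall c, ae_eq0pi (lin_comb c e) (fun=> 0) -> forall i, c i = 0
      & forall y, root_vector T z y -> exists c, ae_eq0pi y (lin_comb c e)].

(* [lam n] is the (n+1)-st eigenvalue.  Eigenvalues of equal modulus may come
   in any order. *)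
Definition spectrum_enum (T : operator) (lam : nat -> C) : Prop :=
  (forall n p, (n <= p)%N -> cmod (lam n) <= cmod (lam p)) /\
  forall z, exists2 d, alg_multiplicity T z d
                     & ([set n | lam n = z] #= `I_d)%card.

End SpectralProblem.

(* Main.v *)
Require Import Defs.
From mathcomp Require Import all_boot all_order all_algebra.
From mathcomp Require Import all_classical all_reals all_analysis.
From mathcomp Require Import measurable_realfun.
From mathcomp Require Import complex ring lra zify.
Set Implicit Arguments.
Unset Strict Implicit.
Unset Printing Implicit Defensive.
Import Order.TTheory GRing.Theory Num.Theory.
Import numFieldNormedType.Exports.
Local Open Scope classical_set_scope.
Local Open Scope ring_scope.

(** The unperturbed operators are diagonal in the sines sin (w x), where w runs
    over the positive integers for the Dirichlet conditions and over the positive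
    half-integers for the Dirichlet-Neumann ones.  Suppose that a common
    eigenvalue lam of the operators with potentials q1 and q2 has eigenfunctions
    y1 and y2.  Since the unperturbed part is symmetric for the bilinear form
    int f g, the integral of (q1 - q2) y1 y2 vanishes.  For small potentials y1
    and y2 are close to a sine, so that y1 y2 is close to
    sin (w x)^2 = (1 - cos (2 w x)) / 2, and for the two problems together 2 w
    exhausts the positive integers.  Hence q1 - q2 is nearly orthogonal to all
    functions 1 - cos (K x), K >= 1, and it vanishes as soon as the errors are
    square-summable in K with a small sum.

    The errors come from perturbation theory.  If y is normalised to have n-th
    sine coefficient 1, its other coefficients are those of
    (lam - Om n - q) y divided by Om j - Om n, where Om j = w_j^(2 m).  They are
    bounded by the L^1 size of q times the weights 1 / |Om j - Om n|, whose sum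
    over j is O((n + 1)^(-3/4)) ([sum_weight]), and this is square-summable in n.
    The same equation, solved as a fixed point in a weighted sup norm, produces
    an eigenvalue of q1 near every Om n ([eigencoef_exists]); it is also an
    eigenvalue of q2 because the spectra agree, and [eigencoef_close] locates the
    eigenfunctions of both potentials.

    All of this takes place on sine coefficients.  The dictionary with the
    differential operators is given by [eigencoef_eigenvalue] and
    [eigenvalue_eigencoef]: integration by parts multiplies the sine coefficients
    of a function in the domain by Om j, repeated integration inverts this, and
    completeness of the sines identifies functions with equal coefficients.

    The final step ([nearly_orthogonal_small]) rests on the completeness of the
    cosines in L^2 ([cosspan_dense], [cos_parseval_le]), which follows from
    Bernstein polynomials in (1 + cos x) / 2; multiplication by the lowest sine
    transfers completeness to both families of sines ([sn_complete]). *)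

(** * Integration over the open interval *)

Section RealIntegrals.
Variable R : realType.
Local Notation mu := (@lebesgue_measure R).
Local Notation I := (@I0pi R).
Implicit Types f g h : R -> R.

Definition L1pi f : Prop := mu.-integrable I (EFin \o f).

Definition L2pi f : Prop := measurable_fun I f /\ L1pi (fun x => f x ^+ 2).

Lemma measurable_I0pi : measurable (I : set (measurableTypeR R)).
Proof. exact: measurable_itv. Qed.
Hint Resolve measurable_I0pi : core.

Lemma I0pi_measure : mu I = (pi%:E : \bar R).
Proof. by rewrite lebesgue_measure_itv/= lte_fin pi_gt0 oppr0 adde0. Qed.

Lemma I0pi_finite : (mu I < +oo)%E.
Proof. by rewrite I0pi_measure ltry. Qed.

Lemma L1pi_measurable f : L1pi f -> measurable_fun I f.
Proof. by move=> /integrableP[/measurable_EFinP]. Qed.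

Lemma eq_L1pi f g : (forall x, I x -> f x = g x) -> L1pi f -> L1pi g.
Proof.
move=> fg; apply: eq_integrable => // x xI /=.
by rewrite fg//; exact/set_mem.
Qed.

Lemma eq_int f g : (forall x, I x -> f x = g x) ->
  \int[mu]_(x in I) f x = \int[mu]_(x in I) g x.
Proof. by move=> fg; apply: eq_Rintegral => x /set_mem; exact: fg. Qed.

Lemma L1pi_le f g : measurable_fun I f ->
  (forall x, I x -> `|f x| <= g x) -> L1pi g -> L1pi f.
Proof.
move=> mf fg; apply: le_integrable => //; first exact/measurable_EFinP.
move=> x xI /=; rewrite lee_fin (le_trans (fg x xI))//.
exact: ler_norm.
Qed.

Lemma L1piD f g : L1pi f -> L1pi g -> L1pi (fun x => f x + g x).
Proof. move=> fi gi; have := integrableD measurable_I0pi fi gi.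
by apply: eq_integrable. Qed.

Lemma L1piB f g : L1pi f -> L1pi g -> L1pi (fun x => f x - g x).
Proof. move=> fi gi; have := integrableB measurable_I0pi fi gi.
by apply: eq_integrable. Qed.

Lemma L1piZ c f : L1pi f -> L1pi (fun x => c * f x).
Proof. move=> fi; have := integrableZl measurable_I0pi c fi; by apply: eq_integrable. Qed.

Lemma L1piN f : L1pi f -> L1pi (fun x => - f x).
Proof. move=> fi; have := integrableN fi; by apply: eq_integrable. Qed.

Lemma L1pi_norm f : L1pi f -> L1pi (fun x => `|f x|).
Proof. by move=> fi; exact: (integrable_norm fi). Qed.

Lemma L1pi_bounded M f : measurable_fun I f ->
  (forall x, I x -> `|f x| <= M) -> L1pi f.
Proof.
move=> mf fM; apply: measurable_bounded_integrable => //.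
  exact: I0pi_finite.
exists M; split; first exact: num_real.
by move=> N MN x xI; apply: (le_trans (fM x xI)); exact: ltW.
Qed.

Lemma L1pi_cst c : L1pi (fun=> c).
Proof. exact: (@L1pi_bounded `|c|). Qed.

Lemma L1pi_sum (n : nat) (f : nat -> R -> R) : (forall k, L1pi (f k)) ->
  L1pi (fun x => \sum_(k < n) f k x).
Proof.
move=> fi; elim: n => [|n IHn].
  by apply: eq_L1pi (L1pi_cst 0) => x _; rewrite big_ord0.
by apply: eq_L1pi (L1piD IHn (fi n)) => x _; rewrite big_ord_recr.
Qed.

Lemma L1pi_mulb M f g : L1pi f -> measurable_fun I g ->
  (forall x, I x -> `|g x| <= M) -> L1pi (fun x => f x * g x).
Proof.
move=> fi mg gM.
apply: (@L1pi_le _ (fun x => M * `|f x|)).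
- by apply: measurable_funM => //; exact: L1pi_measurable.
- by move=> x xI; rewrite normrM mulrC ler_wpM2r// gM.
- exact/L1piZ/L1pi_norm.
Qed.

Lemma intD f g : L1pi f -> L1pi g -> \int[mu]_(x in I) (f x + g x) =
  \int[mu]_(x in I) f x + \int[mu]_(x in I) g x.
Proof. by move=> fi gi; rewrite RintegralD. Qed.

Lemma intB f g : L1pi f -> L1pi g -> \int[mu]_(x in I) (f x - g x) =
  \int[mu]_(x in I) f x - \int[mu]_(x in I) g x.
Proof. by move=> fi gi; rewrite RintegralB. Qed.

Lemma intZ c f : L1pi f ->
  \int[mu]_(x in I) (c * f x) = c * \int[mu]_(x in I) f x.
Proof. by move=> fi; rewrite RintegralZl. Qed.

Lemma int_cst c : \int[mu]_(x in I) c = c * pi.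
Proof. by rewrite Rintegral_cst//; congr (c * _); exact: (congr1 fine I0pi_measure). Qed.

Lemma int_sum (n : nat) (f : nat -> R -> R) : (forall k, L1pi (f k)) ->
  \int[mu]_(x in I) (\sum_(k < n) f k x) = \sum_(k < n) \int[mu]_(x in I) f k x.
Proof.
move=> fi; elim: n => [|n IHn].
  under eq_int do rewrite big_ord0.
  by rewrite int_cst mul0r big_ord0.
under eq_int do rewrite big_ord_recr/=.
by rewrite intD//; [rewrite IHn big_ord_recr|exact: L1pi_sum].
Qed.

Lemma int_le f g : L1pi f -> L1pi g -> (forall x, I x -> f x <= g x) ->
  \int[mu]_(x in I) f x <= \int[mu]_(x in I) g x.
Proof. by move=> fi gi fg; apply: le_Rintegral. Qed.

Lemma int_ge0 f : (forall x, I x -> 0 <= f x) -> 0 <= \int[mu]_(x in I) f x.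
Proof. by move=> f0; apply: Rintegral_ge0. Qed.

Lemma int_bound f g : L1pi f -> L1pi g -> (forall x, I x -> `|f x| <= g x) ->
  `|\int[mu]_(x in I) f x| <= \int[mu]_(x in I) g x.
Proof.
move=> fi gi fg; apply: (le_trans (le_normr_Rintegral measurable_I0pi fi)).
by apply: int_le => //; exact: L1pi_norm.
Qed.

Lemma L2pi_bounded M f : measurable_fun I f ->
  (forall x, I x -> `|f x| <= M) -> L2pi f.
Proof.
move=> mf fM; split => //; apply: (@L1pi_bounded (M ^+ 2)).
  by apply: measurable_funX.
move=> x xI; rewrite normrX lerXn2r ?nnegrE//; last exact: fM.
by rewrite (le_trans _ (fM x xI)).
Qed.

Lemma L2piM f g : L2pi f -> L2pi g -> L1pi (fun x => f x * g x).
Proof.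
move=> [mf fi] [mg gi]; apply: (@L1pi_le _ (fun x => f x ^+ 2 + g x ^+ 2)).
- exact: measurable_funM.
- by move=> x _; rewrite ler_norml; apply/andP; split; nra.
- exact: L1piD.
Qed.

Lemma L2pi_L1 f : L2pi f -> L1pi f.
Proof.
move=> f2; have o2 : L2pi (fun=> 1) by exact: (@L2pi_bounded `|1|).
by apply: eq_L1pi (L2piM f2 o2) => x _; rewrite mulr1.
Qed.

Lemma L2piD f g : L2pi f -> L2pi g -> L2pi (fun x => f x + g x).
Proof.
move=> f2 g2; split; first by apply: measurable_funD; [case: f2|case: g2].
have fg := L2piM f2 g2; case: f2 g2 => _ fi [_ gi].
apply: eq_L1pi (L1piD (L1piD fi gi) (L1piZ 2 fg)) => x _; ring.
Qed.

Lemma L2piZ c f : L2pi f -> L2pi (fun x => c * f x).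
Proof.
move=> [mf fi]; split; first exact: measurable_funM.
by apply: eq_L1pi (L1piZ (c ^+ 2) fi) => x _; rewrite exprMn.
Qed.

Lemma L2piB f g : L2pi f -> L2pi g -> L2pi (fun x => f x - g x).
Proof.
move=> f2 g2; have := L2piD f2 (L2piZ (-1) g2).
by congr L2pi; apply/funext => x; rewrite mulN1r.
Qed.

Lemma L2pi_mulb M f g : L2pi f -> measurable_fun I g ->
  (forall x, I x -> `|g x| <= M) -> L2pi (fun x => f x * g x).
Proof.
move=> [mf fi] mg gM; split; first exact: measurable_funM.
have := @L1pi_mulb (M ^+ 2) _ (fun x => g x ^+ 2) fi.
move=> H; apply: eq_L1pi (H _ _) => [x _||]; first by rewrite exprMn.
  by apply: measurable_funX.
move=> x xI; rewrite normrX lerXn2r ?nnegrE//; last exact: gM.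
by rewrite (le_trans _ (gM x xI)).
Qed.

Lemma ae_imply (P Q : R -> Prop) : (forall x, P x -> Q x) ->
  {ae mu, forall x, P x} -> {ae mu, forall x, Q x}.
Proof. exact: (@filterS _ (almost_everywhere mu) _). Qed.

Lemma ae_imply2 (P Q S : R -> Prop) : (forall x, P x -> Q x -> S x) ->
  {ae mu, forall x, P x} -> {ae mu, forall x, Q x} -> {ae mu, forall x, S x}.
Proof. exact: (@filterS2 _ (almost_everywhere mu) _). Qed.

Lemma int_sqr_eq0 f : L2pi f -> \int[mu]_(x in I) (f x ^+ 2) = 0 ->
  {ae mu, forall x, I x -> f x = 0}.
Proof.
move=> [mf fi] f0.
have : (\int[mu]_(x in I) `|(f x ^+ 2)%:E| = 0)%E.
  under eq_integral do rewrite abse_EFin ger0_norm ?sqr_ge0//.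
  by rewrite -[LHS]fineK ?[fine _]f0//; exact: integrable_fin_num fi.
move/ae_eq_integral_abs => H.
have {}H : ae_eq mu I (fun x => (f x ^+ 2)%:E) (cst 0%E).
  apply: H => //; apply/measurable_EFinP; exact: measurable_funX.
apply: ae_imply H => x H xI.
have /eqP : f x ^+ 2 = 0 by have := H xI; case.
by rewrite sqrf_eq0 => /eqP.
Qed.

(** Approximation arguments only need to pick one good member of a dominated
    sequence, which dispenses them from handling limits of integrals. *)
Lemma dominated_small (F : nat -> R -> R) g (e : R) : 0 < e ->
  (forall n, measurable_fun I (F n)) -> L1pi g ->
  (forall n x, I x -> `|F n x| <= g x) ->
  (forall x, I x -> F n x @[n --> \oo] --> 0) ->
  exists n, `|\int[mu]_(x in I) F n x| < e.
Proof.
move=> e0 mF gi Fg F0.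
have mF' n : measurable_fun I (fun x => (F n x)%:E).
  exact/measurable_EFinP.
have [||| |_ _] := @dominated_convergence _ _ _ mu I measurable_I0pi
  (fun n x => (F n x)%:E) (fun=> 0%E) (fun x => (g x)%:E) mF'.
- exact: measurable_cst.
- by apply: aeW => x Ix; apply/cvg_EFin; [exact: nearW|exact: F0].
- exact: gi.
- by apply: aeW => x n Ix; rewrite lee_fin Fg.
rewrite integral0 => /fine_cvgP[_ /cvgrPdist_lt /(_ e e0)[n _ /(_ n (leqnn n))]].
by rewrite /= sub0r normrN => h; exists n.
Qed.

End RealIntegrals.

(** * Bernstein operators and density of the cosine polynomials *)

Section Bernstein.
Variable R : realType.
Implicit Types (h : nat -> R) (u : R).

(** The expectation of [h] at the number of successes in [n] trials of
    probability [u], computed by conditioning on the first trial.  In this form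
    positivity, the variance and the closure properties of [cosspan] are plain
    inductions, without binomial coefficients. *)
Fixpoint bernstein (n : nat) h u : R :=
  if n is n'.+1 then
    (1 - u) * bernstein n' h u + u * bernstein n' (fun j => h j.+1) u
  else h 0%N.

Lemma bernstein_cst n c u : bernstein n (fun=> c) u = c.
Proof. by elim: n => //= n ->; ring. Qed.

Lemma bernstein_lin n a h1 h2 u :
  bernstein n (fun j => a * h1 j + h2 j) u =
  a * bernstein n h1 u + bernstein n h2 u.
Proof. by elim: n h1 h2 => //= n IHn h1 h2; rewrite !IHn; ring. Qed.

Lemma bernstein_le n h1 h2 u : 0 <= u <= 1 -> (forall j, h1 j <= h2 j) ->
  bernstein n h1 u <= bernstein n h2 u.
Proof.
move=> /andP[u0 u1]; elim: n h1 h2 => [|n IHn] h1 h2 h12 //=.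
by rewrite lerD// ler_wpM2l// ?subr_ge0// IHn.
Qed.

Lemma bernstein_norm n h u : 0 <= u <= 1 ->
  `|bernstein n h u| <= bernstein n (fun j => `|h j|) u.
Proof.
move=> u01; rewrite ler_norml; apply/andP; split; last first.
  by apply: bernstein_le => // j; exact: ler_norm.
have -> : - bernstein n (fun j => `|h j|) u
    = bernstein n (fun j => (-1) * `|h j| + 0) u.
  by rewrite bernstein_lin bernstein_cst mulN1r addr0.
by apply: bernstein_le => // j; rewrite mulN1r addr0 lerNl ler_normr lexx orbT.
Qed.

(** The variance of a binomial variable about an arbitrary centre: leaving [c]
    free absorbs the shift of [h] in the recursion. *)
Lemma bernstein_variance n c u :
  bernstein n (fun j => (j%:R - c) ^+ 2) u
  = n%:R * u * (1 - u) + (n%:R * u - c) ^+ 2.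
Proof.
elim: n c => [|n IHn] c /=; first by ring.
have -> : (fun j : nat => (j.+1%:R - c) ^+ 2)
        = (fun j : nat => (j%:R - (c - 1)) ^+ 2).
  by apply/funext => j; rewrite -natr1; ring.
by rewrite !IHn -natr1; ring.
Qed.

(** Chebyshev's argument at one point: a bounded function continuous at [u]
    differs from [G u] by at most e / 2 + K (v - u)^2, and the expectation of the
    quadratic term is a variance divided by n^2.  Pointwise convergence is enough
    because it is integrated by dominated convergence. *)
Lemma bernstein_cvg (G : R -> R) (M u : R) : (forall v, `|G v| <= M) ->
  0 <= u <= 1 -> {for u, continuous G} ->
  bernstein n.+1 (fun j => G (j%:R / n.+1%:R)) u @[n --> \oo] --> G u.
Proof.
move=> GM u01 cG; apply/cvgrPdist_le => e e0.
have e20 : 0 < e / 2 by rewrite divr_gt0.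
move/cvgrPdist_le : cG => /(_ _ e20) [d /= d0 Gd].
have M0 : 0 <= M by rewrite (le_trans _ (GM 0)).
pose K := 2 * M / d ^+ 2.
have K0 : 0 <= K by rewrite divr_ge0 ?sqr_ge0// mulr_ge0.
have GK v : `|G v - G u| <= K * (v - u) ^+ 2 + e / 2.
  have [vd|vd] := ltP `|u - v| d.
    rewrite distrC (le_trans (Gd v vd))// lerDr mulr_ge0// sqr_ge0//.
  rewrite (le_trans (ler_normB _ _))//.
  have d2 : 0 < d ^+ 2 by rewrite exprn_gt0.
  have : 2 * M <= K * (v - u) ^+ 2.
    rewrite -mulrA ler_peMr ?mulr_ge0// ler_pdivlMl// mulr1.
    by rewrite -[leRHS]real_normK ?num_real// distrC lerXn2r ?nnegrE// ltW.
  have := GM v; have := GM u; lra.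
near=> n.
have n0 : 0 < n.+1%:R :> R by [].
rewrite distrC.
have -> : bernstein n.+1 (fun j => G (j%:R / n.+1%:R)) u - G u =
  bernstein n.+1 (fun j => 1 * G (j%:R / n.+1%:R) + (- G u)) u.
  by rewrite bernstein_lin bernstein_cst mul1r.
apply: (le_trans (bernstein_norm _ _ u01)).
apply: (@le_trans _ _ (bernstein n.+1 (fun j =>
   (K / n.+1%:R ^+ 2) * (j%:R - n.+1%:R * u) ^+ 2 + e / 2) u)).
  apply: bernstein_le => // j; rewrite mul1r (le_trans (GK _))// lerD2r.
  rewrite -mulrA ler_wpM2l//.
  rewrite (_ : j%:R / n.+1%:R - u = (j%:R - n.+1%:R * u) / n.+1%:R).
    by rewrite exprMn mulrC exprVn.
  by field; rewrite addrC natr1 pnatr_eq0.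
rewrite bernstein_lin bernstein_cst bernstein_variance subrr expr0n/= addr0.
rewrite [leRHS]splitr lerD2r.
have -> : K / n.+1%:R ^+ 2 * (n.+1%:R * u * (1 - u))
   = K * (u * (1 - u)) / n.+1%:R by field; rewrite addrC natr1 pnatr_eq0.
rewrite ler_pdivrMr//.
apply: (@le_trans _ _ K).
  move: u01 => /andP[u0 u1]; rewrite ler_piMr//; nra.
rewrite -ler_pdivrMl// mulrC.
apply: (@le_trans _ _ n%:R); last by rewrite ler_nat.
by near: n; exact: nbhs_infty_ger.
Unshelve. all: by end_near.
Qed.

End Bernstein.

Section CosineSpan.
Variable R : realType.
Local Notation mu := (@lebesgue_measure R).
Local Notation I := (@I0pi R).
Implicit Types (f g : R -> R) (p : {poly R}).

(** Polynomials serve as finitely supported coefficient families. *)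
Definition cospoly p (x : R) : R := \sum_(k < size p) p`_k * cos (k%:R * x).

Definition cosspan f : Prop := exists p, forall x, f x = cospoly p x.

Lemma cospolyE n p x : (size p <= n)%N ->
  cospoly p x = \sum_(k < n) p`_k * cos (k%:R * x).
Proof.
move=> pn; rewrite /cospoly (big_ord_widen _ (fun k => p`_k * cos (k%:R * x)) pn).
rewrite big_mkcond/=; apply: eq_bigr => k _; case: ifPn => //.
by rewrite -leqNgt => ?; rewrite nth_default// mul0r.
Qed.

Lemma cosspanD f g : cosspan f -> cosspan g -> cosspan (fun x => f x + g x).
Proof.
move=> [p fp] [q gq]; exists (p + q) => x; rewrite fp gq.
rewrite !(@cospolyE (maxn (size p) (size q))) ?leq_maxl ?leq_maxr ?size_polyD//.
by rewrite -big_split/=; apply: eq_bigr => k _; rewrite coefD mulrDl.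
Qed.

Lemma cosspanZ c f : cosspan f -> cosspan (fun x => c * f x).
Proof.
move=> [p fp]; exists (c *: p) => x; rewrite fp.
rewrite !(@cospolyE (size p)) ?size_scale_leq// mulr_sumr.
by apply: eq_bigr => k _; rewrite coefZ mulrA.
Qed.

Lemma cosspan_cos k : cosspan (fun x => cos (k%:R * x)).
Proof.
exists 'X^k => x; rewrite (@cospolyE k.+1) ?size_polyXn// big_ord_recr/=.
rewrite coefXn eqxx mul1r big1 ?add0r// => i _.
by rewrite coefXn ltn_eqF// mul0r.
Qed.

Lemma cosspan_cst c : cosspan (fun=> c).
Proof.
have [p hp] := cosspanZ c (cosspan_cos 0); exists p => x.
by rewrite -hp mul0r cos0 mulr1.
Qed.

(** Stability under multiplication by the cosine turns Bernstein polynomials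
    in cos x into cosine polynomials. *)
Lemma cosspan_mulcos f : cosspan f -> cosspan (fun x => cos x * f x).
Proof.
move=> [p fp].
suff H n : cosspan (fun x => \sum_(k < n) p`_k * (cos x * cos (k%:R * x))).
  have [q hq] := H (size p); exists q => x; rewrite -hq fp mulr_sumr.
  by apply: eq_bigr => k _; rewrite mulrCA.
elim: n => [|n [q hq]].
  by have [q hq] := cosspan_cst 0; exists q => x; rewrite -hq big_ord0.
have cn : cosspan (fun x => cos x * cos (n%:R * x)).
  case: n {q hq} => [|n].
    have [q hq] := cosspan_cos 1; exists q => x.
    by rewrite -hq mul0r cos0 mulr1 mul1r.
  have [q hq] := cosspanZ 2^-1 (cosspanD (cosspan_cos n) (cosspan_cos n.+2)).
  exists q => x; rewrite -hq.
  have -> : n%:R * x = n.+1%:R * x - x by rewrite -[n.+1%:R]natr1; ring.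
  have -> : n.+2%:R * x = n.+1%:R * x + x by rewrite -[n.+2%:R]natr1; ring.
  by rewrite cosB cosD; field.
have [r hr] := cosspanD (ex_intro _ q hq) (cosspanZ p`_n cn).
by exists r => x; rewrite -hr big_ord_recr/=.
Qed.

Lemma cosspan_bernstein n (h : nat -> R) :
  cosspan (fun x => bernstein n h ((1 + cos x) / 2)).
Proof.
elim: n h => [|n IHn] h /=; first exact: cosspan_cst.
have H1 := IHn h; have H2 := IHn (fun j => h j.+1).
have [p hp] := cosspanZ 2^-1 (cosspanD (cosspanD H1 (cosspanZ (-1)
  (cosspan_mulcos H1))) (cosspanD H2 (cosspan_mulcos H2))).
by exists p => x; rewrite -hp; field.
Qed.

Lemma continuous_cosM (c : R) : continuous (fun x : R => cos (c * x)).
Proof.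
move=> x; apply: continuous_comp; last exact: continuous_cos.
exact: mulrl_continuous.
Qed.

Lemma measurable_continuous f (D : set R) : continuous f -> measurable_fun D f.
Proof. by move=> cf; apply: measurable_funTS; exact: continuous_measurable_fun. Qed.

Lemma measurable_cospoly p : measurable_fun I (cospoly p).
Proof.
rewrite /cospoly; apply: measurable_sum => k; apply: measurable_funM => //.
by apply: measurable_continuous; exact: continuous_cosM.
Qed.

Lemma normr_cos_le1 (x : R) : `|cos x| <= 1.
Proof. by rewrite ler_norml cos_geN1 cos_le1. Qed.

Lemma cosspan_L2 f : cosspan f -> L2pi f.
Proof.
move=> [p fp]; rewrite (_ : f = cospoly p); last exact/funext.
apply: (@L2pi_bounded _ (\sum_(k < size p) `|p`_k|)).
  exact: measurable_cospoly.
move=> x _; rewrite (le_trans (ler_norm_sum _ _ _))//; apply: ler_sum => k _.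
by rewrite normrM ler_piMr// normr_cos_le1.
Qed.

Definition clamp (M y : R) := Num.max (- M) (Num.min M y).

Lemma clamp_le M y : 0 <= M -> `|clamp M y| <= M.
Proof.
move=> M0; rewrite /clamp ler_norml le_max lexx/= ge_max ge_min lexx/=.
by rewrite andbT; lra.
Qed.

Lemma clamp_dist M y z : 0 <= M -> `|y| <= M -> `|y - clamp M z| <= `|y - z|.
Proof.
rewrite ler_norml /clamp => M0 /andP[y1 y2].
have [zM|zM] := leP M z.
  have /max_idPr -> : - M <= M by lra.
  by rewrite [leRHS]distrC [`|y - M|]distrC !ger0_norm; lra.
have [zM'|zM'] := leP (- M) z; first by [].
by rewrite !ger0_norm; lra.
Qed.

Lemma clamp_id M y : `|y| <= M -> clamp M y = y.
Proof.
rewrite ler_norml /clamp => /andP[y1 y2].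
have /min_idPr -> := y2; exact/max_idPr.
Qed.

Lemma continuous_clamp M f : continuous f -> continuous (fun x => clamp M (f x)).
Proof.
move=> cf x.
apply: (@continuous_max _ _ (fun=> - M) (fun x => Num.min M (f x))).
  exact: cst_continuous.
apply: (@continuous_min _ _ (fun=> M) f); first exact: cst_continuous.
exact: cf.
Qed.

Lemma measurable_clamp M f : measurable_fun I f ->
  measurable_fun I (fun x => clamp M (f x)).
Proof.
move=> mf; have : measurable_fun [set: R] (clamp M).
  apply: measurable_continuous; apply: (@continuous_clamp M idfun).
  by move=> x; exact: cvg_id.
by move=> H; exact: measurableT_comp H mf.
Qed.

Lemma sqr_sum_le (a b : R) : (a + b) ^+ 2 <= 2 * a ^+ 2 + 2 * b ^+ 2.
Proof.
rewrite -subr_ge0 (_ : _ - _ = (a - b) ^+ 2); first exact: sqr_ge0.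
by ring.
Qed.

Lemma L2pi_dense_sum f g h (e1 e2 : R) : L2pi f -> L2pi g -> L2pi h ->
  \int[mu]_(x in I) ((f x - g x) ^+ 2) < e1 ->
  \int[mu]_(x in I) ((g x - h x) ^+ 2) < e2 ->
  \int[mu]_(x in I) ((f x - h x) ^+ 2) < 2 * e1 + 2 * e2.
Proof.
move=> f2 g2 h2 fg gh.
have [_ fgi] := L2piB f2 g2; have [_ ghi] := L2piB g2 h2.
have [_ fhi] := L2piB f2 h2.
apply: (@le_lt_trans _ _ (\int[mu]_(x in I)
    (2 * (f x - g x) ^+ 2 + 2 * (g x - h x) ^+ 2))).
  apply: int_le => //; first by apply: L1piD; exact: L1piZ.
  by move=> x _; rewrite -(subrKA (g x)); exact: sqr_sum_le.
rewrite intD ?intZ//; [|exact: L1piZ..].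
by rewrite ltrD// ltr_pM2l.
Qed.

(** The variable is changed to u = (1 + cos x) / 2, so that Bernstein
    polynomials in u become cosine polynomials in x. *)
Lemma cosspan_dense_continuous (M : R) g (e : R) : 0 < e -> continuous g ->
  (forall x, `|g x| <= M) ->
  exists2 phi, cosspan phi & \int[mu]_(x in I) ((g x - phi x) ^+ 2) < e.
Proof.
move=> e0 cg gM.
pose G (u : R) := g (acos (2 * u - 1)).
pose phi n x := bernstein n.+1 (fun j => G (j%:R / n.+1%:R)) ((1 + cos x) / 2).
have u01 (x : R) : 0 <= (1 + cos x) / 2 <= 1.
  by have := cos_le1 x; have := cos_geN1 x; move=> *; apply/andP; split; lra.
have phis n : cosspan (phi n) by exact: cosspan_bernstein.
have M0 : 0 <= M by rewrite (le_trans _ (gM 0)).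
have phiM n x : `|phi n x| <= M.
  rewrite (le_trans (bernstein_norm _ _ (u01 x)))//.
  rewrite -[leRHS](bernstein_cst n.+1 M ((1 + cos x) / 2)).
  by apply: bernstein_le => // j; exact: gM.
have mg : measurable_fun I g by exact: measurable_continuous.
have [n hn] : exists n, `|\int[mu]_(x in I) ((g x - phi n x) ^+ 2)| < e.
  apply: (@dominated_small _ _ (fun=> (M + M) ^+ 2)) => //.
  - move=> n; apply: measurable_funX; apply: measurable_funB => //.
    by case: (cosspan_L2 (phis n)).
  - exact: L1pi_cst.
  - move=> n x _; rewrite normrX lerXn2r ?nnegrE ?addr_ge0//.
    by rewrite (le_trans (ler_normB _ _))// lerD.
  - move=> x; rewrite /I0pi/= in_itv/= => /andP[x0 xpi].
    rewrite (_ : 0 = (g x - g x) ^+ 2); last by rewrite subrr expr0n.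
    have xE : acos (2 * ((1 + cos x) / 2) - 1) = x.
      rewrite (_ : 2 * _ - 1 = cos x); last by field.
      by rewrite cosK// in_itv/= !ltW.
    have : phi ^~ x @ \oo --> g x.
      rewrite -[in X in _ --> X]xE; apply: bernstein_cvg => //.
        by move=> v; exact: gM.
      apply: continuous_comp; last exact: cg.
      apply: continuous_comp.
        apply: continuousB; last exact: cst_continuous.
        exact: mulrl_continuous.
      apply: continuous_acos; rewrite (_ : 2 * _ - 1 = cos x); last by field.
      have xI : x \in `[0, pi] by rewrite in_itv/= !ltW.
      apply/andP; split; [rewrite -cospi|rewrite -cos0];
        by rewrite ltr_cos// in_itv/= lexx pi_ge0.
    move=> h; apply: cvgM; (apply: cvgB; [exact: cvg_cst|exact: h]).
by exists (phi n) => //; exact: le_lt_trans (ler_norm _) hn.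
Qed.

(** Continuous functions are dense for the L^1 distance; once the approximant is
    clamped at the bound of [f], the squared distance is at most 2 M times the
    L^1 distance. *)
Lemma cosspan_dense_bounded (M : R) f (e : R) : 0 < e -> measurable_fun I f ->
  (forall x, I x -> `|f x| <= M) ->
  exists2 phi, cosspan phi & \int[mu]_(x in I) ((f x - phi x) ^+ 2) < e.
Proof.
move=> e0 mf fM.
have M0 : 0 <= M.
  have xI : I (pi / 2) by rewrite /I0pi/= in_itv/=; have := pi_gt0 R; move=> *; apply/andP; split; lra.
  by rewrite (le_trans _ (fM _ xI)).
have fi := L1pi_bounded mf fM.
have [g_ [cg gi gf]] := approximation_continuous_integrable
  (@measurable_I0pi R) (@I0pi_finite R) fi.
have e1 : 0 < e / 4 / (2 * M + 1) by rewrite !divr_gt0//; lra.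
move: gf => /fine_cvgP[fin /cvgrPdist_lt/(_ _ e1) gf].
have [n [gn finn]] : exists n, `|\int[mu]_(x in I) `|f x - g_ n x| |
   < e / 4 / (2 * M + 1) /\ True.
  near \oo => n; exists n; split => //.
  have : `|0 - fine (\int[mu]_(x in I) `|(f x - g_ n x)%:E|)%E|
    < e / 4 / (2 * M + 1) by near: n.
  by rewrite sub0r normrN.
pose g x := clamp M (g_ n x).
have cg' : continuous g by exact: continuous_clamp.
have gM x : `|g x| <= M by exact: clamp_le.
have g2 : L2pi g by apply: (@L2pi_bounded _ M) => //; exact: measurable_continuous.
have f2 : L2pi f by exact: (@L2pi_bounded _ M).
have e4 : 0 < e / 4 by lra.
have [phi phis hphi] := cosspan_dense_continuous e4 cg' gM.
exists phi => //.
rewrite (_ : e = 2 * (e / 4) + 2 * (e / 4)); last by field.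
have phi2 := cosspan_L2 phis.
apply: L2pi_dense_sum hphi => //.
have dfi : L1pi (fun x => `|f x - g_ n x|).
  exact: (L1pi_norm (L1piB fi (gi n))).
apply: (@le_lt_trans _ _ (\int[mu]_(x in I) ((2 * M + 1) * `|f x - g_ n x|))).
  apply: int_le => //; [by case: (L2piB f2 g2)|exact: L1piZ|].
  move=> x xI; rewrite -real_normK ?num_real// expr2.
  apply: ler_pM => //; last by apply: clamp_dist => //; exact: fM.
  rewrite (le_trans (ler_normB _ _))//.
  by have := fM _ xI; have := gM x; lra.
rewrite intZ// -ltr_pdivlMl; last lra.
by rewrite mulrC; exact: le_lt_trans (ler_norm _) gn.
Unshelve. all: by end_near.
Qed.

(** Truncation at a large height reduces the claim to bounded functions. *)
Lemma cosspan_dense f (e : R) : 0 < e -> L2pi f ->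
  exists2 phi, cosspan phi & \int[mu]_(x in I) ((f x - phi x) ^+ 2) < e.
Proof.
move=> e0 f2; have [mf fi] := f2.
have e4 : 0 < e / 4 by lra.
have mc (n : nat) := measurable_clamp n%:R mf.
have [n hn] : exists n : nat,
    `|\int[mu]_(x in I) ((f x - clamp n%:R (f x)) ^+ 2)| < e / 4.
  apply: (@dominated_small _ _ (fun x => f x ^+ 2)) => //.
  - by move=> n; apply: measurable_funX; exact: measurable_funB.
  - move=> n x _; rewrite ger0_norm ?sqr_ge0// -[leLHS]real_normK ?num_real//.
    rewrite -[leRHS]real_normK ?num_real// lerXn2r ?nnegrE//.
    rewrite /clamp; have n0 : 0 <= n%:R :> R by [].
    have [nf|nf] := leP n%:R (f x).
      have /max_idPr -> : - n%:R <= n%:R :> R by lra.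
      by rewrite !ger0_norm; lra.
    have [nf'|nf'] := leP (- n%:R) (f x); first by rewrite subrr normr0.
    by rewrite !ler0_norm; lra.
  - move=> x _; apply: (@cvg_near_cst _ _ 0).
    near=> n; rewrite clamp_id ?subrr ?expr0n//.
    by near: n; exact: nbhs_infty_ger.
have cM x : I x -> `|clamp n%:R (f x)| <= n%:R by move=> _; exact: clamp_le.
have [phi phis hphi] := cosspan_dense_bounded e4 (mc n) cM.
exists phi => //.
rewrite (_ : e = 2 * (e / 4) + 2 * (e / 4)); last by field.
apply: L2pi_dense_sum hphi => //.
- by apply: (@L2pi_bounded _ n%:R).
- exact: cosspan_L2.
- exact: le_lt_trans (ler_norm _) hn.
Unshelve. all: by end_near.
Qed.

End CosineSpan.

(** * The cosine and sine systems *)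

Section Trigonometric.
Variable R : realType.
Local Notation mu := (@lebesgue_measure R).
Local Notation I := (@I0pi R).
Implicit Types (f g : R -> R).

Lemma int_closed f : measurable_fun I f ->
  \int[mu]_(x in I) f x = \int[mu]_(x in `[0, pi]) f x.
Proof.
move=> mf; rewrite /Rintegral; congr fine; apply/esym.
by apply: integral_itv_bndoo; exact/measurable_EFinP.
Qed.

Lemma L1pi_cos (c : R) : L1pi (fun x => cos (c * x)).
Proof.
apply: (@L1pi_bounded _ 1); last by move=> x _; exact: normr_cos_le1.
by apply: measurable_continuous; exact: continuous_cosM.
Qed.

Lemma continuous_sinM (c : R) : continuous (fun x : R => sin (c * x)).
Proof.
move=> x; apply: continuous_comp; last exact: continuous_sin.
exact: mulrl_continuous.
Qed.

Lemma sin_mulpi (k : nat) : sin (k%:R * pi) = 0 :> R.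
Proof.
elim: k => [|k IHk]; first by rewrite mul0r sin0.
by rewrite -natr1 mulrDl mul1r sinDpi IHk oppr0.
Qed.

Lemma is_derive_sinM (c x : R) :
  is_derive x 1 (fun y => sin (c * y)) (c * cos (c * x)).
Proof.
have H : is_derive x 1 (fun y : R => c * y) c.
  by apply: is_derive_eq; rewrite /GRing.scale/= mulr1.
by apply: is_derive_eq; rewrite /GRing.scale/= mulrC.
Qed.

Lemma is_derive_cosM (c x : R) :
  is_derive x 1 (fun y => cos (c * y)) (- c * sin (c * x)).
Proof.
have H : is_derive x 1 (fun y : R => c * y) c.
  by apply: is_derive_eq; rewrite /GRing.scale/= mulr1.
by apply: is_derive_eq; rewrite /GRing.scale/= mulrC mulNr mulrN.
Qed.

Lemma int_cos (k : nat) :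
  \int[mu]_(x in I) cos (k%:R * x) = if k == 0%N then pi else 0.
Proof.
case: eqP => [->|/eqP k0].
  by under eq_int do rewrite mul0r cos0; rewrite int_cst mul1r.
have k1 : k%:R != 0 :> R by rewrite pnatr_eq0.
rewrite int_closed; last by apply: measurable_continuous; exact: continuous_cosM.
have der (x : R) : is_derive x 1 (fun y : R => k%:R^-1 * sin (k%:R * y)) (cos (k%:R * x)).
  have H := is_derive_sinM k%:R x.
  by apply: is_derive_eq; rewrite /GRing.scale/= mulrA mulVf// mul1r.
rewrite /Rintegral (@continuous_FTC2 _ _ (fun y : R => k%:R^-1 * sin (k%:R * y))).
- by rewrite sin_mulpi !mulr0 sin0 mulr0 subee.
- exact: pi_gt0.
- by apply: continuous_subspaceT; exact: continuous_cosM.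
- have cs : continuous (fun y : R => k%:R^-1 * sin (k%:R * y)).
    by move=> x; apply: cvgM; [exact: cvg_cst|exact: continuous_sinM].
  split => //.
  + exact/cvg_at_right_filter/cs.
  + exact/cvg_at_left_filter/cs.
- by move=> x _; rewrite derive1E; exact: derive_val.
Qed.

Definition cosnorm2 (k : nat) : R := if k == 0%N then pi else pi / 2.

Lemma int_coscos (k l : nat) :
  \int[mu]_(x in I) (cos (k%:R * x) * cos (l%:R * x)) =
  if k == l then cosnorm2 k else 0.
Proof.
wlog kl : k l / (k <= l)%N.
  move=> H; have [kl|/ltnW lk] := leqP k l; first exact: H.
  have := H _ _ lk; rewrite eq_sym.
  under eq_int do rewrite mulrC.
  by move=> ->; case: eqP => // ->.
have E x : cos (k%:R * x) * cos (l%:R * x) =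
    2^-1 * (cos ((l - k)%N%:R * x) + cos ((l + k)%N%:R * x)) :> R.
  by rewrite natrB// natrD mulrBl mulrDl cosB cosD; field.
under eq_int do rewrite E.
rewrite intZ; last by apply: L1piD; exact: L1pi_cos.
rewrite intD; [|exact: L1pi_cos..].
rewrite !int_cos subn_eq0 addn_eq0 /cosnorm2.
have -> : (l <= k)%N = (k == l) by lia.
case: (eqVneq k l) => [<-|kl'].
  by rewrite andbb; case: ifP => _; field.
have -> : (l == 0)%N && (k == 0)%N = false by lia.
by rewrite addr0 mulr0.
Qed.

Lemma L1pi_coscos (k l : nat) :
  L1pi (fun x : R => cos (k%:R * x) * cos (l%:R * x)).
Proof.
apply: (@L1pi_mulb _ 1); first exact: L1pi_cos.
  by apply: measurable_continuous; exact: continuous_cosM.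
by move=> x _; exact: normr_cos_le1.
Qed.

Lemma int_cossum_sqr (n : nat) (p : nat -> R) :
  \int[mu]_(x in I) ((\sum_(k < n) p k * cos (k%:R * x)) ^+ 2) =
  \sum_(k < n) cosnorm2 k * p k ^+ 2.
Proof.
have E x : (\sum_(k < n) p k * cos (k%:R * x)) ^+ 2 =
    \sum_(k < n) \sum_(l < n) p k * p l * (cos (k%:R * x) * cos (l%:R * x)) :> R.
  rewrite expr2 mulr_suml; apply: eq_bigr => k _.
  by rewrite mulr_sumr; apply: eq_bigr => l _; rewrite mulrACA.
under eq_int do rewrite E.
have i1 k l : L1pi (fun x : R => p k * p l * (cos (k%:R * x) * cos (l%:R * x))).
  exact/L1piZ/L1pi_coscos.
rewrite (@int_sum _ n (fun k x => \sum_(l < n) p k * p l * (cos (k%:R * x) * cos (l%:R * x)))); last first.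
  by move=> k; exact: (@L1pi_sum _ n (fun l x => p k * p l * (cos (k%:R * x) * cos (l%:R * x)))).
apply: eq_bigr => k _.
rewrite (@int_sum _ n (fun l x => p k * p l * (cos (k%:R * x) * cos (l%:R * x))))//.
rewrite (bigD1 k)//= big1 ?addr0; last first.
  move=> l lk; rewrite intZ ?int_coscos; last exact: L1pi_coscos.
  by rewrite eq_sym (negbTE lk : (l == k :> nat) = false) mulr0.
by rewrite intZ ?int_coscos ?eqxx; [rewrite mulrC|exact: L1pi_coscos].
Qed.

Definition coscoef f (k : nat) : R := \int[mu]_(x in I) (f x * cos (k%:R * x)).

Lemma L1pi_mulcos f (k : nat) : L1pi f -> L1pi (fun x => f x * cos (k%:R * x)).
Proof.
move=> fi; apply: (@L1pi_mulb _ 1) => //.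
  by apply: measurable_continuous; exact: continuous_cosM.
by move=> x _; exact: normr_cos_le1.
Qed.

Lemma int_mul_cossum f (n : nat) (p : nat -> R) : L1pi f ->
  \int[mu]_(x in I) (f x * \sum_(k < n) p k * cos (k%:R * x)) =
  \sum_(k < n) p k * coscoef f k.
Proof.
move=> fi.
under eq_int => x _ do rewrite mulr_sumr.
have i1 k : L1pi (fun x => f x * (p k * cos (k%:R * x))).
  by apply: eq_L1pi (L1piZ (p k) (L1pi_mulcos k fi)) => x _; ring.
rewrite (@int_sum _ n (fun k x => f x * (p k * cos (k%:R * x))))//.
apply: eq_bigr => k _; rewrite -intZ; last exact: L1pi_mulcos.
by apply: eq_int => x _; ring.
Qed.

Lemma int_sub_cossum_sqr f (n : nat) (p : nat -> R) : L2pi f ->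
  \int[mu]_(x in I) ((f x - \sum_(k < n) p k * cos (k%:R * x)) ^+ 2) =
  \int[mu]_(x in I) (f x ^+ 2) - 2 * \sum_(k < n) p k * coscoef f k
    + \sum_(k < n) cosnorm2 k * p k ^+ 2.
Proof.
move=> f2; have fi := L2pi_L1 f2; rewrite -int_mul_cossum// -int_cossum_sqr.
have c2 : L2pi (fun x => \sum_(k < n) p k * cos (k%:R * x)).
  apply: cosspan_L2; exists (\poly_(k < n) p k) => x.
  rewrite (@cospolyE _ n) ?size_poly//.
  by apply: eq_bigr => k _; rewrite coef_poly ltn_ord.
have fc1 := L2piM f2 c2; case: (f2) (c2) => _ ff [_ cc].
have fc2 := L1piZ 2 fc1; have fc3 := L1piB ff fc2.
rewrite -intZ// -intB// -intD//.
by apply: eq_int => x _; ring.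
Qed.

Lemma cosnorm2_bounds k : pi / 2 <= cosnorm2 k <= pi.
Proof. by rewrite /cosnorm2; have := pi_gt0 R; case: ifP => _ ?; apply/andP; split; lra. Qed.

(** Bessel's inequality: the square of [f] minus 1 / pi times its cosine sum
    has a nonnegative integral, and every cosine has squared norm at most pi. *)
Lemma cos_bessel f (n : nat) : L2pi f ->
  \sum_(k < n) coscoef f k ^+ 2 <= pi * \int[mu]_(x in I) (f x ^+ 2).
Proof.
move=> f2; have p0 := pi_gt0 R.
have := @int_sub_cossum_sqr f n (fun k => pi^-1 * coscoef f k) f2.
have : 0 <= \int[mu]_(x in I)
   ((f x - \sum_(k < n) (pi^-1 * coscoef f k) * cos (k%:R * x)) ^+ 2).
  by apply: int_ge0 => x _; exact: sqr_ge0.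
set A := \int[mu]_(x in I) _; set B := \int[mu]_(x in I) _.
set S := \sum_(k < n) coscoef f k ^+ 2.
have -> : \sum_(k < n) pi^-1 * coscoef f k * coscoef f k = pi^-1 * S.
  by rewrite mulr_sumr; apply: eq_bigr => k _; rewrite -mulrA.
have : \sum_(k < n) cosnorm2 k * (pi^-1 * coscoef f k) ^+ 2 <= pi^-1 * S.
  rewrite mulr_sumr; apply: ler_sum => k _.
  have ck : cosnorm2 k / pi <= 1.
    by rewrite ler_pdivrMr// mul1r; case/andP: (cosnorm2_bounds k).
  have -> : cosnorm2 k * (pi^-1 * coscoef f k) ^+ 2
      = (cosnorm2 k / pi) * (pi^-1 * coscoef f k ^+ 2) by ring.
  by rewrite ler_piMl// mulr_ge0 ?sqr_ge0// invr_ge0 ltW.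
move=> h1 h2 h3; rewrite -ler_pdivrMl//; lra.
Qed.

(** Parseval's inequality in the direction that needs completeness.  For a
    cosine polynomial close to [f], completing the squares in its coefficients
    bounds the integral of f^2 by the squared cosine coefficients of [f]; density
    does the rest. *)
Lemma cos_parseval_le f (eta : nat -> R) (E : R) : L2pi f ->
  (forall k, coscoef f k ^+ 2 <= eta k) ->
  (forall n, \sum_(k < n) eta k <= E) ->
  \int[mu]_(x in I) (f x ^+ 2) <= 2 / pi * E.
Proof.
move=> f2 ce etaE; have p0 := pi_gt0 R.
apply/ler_addgt0Pr => e e0.
have [phi [p phip] hphi] := cosspan_dense e0 f2.
have := @int_sub_cossum_sqr f (size p) (fun k => p`_k) f2.
have -> : \int[mu]_(x in I) ((f x - \sum_(k < size p) p`_k * cos (k%:R * x)) ^+ 2)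
   = \int[mu]_(x in I) ((f x - phi x) ^+ 2).
  by apply: eq_int => x _; rewrite phip.
set A := \int[mu]_(x in I) _ in hphi *; set B := \int[mu]_(x in I) _.
set S1 := \sum_(k < _) _; set S2 := \sum_(k < _) _.
move=> h.
suff : 2 * S1 - S2 <= 2 / pi * E by lra.
apply: (@le_trans _ _ (2 / pi * \sum_(k < size p) eta k)); last first.
  by rewrite ler_wpM2l// divr_ge0// ltW.
rewrite /S1 /S2 !mulr_sumr -sumrB; apply: ler_sum => k _.
apply: (@le_trans _ _ (2 / pi * coscoef f k ^+ 2)); last first.
  by rewrite ler_wpM2l// divr_ge0// ltW.
set c := coscoef f k; set a := p`_k.
(* 2 a c - (pi / 2) a^2 is largest at a = 2 c / pi, where it is (2 / pi) c^2. *)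
apply: (@le_trans _ _ (2 * (a * c) - pi / 2 * a ^+ 2)).
  by rewrite lerB// ler_wpM2r ?sqr_ge0//; case/andP: (cosnorm2_bounds k).
rewrite -subr_ge0 (_ : _ - _ = (2 * pi)^-1 * (2 * c - pi * a) ^+ 2).
  by rewrite mulr_ge0 ?sqr_ge0// invr_ge0; lra.
move: (negbT (gt_eqF p0)); generalize (pi : R) => P P0.
by field.
Qed.

(** The cosine coefficients are square-summable by Bessel and the defects by
    hypothesis, so a constant that is the sum of the two has to vanish. *)
Lemma coscoef0_eq0 f (delta : nat -> R) (E : R) : L2pi f ->
  (forall k, coscoef f 0 - coscoef f k.+1 = delta k) ->
  (forall n, \sum_(k < n) delta k ^+ 2 <= E) ->
  coscoef f 0 = 0.
Proof.
move=> f2 cd dE.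
pose B := 2 * (pi * \int[mu]_(x in I) (f x ^+ 2)) + 2 * E.
have H n : n%:R * coscoef f 0 ^+ 2 <= B.
  have -> : n%:R * coscoef f 0 ^+ 2 = \sum_(k < n) coscoef f 0 ^+ 2.
    by rewrite sumr_const card_ord mulr_natl.
  apply: (@le_trans _ _ (\sum_(k < n) (2 * coscoef f k.+1 ^+ 2 + 2 * delta k ^+ 2))).
    apply: ler_sum => k _; rewrite -(subrK (coscoef f k.+1) (coscoef f 0)) cd addrC.
    exact: sqr_sum_le.
  rewrite big_split/= -!mulr_sumr; apply: lerD; rewrite ler_pM2l//.
    apply: le_trans (cos_bessel n.+1 f2).
    by rewrite big_ord_recl/= lerDr sqr_ge0.
  exact: dE.
apply/eqP; rewrite -sqrf_eq0 eq_le sqr_ge0 andbT leNgt; apply/negP => c0.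
have := H (Num.truncn (B / coscoef f 0 ^+ 2)).+1.
rewrite -ler_pdivlMr//; apply/negP; rewrite -ltNge.
exact: truncnS_gt.
Qed.

Section Sines.
Variable b : bool.

(** The square roots of the unperturbed eigenvalues for m = 1: integers for the
    Dirichlet problem, half-integers for the Dirichlet-Neumann one. *)
Definition frequency (j : nat) : R := j%:R + (if b then 2^-1 else 1).

Definition sn (j : nat) (x : R) : R := sin (frequency j * x).

Lemma freq_gt0 j : 0 < frequency j.
Proof.
have : 0 <= j%:R :> R by [].
by rewrite /frequency; case: b; lra.
Qed.

Lemma measurable_sn j (D : set R) : measurable_fun D (sn j).
Proof. by apply: measurable_continuous; exact: continuous_sinM. Qed.

Lemma sn_le1 j x : `|sn j x| <= 1.
Proof. by rewrite ler_norml sin_geN1 sin_le1. Qed.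

Lemma L1pi_mulsn f j : L1pi f -> L1pi (fun x => f x * sn j x).
Proof.
move=> fi; apply: (@L1pi_mulb _ 1) => //; first exact: measurable_sn.
by move=> x _; exact: sn_le1.
Qed.

Lemma int_snsn (i j : nat) :
  \int[mu]_(x in I) (sn i x * sn j x) = if i == j then pi / 2 else 0.
Proof.
wlog ij : i j / (i <= j)%N.
  move=> H; have [ij|/ltnW ji] := leqP i j; first exact: H.
  have := H _ _ ji; rewrite eq_sym.
  by under eq_int do rewrite mulrC.
pose c := if b then 1%N else 2%N.
have E x : sn i x * sn j x =
    2^-1 * (cos ((j - i)%N%:R * x) - cos ((j + i + c)%N%:R * x)).
  rewrite /sn.
  have -> : (j - i)%N%:R * x = frequency j * x - frequency i * x.
    by rewrite natrB// /frequency; ring.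
  have -> : (j + i + c)%N%:R * x = frequency j * x + frequency i * x.
    by rewrite !natrD /frequency /c; case: b; field.
  by rewrite cosB cosD; field.
under eq_int do rewrite E.
rewrite intZ; last by apply: L1piB; exact: L1pi_cos.
rewrite intB; [|exact: L1pi_cos..].
rewrite !int_cos subn_eq0 !addn_eq0.
have -> : (c == 0)%N = false by rewrite /c; case: b.
rewrite andbF subr0.
have -> : (j <= i)%N = (i == j) by lia.
by case: eqP => _; [rewrite mulrC|rewrite mulr0].
Qed.

(** Multiplication by the lowest sine maps sine coefficients to differences of
    consecutive ones, so completeness of the cosines gives that of the sines. *)
Lemma sn_complete f : L2pi f ->
  (forall j, \int[mu]_(x in I) (f x * sn j x) = 0) ->
  {ae mu, forall x, I x -> f x = 0}.
Proof.
move=> f2 fs; have fi := L2pi_L1 f2.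
pose g x := f x * sn 0 x.
have g2 : L2pi g.
  apply: (@L2pi_mulb _ 1) => //; first exact: measurable_sn.
  by move=> x _; exact: sn_le1.
have g0 k : coscoef g k = 0.
  have [j [s E]] : exists j, exists s : R, forall x,
     sn 0 x * cos (k%:R * x) = 2^-1 * sn k x + s * sn j x.
    rewrite /sn /frequency.
    case: k => [|k].
      by exists 0%N, 2^-1 => x; rewrite mul0r cos0 add0r; field.
    have F (c x : R) : sin (c * x) * cos (k.+1%:R * x)
       = 2^-1 * sin ((k.+1%:R + c) * x) - 2^-1 * sin ((k.+1%:R - c) * x).
      by rewrite mulrDl mulrBl sinD sinB; field.
    case: b.
      exists k, (- 2^-1) => x; rewrite add0r F mulNr.
      by congr (_ - _ * sin (_ * _)); rewrite -natr1; field.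
    case: k F => [|k] F.
      exists 0%N, 0 => x; rewrite add0r F mul0r addr0.
      by rewrite subrr mul0r sin0 mulr0 subr0.
    exists k, (- 2^-1) => x; rewrite add0r F mulNr.
    by congr (_ - _ * sin (_ * _)); rewrite -[k.+2%:R]natr1 addrK natr1.
  have -> : coscoef g k =
      \int[mu]_(x in I) (2^-1 * (f x * sn k x) + s * (f x * sn j x)).
    by apply: eq_int => x _; rewrite /g -mulrA E; ring.
  rewrite intD ?intZ; [|exact/L1pi_mulsn|exact/L1pi_mulsn|exact/L1piZ/L1pi_mulsn..].
  by rewrite !fs !mulr0 addr0.
have gg : \int[mu]_(x in I) (g x ^+ 2) = 0.
  apply/eqP; rewrite eq_le int_ge0 ?andbT; last by move=> x _; exact: sqr_ge0.
  rewrite -[leRHS](mulr0 (2 / pi)).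
  apply: (@cos_parseval_le _ (fun=> 0)) => //.
    by move=> k; rewrite g0 expr0n.
  by move=> n; rewrite big1.
have gae := int_sqr_eq0 g2 gg.
apply: ae_imply gae => x gx xI; move: (gx xI) => /eqP.
rewrite mulf_eq0 => /orP[/eqP//|].
rewrite gt_eqF// /sn sin_gt0_pi//.
move: xI; rewrite /I0pi/= in_itv/= => /andP[x0 xpi].
rewrite mulr_gt0 ?freq_gt0//= (le_lt_trans _ xpi)// ler_piMl ?(ltW x0)//.
by rewrite /frequency add0r; case: b; lra.
Qed.

End Sines.

End Trigonometric.

(** * Absolutely continuous functions and integration by parts *)

Section AbsoluteContinuity.
Variable R : realType.
Local Notation mu := (@lebesgue_measure R).
Local Notation I := (@I0pi R).
Implicit Types (f g h F : R -> R).

Definition primitive0 F g : Prop :=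
  mu.-integrable `[0, pi] (EFin \o g) /\
  forall x : R, x \in `[0, pi] -> F x = F 0 + \int[mu]_(t in `[0, x]) g t.

Lemma integrable_closed g : mu.-integrable `[0, pi] (EFin \o g) <-> L1pi g.
Proof.
split=> [|gi].
  apply: integrableS => //; first exact: measurable_itv.
  by apply: subset_itvScc; rewrite bnd_simp.
have /integrableP[mg gfin] := gi.
apply/integrableP; split.
  apply/measurable_EFinP/measurable_fun_itv_bndo_bndcP.
  exact/measurable_fun_itv_obnd_cbndP/measurable_EFinP.
rewrite integral_itv_bndoo//; apply: measurableT_comp => //; exact: mg.
Qed.

Lemma integrable_initial g (x : R) : L1pi g -> x \in `[0, pi] ->
  mu.-integrable `[0, x] (EFin \o g).
Proof.
move=> /integrable_closed gi; rewrite in_itv/= => /andP[x0 xpi].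
apply: integrableS gi => //.
by apply: subset_itvl; rewrite bnd_simp.
Qed.

Lemma int_initial_bound g (x : R) : L1pi g -> x \in `[0, pi] ->
  `|\int[mu]_(t in `[0, x]) g t| <= \int[mu]_(t in I) `|g t|.
Proof.
move=> gi xpi; have gx := integrable_initial gi xpi.
have gi' := L1pi_norm gi.
have mx : measurable (`[0, x]%classic : set (measurableTypeR R)).
  exact: measurable_itv.
have mpi : measurable (`[0, pi]%classic : set (measurableTypeR R)).
  exact: measurable_itv.
apply: (le_trans (le_normr_Rintegral mx gx)).
rewrite int_closed; last exact: L1pi_measurable.
have gc : mu.-integrable `[0, pi] (EFin \o (fun t => `|g t|)).
  exact/integrable_closed.
apply: fine_le.
- have gn := integrable_norm gx; exact: (integrable_fin_num mx gn).
- exact: (integrable_fin_num mpi gc).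
- apply: ge0_subset_integral => //.
  + by case/integrableP: gc.
  + by move: xpi; rewrite in_itv/= => /andP[_ ?]; apply: subset_itvl; rewrite bnd_simp.
Qed.

Section Primitive.
Variables F g : R -> R.
Hypothesis Fg : primitive0 F g.

Lemma primitive_L1 : L1pi g.
Proof. by apply/integrable_closed; case: Fg. Qed.

Lemma primitive_bounded x : x \in `[0, pi] ->
  `|F x| <= `|F 0| + \int[mu]_(t in I) `|g t|.
Proof.
move=> xpi; rewrite (proj2 Fg)// (le_trans (ler_normD _ _))// lerD2l.
exact: int_initial_bound primitive_L1 xpi.
Qed.

Lemma primitive_measurable : measurable_fun I F.
Proof.
have mc : measurable_fun `[0, pi] (fun x => F 0 + \int[mu]_(t in `[0, x]) g t).
  apply: measurable_funD; first exact: measurable_cst.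
  apply: subspace_continuous_measurable_fun; first exact: measurable_itv.
  by apply: parameterized_integral_continuous; [exact: pi_ge0|case: Fg].
have {}mc : measurable_fun I (fun x => F 0 + \int[mu]_(t in `[0, x]) g t).
  apply: measurable_funS mc; first exact: measurable_itv.
  by apply: subset_itvScc; rewrite bnd_simp.
apply: eq_measurable_fun mc => x; rewrite inE /I0pi/= => xI.
apply/esym/(proj2 Fg); move: xI; rewrite !in_itv/= => /andP[? ?].
by rewrite !ltW.
Qed.

Lemma primitive_L2 : L2pi F.
Proof.
apply: (L2pi_bounded primitive_measurable) => x xI.
apply: primitive_bounded; move: xI; rewrite /I0pi/= !in_itv/= => /andP[? ?].
by rewrite !ltW.
Qed.

End Primitive.

Section Parts.
Variables (phi psi : R -> R) (M : R).
Hypothesis dphi : forall x : R, is_derive x 1 phi (psi x).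
Hypothesis cpsi : continuous psi.
Hypothesis phiM : forall x, `|phi x| <= M.
Hypothesis psiM : forall x, `|psi x| <= M.

Let cphi : continuous phi.
Proof.
move=> x; apply: differentiable_continuous; apply/derivable1_diffP.
by case: (dphi x).
Qed.

Lemma parts_continuous h (c : R) : continuous h ->
  let H x := c + \int[mu]_(t in `[0, x]) h t in
  \int[mu]_(x in `[0, pi]) (phi x * h x) =
  phi pi * H pi - phi 0 * H 0 - \int[mu]_(x in `[0, pi]) (psi x * H x).
Proof.
move=> ch H.
have hi : mu.-integrable `[0, pi] (EFin \o h).
  apply: continuous_compact_integrable; first exact: segment_compact.
  exact: continuous_subspaceT.
have hi1 : mu.-integrable `[0, pi + 1] (EFin \o h).
  apply: continuous_compact_integrable; first exact: segment_compact.
  exact: continuous_subspaceT.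
have p0 := pi_gt0 R.
have dH (x : R) : x \in `]0, pi[ -> is_derive x 1 H (h x).
  rewrite in_itv/= => /andP[x0 xpi].
  have [d1 d2] := @continuous_FTC1_closed _ h 0 x pi xpi hi x0 (ch x).
  have d3 : is_derive x 1 (fun y => \int[mu]_(t in `[0, y]) h t) (h x).
    by split; [exact: d1|rewrite -derive1E; exact: d2].
  by have := is_deriveD (is_derive_cst c x 1) d3; rewrite add0r.
apply: (@Rintegration_by_parts _ phi H psi h 0 pi) => //.
- exact: continuous_subspaceT.
- split => //; [exact/cvg_at_right_filter/cphi|exact/cvg_at_left_filter/cphi].
- by move=> x _; rewrite derive1E; exact: derive_val.
- exact: continuous_subspaceT.
- split.
  + by move=> x /dH[].
  + rewrite /H set_itv1 Rintegral_set1 addr0 -[X in _ --> X]addr0.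
    apply: cvgD; first exact: cvg_cst.
    apply: cvg_at_right_filter.
    exact: (@parameterized_integral_cvg_left _ 0 pi h p0 hi).
  + apply: cvgD; first exact: cvg_cst.
    exact: (@parameterized_integral_cvg_at_left _ 0 pi h p0 hi).
- by move=> x /dH H'; rewrite derive1E; exact: derive_val.
Qed.

(** Both sides are continuous in [g] for the L^1 norm, uniformly in the
    corresponding primitives, so the classical formula for continuous [g]
    extends to all integrable [g]. *)
Lemma parts F g : primitive0 F g ->
  \int[mu]_(x in I) (g x * phi x) =
  F pi * phi pi - F 0 * phi 0 - \int[mu]_(x in I) (F x * psi x).
Proof.
move=> Fg; have p0 := pi_gt0 R; have gi := primitive_L1 Fg.
have M0 : 0 <= M by rewrite (le_trans _ (phiM 0)).
have mphi : measurable_fun I phi by exact: measurable_continuous.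
have mpsi : measurable_fun I psi by exact: measurable_continuous.
set X := LHS; set Y := RHS.
suff H e : 0 < e -> `|X - Y| <= e * (2 * M + M * pi).
  apply/eqP; rewrite -subr_eq0 -normr_eq0 eq_le normr_ge0 andbT.
  apply/ler_addgt0Pl => e e0; rewrite addr0.
  have Mp : 0 <= M * pi by rewrite mulr_ge0// ltW.
  have C0 : 0 < 2 * M + M * pi + 1 by lra.
  have := H (e / (2 * M + M * pi + 1)); rewrite divr_gt0// => /(_ erefl).
  move=> /le_trans; apply; rewrite mulrAC ler_pdivrMr// ler_wpM2l ?(ltW e0)//; lra.
move=> e0.
have [g_ [cg _ gf]] := approximation_continuous_integrable
  (@measurable_I0pi R) (@I0pi_finite R) gi.
move: gf => /fine_cvgP[_ /cvgrPdist_lt/(_ _ e0)[n _ /(_ n (leqnn n))]].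
rewrite /= sub0r normrN => gn.
have {}gn : \int[mu]_(x in I) `|g x - g_ n x| <= e.
  by apply: ltW; apply: le_lt_trans gn; exact: ler_norm.
move: (cg n) gn; set h := g_ n => ch gn.
pose H x := F 0 + \int[mu]_(t in `[0, x]) h t.
have hi : L1pi h.
  apply/integrable_closed; apply: continuous_compact_integrable.
    exact: segment_compact.
  exact: continuous_subspaceT.
have Hh : primitive0 H h.
  split; first exact/integrable_closed.
  by move=> x xpi; rewrite /H set_itv1 Rintegral_set1 addr0.
have dFH x : x \in `[0, pi] -> `|F x - H x| <= e.
  move=> xpi.
  have mx : measurable (`[0, x]%classic : set (measurableTypeR R)).
    exact: measurable_itv.
  rewrite (proj2 Fg)// /H opprD addrACA subrr add0r.
  rewrite -(RintegralB mx (integrable_initial gi xpi) (integrable_initial hi xpi)).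
  apply: le_trans gn; exact: (int_initial_bound (L1piB gi hi) xpi).
have FL := L2pi_L1 (primitive_L2 Fg); have HL := L2pi_L1 (primitive_L2 Hh).
have := parts_continuous (F 0) ch; rewrite /= -/(H pi) -/(H 0).
have i1 : L1pi (fun x => g x * phi x) by exact: (@L1pi_mulb _ M).
have i2 : L1pi (fun x => h x * phi x) by exact: (@L1pi_mulb _ M).
have i3 : L1pi (fun x => F x * psi x) by exact: (@L1pi_mulb _ M).
have i4 : L1pi (fun x => H x * psi x) by exact: (@L1pi_mulb _ M).
have <- : \int[mu]_(x in I) (h x * phi x) = \int[mu]_(x in `[0, pi]) (phi x * h x).
  rewrite int_closed; last exact: L1pi_measurable.
  by apply: eq_Rintegral => x _; rewrite mulrC.
have <- : \int[mu]_(x in I) (H x * psi x) = \int[mu]_(x in `[0, pi]) (psi x * H x).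
  rewrite int_closed; last exact: L1pi_measurable.
  by apply: eq_Rintegral => x _; rewrite mulrC.
have H0 : H 0 = F 0 by rewrite /H set_itv1 Rintegral_set1 addr0.
rewrite H0 => E.
have -> : X - Y = \int[mu]_(x in I) ((g x - h x) * phi x)
   + (H pi - F pi) * phi pi + \int[mu]_(x in I) ((F x - H x) * psi x).
  have -> : \int[mu]_(x in I) ((g x - h x) * phi x) = X - \int[mu]_(x in I) (h x * phi x).
    by rewrite -intB//; apply: eq_int => x _; rewrite mulrBl.
  have -> : \int[mu]_(x in I) ((F x - H x) * psi x) =
     \int[mu]_(x in I) (F x * psi x) - \int[mu]_(x in I) (H x * psi x).
    by rewrite -intB//; apply: eq_int => x _; rewrite mulrBl.
  by rewrite E /Y; ring.
have -> : e * (2 * M + M * pi) = e * M + e * M + e * (M * pi) by ring.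
have b1 : `|\int[mu]_(x in I) ((g x - h x) * phi x)| <= e * M.
  apply: (@le_trans _ _ (\int[mu]_(x in I) (M * `|g x - h x|))).
    apply: int_bound; [|exact/L1piZ/L1pi_norm/L1piB|].
      by apply: (@L1pi_mulb _ M) => //; exact: L1piB.
    by move=> x _; rewrite normrM mulrC ler_wpM2r.
  rewrite intZ; last exact/L1pi_norm/L1piB.
  by rewrite mulrC ler_wpM2r.
have b3 : `|\int[mu]_(x in I) ((F x - H x) * psi x)| <= e * (M * pi).
  rewrite mulrA -int_cst; apply: int_bound; [|exact: L1pi_cst|].
    by apply: (@L1pi_mulb _ M) => //; exact: L1piB.
  move=> x xI; rewrite normrM ler_pM//; apply: dFH.
  by move: xI; rewrite /I0pi/= !in_itv/= => /andP[? ?]; rewrite !ltW.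
rewrite (le_trans (ler_normD _ _))// lerD//.
rewrite (le_trans (ler_normD _ _))// lerD//.
rewrite normrM ler_pM// distrC; apply: dFH.
by rewrite in_itv/= lexx pi_ge0.
Qed.

End Parts.

Lemma parts_sin (c : R) F g : primitive0 F g ->
  \int[mu]_(x in I) (g x * sin (c * x)) =
  F pi * sin (c * pi) - c * \int[mu]_(x in I) (F x * cos (c * x)).
Proof.
move=> Fg.
have FL := L2pi_L1 (primitive_L2 Fg).
rewrite (@parts (fun x => sin (c * x)) (fun x => c * cos (c * x)) (1 + `|c|) _ _ _ _ F)//.
- rewrite mulr0 sin0 mulr0 subr0; congr (_ - _); rewrite -intZ; last first.
    apply: (@L1pi_mulb _ 1) => //; last by move=> x _; exact: normr_cos_le1.
    by apply: measurable_continuous; exact: continuous_cosM.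
  by apply: eq_int => x _; ring.
- by move=> x; exact: is_derive_sinM.
- by move=> x; apply: cvgM; [exact: cvg_cst|exact: continuous_cosM].
- move=> x; have : `|sin (c * x)| <= 1 by rewrite ler_norml sin_geN1 sin_le1.
  by move=> /le_trans; apply; rewrite lerDl.
- move=> x; rewrite normrM (@le_trans _ _ `|c|)// ?lerDr//.
  by rewrite ler_piMr// normr_cos_le1.
Qed.

Lemma parts_cos (c : R) F g : primitive0 F g ->
  \int[mu]_(x in I) (g x * cos (c * x)) =
  F pi * cos (c * pi) - F 0 + c * \int[mu]_(x in I) (F x * sin (c * x)).
Proof.
move=> Fg.
have FL := L2pi_L1 (primitive_L2 Fg).
have s1 x : `|sin (c * x)| <= 1 by rewrite ler_norml sin_geN1 sin_le1.
rewrite (@parts (fun x => cos (c * x)) (fun x => - c * sin (c * x)) (1 + `|c|) _ _ _ _ F)//.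
- rewrite mulr0 cos0 mulr1.
  have -> : \int[mu]_(x in I) (F x * (- c * sin (c * x))) =
      - c * \int[mu]_(x in I) (F x * sin (c * x)).
    rewrite -intZ; first by apply: eq_int => x _; ring.
    apply: (@L1pi_mulb _ 1) => //.
    by apply: measurable_continuous; exact: continuous_sinM.
  by rewrite mulNr opprK.
- by move=> x; exact: is_derive_cosM.
- by move=> x; apply: cvgM; [exact: cvg_cst|exact: continuous_sinM].
- by move=> x; rewrite (le_trans (normr_cos_le1 _))// lerDl.
- move=> x; rewrite normrM normrN (@le_trans _ _ `|c|)// ?lerDr//.
  by rewrite ler_piMr.
Qed.

(** Two integrations by parts.  At pi either the sine and [u] vanish
    (Dirichlet, integer frequency) or the cosine and [u'] do (Neumann,
    half-integer frequency); at 0 the sine and [u] vanish in both cases. *)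
Lemma sn_coef_second_derivative b j (u u' g : R -> R) :
  primitive0 u u' -> primitive0 u' g -> u 0 = 0 ->
  (if b then u' pi else u pi) = 0 ->
  \int[mu]_(x in I) (g x * sn b j x) =
  - frequency R b j ^+ 2 * \int[mu]_(x in I) (u x * sn b j x).
Proof.
move=> uu' u'g u0 upi; rewrite /sn (parts_sin _ u'g) (parts_cos _ uu') u0.
have E : u' pi * sin (frequency R b j * pi) = 0 /\ u pi * cos (frequency R b j * pi) = 0.
  case: b upi => ->; rewrite /frequency ?mul0r; split => //.
    by rewrite mulrDl [2^-1 * _]mulrC cosDpihalf sin_mulpi oppr0 mulr0.
  by rewrite natr1 sin_mulpi mulr0.
by case: E => -> ->; ring.
Qed.

End AbsoluteContinuity.

(** * Complex-valued functions and their sine coefficients *)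

Section ComplexLayer.
Variable R : realType.
Local Notation C := R[i].
Local Notation mu := (@lebesgue_measure R).
Local Notation I := (@I0pi R).
Local Notation re := (@complex.Re R).
Local Notation im := (@complex.Im R).
Local Notation "r %:C" := (real_complex R r).
Implicit Types (f g : R -> C) (z w : C).

Lemma complex_ext z w : re z = re w -> im z = im w -> z = w.
Proof. by case: z w => a b [c d] /= -> ->. Qed.

Lemma reD z w : re (z + w) = re z + re w. Proof. by case: z w => ? ? []. Qed.
Lemma imD z w : im (z + w) = im z + im w. Proof. by case: z w => ? ? []. Qed.
Lemma reN z : re (- z) = - re z. Proof. by case: z. Qed.
Lemma imN z : im (- z) = - im z. Proof. by case: z. Qed.
Lemma reM z w : re (z * w) = re z * re w - im z * im w.
Proof. by case: z w => ? ? []. Qed.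
Lemma imM z w : im (z * w) = re z * im w + im z * re w.
Proof. by case: z w => ? ? []. Qed.
Lemma re_real (r : R) : re r%:C = r. Proof. by []. Qed.
Lemma im_real (r : R) : im r%:C = 0. Proof. by []. Qed.
Lemma re0 : re 0 = 0. Proof. by []. Qed.
Lemma im0 : im 0 = 0. Proof. by []. Qed.
Lemma re1 : re 1 = 1. Proof. by []. Qed.
Lemma im1 : im 1 = 0. Proof. by []. Qed.
Definition reimE := (reD, imD, reN, imN, reM, imM, re_real, im_real,
  re0, im0, re1, im1).

Lemma re_sum (n : nat) (F : nat -> C) : re (\sum_(k < n) F k) = \sum_(k < n) re (F k).
Proof. by elim: n => [|n IHn]; rewrite ?big_ord0// !big_ord_recr/= reD IHn. Qed.

Lemma im_sum (n : nat) (F : nat -> C) : im (\sum_(k < n) F k) = \sum_(k < n) im (F k).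
Proof. by elim: n => [|n IHn]; rewrite ?big_ord0// !big_ord_recr/= imD IHn. Qed.

(** The l^1 norm of the plane is submultiplicative, like the modulus, and is the
    sum of its contributions from the real and imaginary parts; constants do not
    matter here, so it replaces the modulus in all estimates. *)
Definition norm1 z : R := `|re z| + `|im z|.

Lemma norm1_ge0 z : 0 <= norm1 z. Proof. exact: addr_ge0. Qed.

Lemma norm1_0 : norm1 0 = 0. Proof. by rewrite /norm1 !reimE normr0 addr0. Qed.

Lemma norm1_eq0 z : norm1 z <= 0 -> z = 0.
Proof.
move=> z0; have := normr_ge0 (re z); have := normr_ge0 (im z) => h1 h2.
have r0 : `|re z| = 0 by move: z0; rewrite /norm1; lra.
have i0 : `|im z| = 0 by move: z0; rewrite /norm1; lra.
by apply: complex_ext; apply/eqP; rewrite -normr_eq0 ?r0 ?i0.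
Qed.

Lemma norm1D z w : norm1 (z + w) <= norm1 z + norm1 w.
Proof. by rewrite /norm1 !reimE addrACA lerD// ler_normD. Qed.

Lemma norm1N z : norm1 (- z) = norm1 z.
Proof. by rewrite /norm1 !reimE !normrN. Qed.

Lemma norm1B z w : norm1 (z - w) <= norm1 z + norm1 w.
Proof. by rewrite (le_trans (norm1D _ _))// norm1N. Qed.

Lemma norm1M z w : norm1 (z * w) <= norm1 z * norm1 w.
Proof.
rewrite /norm1 !reimE.
rewrite (le_trans (lerD (ler_normB _ _) (ler_normD _ _)))// !normrM.
by rewrite le_eqVlt; apply/orP; left; apply/eqP; ring.
Qed.

Lemma norm1_realM (r : R) z : norm1 (r%:C * z) = `|r| * norm1 z.
Proof. by rewrite /norm1 !reimE !mul0r subr0 addr0 !normrM mulrDr. Qed.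

Lemma norm1_real (r : R) : norm1 r%:C = `|r|.
Proof. by rewrite /norm1 !reimE normr0 addr0. Qed.

Lemma norm1_re z : `|re z| <= norm1 z. Proof. by rewrite lerDl. Qed.
Lemma norm1_im z : `|im z| <= norm1 z. Proof. by rewrite lerDr. Qed.

Lemma norm1_1 : norm1 1 = 1.
Proof. by rewrite /norm1 !reimE normr1 normr0 addr0. Qed.

Definition cmeas f : Prop :=
  measurable_fun I (fun x => re (f x)) /\ measurable_fun I (fun x => im (f x)).

Definition cL1 f : Prop := L1pi (fun x => re (f x)) /\ L1pi (fun x => im (f x)).

Definition cL2 f : Prop := L2pi (fun x => re (f x)) /\ L2pi (fun x => im (f x)).

Definition cbounded (M : R) f : Prop := forall x, I x -> norm1 (f x) <= M.

Lemma cL2_L1 f : cL2 f -> cL1 f.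
Proof. by case=> h1 h2; split; exact: L2pi_L1. Qed.

Lemma cL1_meas f : cL1 f -> cmeas f.
Proof. by case=> h1 h2; split; exact: L1pi_measurable. Qed.

Lemma cL2_meas f : cL2 f -> cmeas f.
Proof. by move/cL2_L1/cL1_meas. Qed.

Lemma cmeasD f g : cmeas f -> cmeas g -> cmeas (fun x => f x + g x).
Proof.
move=> [f1 f2] [g1 g2]; split.
  under eq_fun do rewrite reD; exact: measurable_funD.
under eq_fun do rewrite imD; exact: measurable_funD.
Qed.

Lemma cmeasM f g : cmeas f -> cmeas g -> cmeas (fun x => f x * g x).
Proof.
move=> [f1 f2] [g1 g2]; split.
  by under eq_fun do rewrite reM; apply: measurable_funB; exact: measurable_funM.
by under eq_fun do rewrite imM; apply: measurable_funD; exact: measurable_funM.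
Qed.

Lemma cmeas_cst z : cmeas (fun=> z).
Proof. by split; exact: measurable_cst. Qed.

Lemma cmeas_real (h : R -> R) : measurable_fun I h -> cmeas (fun x => (h x)%:C).
Proof. by move=> mh; split => //=; exact: measurable_cst. Qed.

Lemma cL1D f g : cL1 f -> cL1 g -> cL1 (fun x => f x + g x).
Proof.
move=> [f1 f2] [g1 g2]; split.
  by apply: eq_L1pi (L1piD f1 g1) => x _; rewrite reD.
by apply: eq_L1pi (L1piD f2 g2) => x _; rewrite imD.
Qed.

Lemma cL1Z z f : cL1 f -> cL1 (fun x => z * f x).
Proof.
move=> [f1 f2]; split.
  by apply: eq_L1pi (L1piB (L1piZ (re z) f1) (L1piZ (im z) f2)) => x _; rewrite reM.
by apply: eq_L1pi (L1piD (L1piZ (re z) f2) (L1piZ (im z) f1)) => x _; rewrite imM.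
Qed.

Lemma cL1B f g : cL1 f -> cL1 g -> cL1 (fun x => f x - g x).
Proof.
move=> hf hg; have := cL1D hf (cL1Z (-1) hg).
by congr cL1; apply/funext => x; rewrite mulN1r.
Qed.

Lemma cL1_mulb M f g : cL1 f -> cmeas g -> cbounded M g ->
  cL1 (fun x => f x * g x).
Proof.
move=> [f1 f2] [g1 g2] gM.
have gr x : I x -> `|re (g x)| <= M by move=> /gM; apply: le_trans; exact: norm1_re.
have gi x : I x -> `|im (g x)| <= M by move=> /gM; apply: le_trans; exact: norm1_im.
split.
  apply: eq_L1pi (L1piB (L1pi_mulb f1 g1 gr) (L1pi_mulb f2 g2 gi)) => x _.
  by rewrite reM.
apply: eq_L1pi (L1piD (L1pi_mulb f1 g2 gi) (L1pi_mulb f2 g1 gr)) => x _.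
by rewrite imM.
Qed.

Lemma cL2D f g : cL2 f -> cL2 g -> cL2 (fun x => f x + g x).
Proof.
move=> [f1 f2] [g1 g2]; split.
  by under eq_fun do rewrite reD; exact: L2piD.
by under eq_fun do rewrite imD; exact: L2piD.
Qed.

Lemma cL2Z z f : cL2 f -> cL2 (fun x => z * f x).
Proof.
move=> [f1 f2]; split.
  by under eq_fun do rewrite reM; apply: L2piB; exact: L2piZ.
by under eq_fun do rewrite imM; apply: L2piD; exact: L2piZ.
Qed.

Lemma cL2_mulb M f g : cL2 f -> cmeas g -> cbounded M g ->
  cL2 (fun x => f x * g x).
Proof.
move=> [f1 f2] [g1 g2] gM.
have gr x : I x -> `|re (g x)| <= M by move=> /gM; apply: le_trans; exact: norm1_re.
have gi x : I x -> `|im (g x)| <= M by move=> /gM; apply: le_trans; exact: norm1_im.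
split.
  under eq_fun do rewrite reM.
  by apply: L2piB; [exact: L2pi_mulb gr|exact: L2pi_mulb gi].
under eq_fun do rewrite imM.
by apply: L2piD; [exact: L2pi_mulb gi|exact: L2pi_mulb gr].
Qed.

Lemma cL2_bounded M f : cmeas f -> cbounded M f -> cL2 f.
Proof.
move=> [f1 f2] fM; split.
  apply: (@L2pi_bounded _ M) => // x /fM; apply: le_trans; exact: norm1_re.
apply: (@L2pi_bounded _ M) => // x /fM; apply: le_trans; exact: norm1_im.
Qed.

Lemma L1pi_norm1 f : cL1 f -> L1pi (fun x => norm1 (f x)).
Proof. by case=> f1 f2; apply: L1piD; exact: L1pi_norm. Qed.

Definition cint f : C :=
  Complex (\int[mu]_(x in I) re (f x)) (\int[mu]_(x in I) im (f x)).

Lemma eq_cint f g : (forall x, I x -> f x = g x) -> cint f = cint g.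
Proof.
by move=> fg; congr Complex; apply: eq_int => x xI; rewrite fg.
Qed.

Lemma cintD f g : cL1 f -> cL1 g -> cint (fun x => f x + g x) = cint f + cint g.
Proof.
move=> [f1 f2] [g1 g2]; apply: complex_ext; rewrite !reimE /= -intD//.
  by apply: eq_int => x _; rewrite reD.
by apply: eq_int => x _; rewrite imD.
Qed.

Lemma cintZ z f : cL1 f -> cint (fun x => z * f x) = z * cint f.
Proof.
move=> [f1 f2]; apply: complex_ext; rewrite !reimE /=.
  rewrite -!intZ// -intB//; [|exact: L1piZ..].
  by apply: eq_int => x _; rewrite reM.
rewrite -!intZ// -intD//; [|exact: L1piZ..].
by apply: eq_int => x _; rewrite imM.
Qed.

Lemma cintB f g : cL1 f -> cL1 g -> cint (fun x => f x - g x) = cint f - cint g.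
Proof.
move=> hf hg; rewrite -mulN1r -cintZ// -cintD//; last exact: cL1Z.
by apply: eq_cint => x _; rewrite mulN1r.
Qed.

Lemma norm1_cint f (h : R -> R) : cL1 f -> L1pi h ->
  (forall x, I x -> norm1 (f x) <= h x) -> norm1 (cint f) <= \int[mu]_(x in I) h x.
Proof.
move=> fi hi fh; have [f1 f2] := fi.
apply: (@le_trans _ _ (\int[mu]_(x in I) norm1 (f x))); last first.
  by apply: int_le => //; exact: L1pi_norm1.
rewrite intD; [|exact: L1pi_norm..].
by apply: lerD; apply: int_bound => //; exact: L1pi_norm.
Qed.

Lemma int_ae_eq (f g : R -> R) : measurable_fun I f -> measurable_fun I g ->
  {ae mu, forall x, I x -> f x = g x} ->
  \int[mu]_(x in I) f x = \int[mu]_(x in I) g x.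
Proof.
move=> mf mg fg; rewrite /Rintegral; congr fine.
apply: ae_eq_integral => //; [exact: measurable_I0pi|exact/measurable_EFinP..|].
by apply: ae_imply fg => x fg xI; rewrite /= fg.
Qed.

Lemma cint_ae_eq f g : cmeas f -> cmeas g ->
  {ae mu, forall x, I x -> f x = g x} -> cint f = cint g.
Proof.
move=> [f1 f2] [g1 g2] fg; congr Complex; apply: int_ae_eq => //.
  by apply: ae_imply fg => x fg xI; rewrite fg.
by apply: ae_imply fg => x fg xI; rewrite fg.
Qed.

Section SineCoefficients.
Variable b : bool.
Local Notation sn := (@sn R b).

Definition sine_coef f (j : nat) : C := (2 / pi)%:C * cint (fun x => f x * (sn j x)%:C).

Lemma cmeas_sn j : cmeas (fun x => (sn j x)%:C).
Proof. apply: cmeas_real; exact: measurable_sn. Qed.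

Lemma cbounded_sn j : cbounded 1 (fun x => (sn j x)%:C).
Proof. by move=> x _; rewrite norm1_real; exact: sn_le1. Qed.

Lemma cL1_mulsn f j : cL1 f -> cL1 (fun x => f x * (sn j x)%:C).
Proof. by move=> fi; exact: cL1_mulb (cmeas_sn j) (cbounded_sn j). Qed.

Lemma scoefD f g j : cL1 f -> cL1 g ->
  sine_coef (fun x => f x + g x) j = sine_coef f j + sine_coef g j.
Proof.
move=> fi gi; rewrite /sine_coef -mulrDr -cintD; [|exact: cL1_mulsn..].
by congr (_ * _); apply: eq_cint => x _; rewrite mulrDl.
Qed.

Lemma scoefZ z f j : cL1 f -> sine_coef (fun x => z * f x) j = z * sine_coef f j.
Proof.
move=> fi; rewrite /sine_coef [RHS]mulrCA -(cintZ z (cL1_mulsn j fi)).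
by congr (_ * _); apply: eq_cint => x _; rewrite mulrA.
Qed.

Lemma scoefB f g j : cL1 f -> cL1 g ->
  sine_coef (fun x => f x - g x) j = sine_coef f j - sine_coef g j.
Proof.
move=> fi gi; rewrite -mulN1r -scoefZ// -scoefD//; last exact: cL1Z.
by congr (_ * _); apply: eq_cint => x _; rewrite mulN1r.
Qed.

Lemma scoef_bound f j (h : R -> R) : cL1 f -> L1pi h ->
  (forall x, I x -> norm1 (f x) <= h x) ->
  norm1 (sine_coef f j) <= \int[mu]_(x in I) h x.
Proof.
move=> fi hi fh; rewrite norm1_realM.
have p2 := pi_ge2 R; have p0 := pi_gt0 R.
have b1 : norm1 (cint (fun x => f x * (sn j x)%:C)) <= \int[mu]_(x in I) h x.
  apply: norm1_cint => //; first exact: cL1_mulsn.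
  move=> x xI; rewrite mulrC norm1_realM; apply: le_trans (fh x xI).
  by rewrite ler_piMl ?norm1_ge0// sn_le1.
apply: le_trans b1; rewrite ler_piMl ?norm1_ge0//.
have -> : `|2 / pi| = 2 / pi :> R by rewrite ger0_norm// divr_ge0// ltW.
by rewrite ler_pdivrMr// mul1r.
Qed.

Lemma scoef_ae_eq f g j : cmeas f -> cmeas g ->
  {ae mu, forall x, I x -> f x = g x} -> sine_coef f j = sine_coef g j.
Proof.
move=> mf mg fg; congr (_ * _); apply: cint_ae_eq.
- by apply: cmeasM => //; exact: cmeas_sn.
- by apply: cmeasM => //; exact: cmeas_sn.
- by apply: ae_imply fg => x fg xI; rewrite fg.
Qed.

Lemma re_scoef f j : re (sine_coef f j) =
  2 / pi * \int[mu]_(x in I) (re (f x) * sn j x).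
Proof.
rewrite !reimE /= mul0r subr0; congr (_ * _).
by apply: eq_int => x _; rewrite !reimE mulr0 subr0.
Qed.

Lemma im_scoef f j : im (sine_coef f j) =
  2 / pi * \int[mu]_(x in I) (im (f x) * sn j x).
Proof.
rewrite !reimE /= mul0r addr0; congr (_ * _).
by apply: eq_int => x _; rewrite !reimE mulr0 add0r.
Qed.

(** Completeness of the sines, applied to both components of the difference. *)
Lemma scoef_complete f g : cL2 f -> cL2 g -> (forall j, sine_coef f j = sine_coef g j) ->
  {ae mu, forall x, I x -> f x = g x}.
Proof.
move=> f2 g2 fg.
have p0 : 2 / pi != 0 :> R by rewrite mulf_neq0// invr_neq0// gt_eqF// pi_gt0.
have [h1 h2] := cL2D f2 (cL2Z (-1) g2).
have fgL1 := cL1D (cL2_L1 f2) (cL1Z (-1) (cL2_L1 g2)).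
have sc0 j : sine_coef (fun x => f x + -1 * g x) j = 0.
  by rewrite scoefD ?scoefZ ?fg ?mulN1r ?subrr//; [..|apply: cL1Z]; exact: cL2_L1.
have a1 := sn_complete h1 (b := b).
have a2 := sn_complete h2 (b := b).
apply: ae_imply2 (a1 _) (a2 _) => [x H1 H2 xI|j|j].
- move: (H1 xI) (H2 xI); rewrite mulN1r !reimE.
  by move=> /subr0_eq e1 /subr0_eq e2; exact: complex_ext.
- apply: (mulfI p0); rewrite mulr0 -re_scoef sc0 re0 //.
- by apply: (mulfI p0); rewrite mulr0 -im_scoef sc0.
Qed.

Lemma AC_deriv_primitive f g : AC_deriv f g ->
  primitive0 (fun x => re (f x)) (fun x => re (g x)) /\
  primitive0 (fun x => im (f x)) (fun x => im (g x)).
Proof.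
move=> [[g1 g2] fg]; split; split => // x xpi.
  by rewrite {1}fg// reD.
by rewrite {1}fg// imD.
Qed.

Lemma scoef_second_derivative j (u u' g : R -> C) :
  AC_deriv u u' -> AC_deriv u' g -> u 0 = 0 ->
  (if b then u' pi else u pi) = 0 ->
  sine_coef g j = (- frequency R b j ^+ 2)%:C * sine_coef u j.
Proof.
move=> /AC_deriv_primitive[r1 i1] /AC_deriv_primitive[r2 i2] u0 upi.
apply: complex_ext; rewrite [RHS]reimE ?re_scoef ?im_scoef ?reimE mul0r ?subr0 ?addr0 mulrCA.
  rewrite (sn_coef_second_derivative j r1 r2)// ?u0//.
  by case: b upi => ->.
rewrite (sn_coef_second_derivative j i1 i2)// ?u0//.
by case: b upi => ->.
Qed.

End SineCoefficients.

End ComplexLayer.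

(** * Gaps between unperturbed eigenvalues *)

Section Gaps.
Variable R : realType.

(** Fourth roots make the exponents 5/4 and 3/4 of the weights algebraic. *)
Definition root4 (k : nat) : R := Num.sqrt (Num.sqrt k%:R).

Lemma root4_ge0 k : 0 <= root4 k. Proof. exact: sqrtr_ge0. Qed.

Lemma root4_pow2 k : root4 k ^+ 2 = Num.sqrt k%:R.
Proof. by rewrite sqr_sqrtr// sqrtr_ge0. Qed.

Lemma root4_pow4 k : root4 k ^+ 4 = k%:R.
Proof. by rewrite (exprM _ 2 2) root4_pow2 sqr_sqrtr. Qed.

Lemma root4_gt0 k : (0 < k)%N -> 0 < root4 k.
Proof. by move=> k0; rewrite !sqrtr_gt0 ltr0n. Qed.

Lemma root4_le k l : (k <= l)%N -> root4 k <= root4 l.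
Proof. by move=> kl; rewrite !ler_wsqrtr// ler_nat. Qed.

Lemma root4_1 : root4 1 = 1.
Proof. by rewrite /root4 !sqrtr1. Qed.

(** The terms k^(-5/4) are dominated by the increments of -4 k^(-1/4): when
    v^4 = u^4 + 1, factoring v^4 - u^4 gives 1 / u - 1 / v >= 1 / (4 v^5). *)
Lemma sum_root4_inv5 n : \sum_(k < n) (root4 k.+1 ^+ 5)^-1 <= 5.
Proof.
suff H : \sum_(k < n.+1) (root4 k.+1 ^+ 5)^-1 <= 5 - 4 * (root4 n.+1)^-1.
  apply: (@le_trans _ _ (\sum_(k < n.+1) (root4 k.+1 ^+ 5)^-1)).
    by rewrite big_ord_recr/= lerDl invr_ge0 exprn_ge0// root4_ge0.
  by rewrite (le_trans H)// lerBlDr lerDl mulr_ge0// invr_ge0 root4_ge0.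
elim: n => [|n IHn]; first by rewrite big_ord1 root4_1 expr1n invr1; lra.
rewrite big_ord_recr/=; apply: (le_trans (lerD IHn (lexx _))).
have := @root4_gt0 n.+1 isT; have := @root4_gt0 n.+2 isT.
have : root4 n.+2 ^+ 4 = root4 n.+1 ^+ 4 + 1 by rewrite !root4_pow4 -natr1.
have := root4_le (leqnSn n.+1).
set u := root4 n.+1; set v := root4 n.+2 => uv E v0 u0.
rewrite -subr_ge0.
have -> : 5 - 4 / v - (5 - 4 / u + (v ^+ 5)^-1) = 4 * (u^-1 - v^-1) - (v ^+ 5)^-1 by ring.
have un0 : u != 0 by rewrite gt_eqF.
have vn0 : v != 0 by rewrite gt_eqF.
have pos : 0 < u * v * (v + u) * (u ^+ 2 + v ^+ 2).
  by rewrite !mulr_gt0// ?addr_gt0// exprn_gt0.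
have -> : u^-1 - v^-1 = (u * v * (v + u) * (u ^+ 2 + v ^+ 2))^-1.
  apply: (mulIf (negbT (gt_eqF pos))); rewrite mulVf ?gt_eqF//.
  have -> : (u^-1 - v^-1) * (u * v * (v + u) * (u ^+ 2 + v ^+ 2)) = v ^+ 4 - u ^+ 4.
    by field; rewrite ?un0 ?vn0.
  by rewrite E addrC addKr.
rewrite subr_ge0 -[4]invrK -invfM lef_pV2 ?posrE ?exprn_gt0 ?mulr_gt0 ?invr_gt0//; last 2 first.
- by rewrite addr_gt0.
- by rewrite addr_gt0// exprn_gt0.
rewrite mulrC ler_pdivrMr//.
have -> : v ^+ 5 * 4 = v * v * (v + v) * (v ^+ 2 + v ^+ 2) by ring.
have [u0' v0'] := (ltW u0, ltW v0).
have h2 : u ^+ 2 <= v ^+ 2 by rewrite lerXn2r ?nnegrE.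
apply: ler_pM; rewrite ?mulr_ge0 ?addr_ge0 ?exprn_ge0// ?lerD//.
by apply: ler_pM; rewrite ?mulr_ge0 ?addr_ge0// ?lerD2l// ler_wpM2r.
Qed.

(** The same telescoping for k^(-3/2), with square roots in place of fourth
    roots. *)
Lemma sum_root4_inv6 n : \sum_(k < n) (root4 k.+1 ^+ 6)^-1 <= 3.
Proof.
suff H : \sum_(k < n.+1) (root4 k.+1 ^+ 6)^-1 <= 3 - 2 * (root4 n.+1 ^+ 2)^-1.
  apply: (@le_trans _ _ (\sum_(k < n.+1) (root4 k.+1 ^+ 6)^-1)).
    by rewrite big_ord_recr/= lerDl invr_ge0 exprn_ge0// root4_ge0.
  by rewrite (le_trans H)// lerBlDr lerDl mulr_ge0// invr_ge0 exprn_ge0// root4_ge0.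
elim: n => [|n IHn]; first by rewrite big_ord1 root4_1 !expr1n invr1; lra.
rewrite big_ord_recr/=; apply: (le_trans (lerD IHn (lexx _))).
rewrite ![_ ^+ 6](exprM _ 2 3).
have : 0 < root4 n.+1 ^+ 2 by rewrite exprn_gt0// root4_gt0.
have : 0 < root4 n.+2 ^+ 2 by rewrite exprn_gt0// root4_gt0.
have : (root4 n.+2 ^+ 2) ^+ 2 = (root4 n.+1 ^+ 2) ^+ 2 + 1.
  by rewrite -!exprM !root4_pow4 -natr1.
have : root4 n.+1 ^+ 2 <= root4 n.+2 ^+ 2.
  by rewrite lerXn2r ?nnegrE ?root4_ge0// root4_le.
move: (root4 n.+1 ^+ 2) (root4 n.+2 ^+ 2) => u v uv E v0 u0.
rewrite -subr_ge0.
have -> : 3 - 2 / v - (3 - 2 / u + (v ^+ 3)^-1) = 2 * (u^-1 - v^-1) - (v ^+ 3)^-1 by ring.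
have un0 : u != 0 by rewrite gt_eqF.
have vn0 : v != 0 by rewrite gt_eqF.
have pos : 0 < u * v * (v + u) by rewrite !mulr_gt0// ?addr_gt0.
have -> : u^-1 - v^-1 = (u * v * (v + u))^-1.
  apply: (mulIf (negbT (gt_eqF pos))); rewrite mulVf ?gt_eqF//.
  have -> : (u^-1 - v^-1) * (u * v * (v + u)) = v ^+ 2 - u ^+ 2.
    by field; rewrite ?un0 ?vn0.
  by rewrite E addrC addKr.
rewrite subr_ge0 -[2]invrK -invfM lef_pV2 ?posrE ?exprn_gt0 ?mulr_gt0 ?invr_gt0//; last first.
  by rewrite addr_gt0.
rewrite mulrC ler_pdivrMr//.
have -> : v ^+ 3 * 2 = v * v * (v + v) by ring.
have [u0' v0'] := (ltW u0, ltW v0).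
by apply: ler_pM; rewrite ?mulr_ge0 ?addr_ge0// ?lerD2l// ler_wpM2r.
Qed.

Section Weights.
Variables (b : bool) (m : nat).
Hypothesis m_gt0 : (0 < m)%N.
Local Notation freq := (frequency R b).

Definition unperturbed (j : nat) : R := freq j ^+ (2 * m).

Lemma freq_le i j : (i <= j)%N -> freq i <= freq j.
Proof. by move=> ij; rewrite lerD2r ler_nat. Qed.

(** Since the larger frequency is at least 1, raising the order of the operator
    only widens the gaps, and the case m = 1 bounds all the others. *)
Lemma pow_gap (x y : R) (p : nat) : (0 < p)%N -> 1 <= x -> 0 <= y <= x ->
  x - y <= x ^+ p - y ^+ p.
Proof.
move=> p0 x1 /andP[y0 yx]; case: p p0 => // p _.
elim: p => [|p IHp]; first by rewrite !expr1.
apply: (le_trans IHp).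
have -> : x ^+ p.+2 = x * x ^+ p.+1 by rewrite exprS.
have -> : y ^+ p.+2 = y * y ^+ p.+1 by rewrite exprS.
have h1 : 0 <= (x - 1) * (x ^+ p.+1 - y ^+ p.+1).
  by rewrite mulr_ge0 ?subr_ge0// lerXn2r ?nnegrE// (le_trans y0).
have h2 : 0 <= (x - y) * y ^+ p.+1 by rewrite mulr_ge0 ?subr_ge0// exprn_ge0.
by move: h1 h2; move: (x ^+ p.+1) (y ^+ p.+1) => X Y; lra.
Qed.

Lemma unperturbed_gap n j : (n < j)%N ->
  (j - n)%N%:R * (j + n + 1)%N%:R <= unperturbed j - unperturbed n.
Proof.
move=> nj; have f1 : 1 <= freq j.
  have : 1 <= j%:R :> R by rewrite ler1n; lia.
  by rewrite /frequency; case: b; lra.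
have fn := freq_gt0 R b n; have fnj := freq_le (ltnW nj).
apply: (@le_trans _ _ (freq j ^+ 2 - freq n ^+ 2)).
  rewrite subr_sqr natrB 1?ltnW// !natrD.
  have -> : freq j - freq n = j%:R - n%:R by rewrite /frequency; ring.
  rewrite ler_wpM2l ?subr_ge0 ?ler_nat 1?ltnW//.
  by rewrite /frequency; case: b; lra.
rewrite /unperturbed !exprM; apply: pow_gap => //; first by rewrite exprn_ege1.
by rewrite exprn_ge0 ?(ltW fn)//= lerXn2r ?nnegrE ?(ltW fn)// (le_trans (ltW fn)).
Qed.

Definition weight (n j : nat) : R := `|unperturbed j - unperturbed n|^-1.

Lemma weight_ge0 n j : 0 <= weight n j.
Proof. by rewrite invr_ge0. Qed.

(** At j = n the inverse of 0 is 0: the resonant term carries no weight. *)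
Lemma weight_diag n : weight n n = 0.
Proof. by rewrite /weight subrr normr0 invr0. Qed.

Definition dist (n j : nat) : nat := (n - j + (j - n))%N.

(** The gap is at least d (j + n + 1) with d the distance of [n] and [j], and
    j + n + 1 is at least d^(1/4) (n + 1)^(3/4).  This splitting keeps an exponent
    above 1 for the sum over [j] and, after squaring, for the sum over [n]. *)
Lemma weight_le n j : n != j ->
  weight n j <= (root4 n.+1 ^+ 3)^-1 * (root4 (dist n j) ^+ 5)^-1.
Proof.
move=> nj.
pose d := dist n j; pose s := (j + n + 1)%N.
have d0 : (0 < d)%N by rewrite /d /dist; lia.
have gap : d%:R * s%:R <= `|unperturbed j - unperturbed n|.
  have [lt|lt] : ((n < j) \/ (j < n))%N by lia.
    have -> : d = (j - n)%N by rewrite /d /dist; lia.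
    exact: le_trans (unperturbed_gap lt) (ler_norm _).
  have -> : d = (n - j)%N by rewrite /d /dist; lia.
  rewrite distrC /s [(j + n)%N]addnC.
  exact: le_trans (unperturbed_gap lt) (ler_norm _).
have p3 : 0 < root4 n.+1 ^+ 3 by rewrite exprn_gt0// root4_gt0.
have p5 : 0 < root4 d ^+ 5 by rewrite exprn_gt0// root4_gt0.
have le1 : root4 n.+1 ^+ 3 * root4 d ^+ 5 <= d%:R * s%:R.
  rewrite -!root4_pow4 [root4 d ^+ 5]exprS mulrCA mulrC [leRHS]mulrC.
  rewrite mulrAC ler_wpM2r ?exprn_ge0 ?root4_ge0//.
  rewrite [root4 s ^+ 4]exprSr mulrC.
  have sd : root4 d <= root4 s by apply: root4_le; rewrite /d /s /dist; lia.
  have sn : root4 n.+1 <= root4 s by apply: root4_le; rewrite /s; lia.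
  by rewrite mulrC ler_pM ?exprn_ge0 ?root4_ge0// lerXn2r ?nnegrE ?root4_ge0.
have p35 := mulr_gt0 p3 p5.
have p35' := lt_le_trans p35 (le_trans le1 gap).
by rewrite -invfM /weight lef_pV2 ?posrE//; exact: le_trans gap.
Qed.

Definition weight_sum (n : nat) : R := 10 * (root4 n.+1 ^+ 3)^-1.

Lemma sum_weight n J : \sum_(j < J) weight n j <= weight_sum n.
Proof.
apply: (@le_trans _ _ (\sum_(j < n + J.+1) weight n j)).
  rewrite (big_ord_widen _ (weight n) (_ : J <= n + J.+1)%N); last by lia.
  rewrite big_mkcond/=; apply: ler_sum => j _.
  by case: ifP => // _; exact: weight_ge0.
rewrite big_split_ord/= big_ord_recl/= addn0 weight_diag add0r.
have -> : weight_sum n = (root4 n.+1 ^+ 3)^-1 * 5 + (root4 n.+1 ^+ 3)^-1 * 5.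
  by rewrite /weight_sum; ring.
have c0 : 0 <= (root4 n.+1 ^+ 3)^-1 by rewrite invr_ge0 exprn_ge0// root4_ge0.
apply: lerD.
  rewrite (reindex_inj rev_ord_inj)/=.
  apply: le_trans (ler_wpM2l c0 (sum_root4_inv5 n)).
  rewrite mulr_sumr; apply: ler_sum => i _.
  have ni : n != (n - i.+1)%N by have := ltn_ord i; lia.
  have -> : i.+1 = dist n (n - i.+1)%N by rewrite /dist; have := ltn_ord i; lia.
  by have := weight_le ni; have -> : (n - dist n (n - i.+1))%N = (n - i.+1)%N
    by rewrite /dist; have := ltn_ord i; lia.
apply: le_trans (ler_wpM2l c0 (sum_root4_inv5 J)).
rewrite mulr_sumr; apply: ler_sum => i _; rewrite /bump/= add1n.
have ni : n != (n + i.+1)%N by lia.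
have E : i.+1 = dist n (n + i.+1)%N by rewrite /dist; lia.
by rewrite [in leRHS]E; exact: weight_le.
Qed.

Lemma weight_sum_le10 n : weight_sum n <= 10.
Proof.
rewrite /weight_sum ler_piMr// invf_le1 ?exprn_gt0 ?root4_gt0// exprn_ege1//.
by rewrite -root4_1 root4_le.
Qed.

Lemma weight_sum_ge0 n : 0 <= weight_sum n.
Proof. by rewrite mulr_ge0// invr_ge0 exprn_ge0// root4_ge0. Qed.

Lemma sum_weight_sum_sqr N : \sum_(n < N) weight_sum n ^+ 2 <= 300.
Proof.
have -> : \sum_(n < N) weight_sum n ^+ 2 = 100 * \sum_(n < N) (root4 n.+1 ^+ 6)^-1.
  rewrite mulr_sumr; apply: eq_bigr => n _.
  by rewrite /weight_sum exprMn -natrX exprVn -exprM.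
by have := sum_root4_inv6 N; lra.
Qed.

End Weights.
End Gaps.

(** * Absolutely convergent sine series *)

Section CauchyModulus.
Variable R : realType.

(** Completeness of the line with an explicit rate, which serves both for the
    sine series and for the iteration behind the fixed point theorem. *)
Lemma cauchy_modulus (u eps : nat -> R) :
  (forall n p, (n <= p)%N -> `|u p - u n| <= eps n) ->
  eps n @[n --> \oo] --> 0 ->
  u n @[n --> \oo] --> limn u /\ forall n, `|limn u - u n| <= eps n.
Proof.
move=> ueps eps0.
have cu : cvgn u.
  apply/cauchy_cvgP/cauchy_exP => e e0.
  move/cvgrPdist_lt : eps0 => /(_ _ e0)[N _ HN].
  exists (u N); exists N => // p /= Np.
  rewrite /ball/= distrC (le_lt_trans (ueps _ _ Np))//.
  by have := HN N (leqnn N); rewrite /= sub0r normrN; exact: le_lt_trans (ler_norm _).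
split; first exact: cu.
move=> n; apply/ler_addgt0Pl => e e0.
move/cvgrPdist_lt : (cu : u n @[n --> \oo] --> limn u) => /(_ _ e0)[N _ HN].
have h1 := HN (maxn n N) (leq_maxr _ _); have h2 := ueps n (maxn n N) (leq_maxl _ _).
rewrite -(subrKA (u (maxn n N))) (le_trans (ler_normD _ _))// lerD// ltW//.
Qed.

End CauchyModulus.

Section SineSeries.
Variable R : realType.
Variable b : bool.
Local Notation C := R[i].
Local Notation mu := (@lebesgue_measure R).
Local Notation I := (@I0pi R).
Local Notation re := (@complex.Re R).
Local Notation im := (@complex.Im R).
Local Notation "r %:C" := (real_complex R r).
Local Notation sn := (@sn R b).
Local Notation scoef := (@sine_coef R b).

Definition psum (c : nat -> R) (n : nat) (x : R) : R := \sum_(k < n) c k * sn k x.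

Definition rseries (c : nat -> R) (x : R) : R := limn (fun n => psum c n x).

Lemma psum_limit (a w : nat -> R) (W : R) :
  (forall k, `|a k| <= w k) -> (forall n, \sum_(k < n) w k <= W) ->
  (forall x, psum a n x @[n --> \oo] --> rseries a x) /\
  (forall e, 0 < e -> exists N, forall n x, (N <= n)%N ->
    `|rseries a x - psum a n x| <= e).
Proof.
move=> aw wW.
have w0 k : 0 <= w k by exact: le_trans (aw k).
pose s (n : nat) := \sum_(k < n) w k.
have cs : cvgn s.
  apply: nondecreasing_is_cvgn.
    by apply/nondecreasing_seqP => n; rewrite /s big_ord_recr/= lerDl.
  by exists W => _ [n _ <-]; exact: wW.
have sl n : s n <= limn s.
  apply: nondecreasing_cvgn_le => //.
  by apply/nondecreasing_seqP => k; rewrite /s big_ord_recr/= lerDl.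
have e0 : limn s - s n @[n --> \oo] --> 0.
  by rewrite -[X in _ --> X](subrr (limn s)); apply: cvgB; [exact: cvg_cst|].
have mod x n p : (n <= p)%N -> `|psum a p x - psum a n x| <= limn s - s n.
  move=> np; apply: (@le_trans _ _ (s p - s n)); last by rewrite lerB.
  rewrite /psum /s -(subnKC np) !big_split_ord/= !(addrC (\sum_(i < n) _)) !addrK.
  rewrite (le_trans (ler_norm_sum _ _ _))//; apply: ler_sum => k _.
  by rewrite normrM (le_trans _ (aw _))// ler_piMr// sn_le1.
split=> [x|e ep].
  by have [] := cauchy_modulus (mod x) e0.
move/cvgrPdist_le : (e0) => /(_ _ ep)[N _ HN]; exists N => n x Nn.
have [_ /(_ n)/le_trans] := cauchy_modulus (mod x) e0; apply.
by have := HN n Nn; rewrite /= sub0r normrN; exact: le_trans (ler_norm _).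
Qed.

(** The perturbation argument takes place entirely among sine series whose
    coefficients have a summable majorant [w]; the total [W] then bounds the sum
    of the series. *)
Definition summable_by (a : nat -> C) (w : nat -> R) (W : R) : Prop :=
  (forall k, norm1 (a k) <= w k) /\ forall n, \sum_(k < n) w k <= W.

Definition sseries (a : nat -> C) (x : R) : C :=
  Complex (rseries (fun k => re (a k)) x) (rseries (fun k => im (a k)) x).

Definition csum (a : nat -> C) (n : nat) (x : R) : C :=
  \sum_(k < n) a k * (sn k x)%:C.

Lemma csumE a n x :
  csum a n x = Complex (psum (fun k => re (a k)) n x) (psum (fun k => im (a k)) n x).
Proof.
apply: complex_ext.
  rewrite (re_sum n (fun k => a k * (sn k x)%:C)).
  by apply: eq_bigr => k _; rewrite !reimE mulr0 subr0.
rewrite (im_sum n (fun k => a k * (sn k x)%:C)).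
by apply: eq_bigr => k _; rewrite !reimE mulr0 add0r.
Qed.

Lemma csum_bound a w W n x : summable_by a w W -> norm1 (csum a n x) <= W.
Proof.
move=> [aw wW]; apply: le_trans (wW n); rewrite /csum.
elim: n => [|n IHn]; first by rewrite !big_ord0 norm1_0.
rewrite !big_ord_recr/= (le_trans (norm1D _ _))// lerD//.
rewrite mulrC norm1_realM; apply: le_trans (aw n).
by rewrite ler_piMl ?norm1_ge0// sn_le1.
Qed.

Section Summable.
Variables (a : nat -> C) (w : nat -> R) (W : R).
Hypothesis aw : summable_by a w W.

Let ar k : `|re (a k)| <= w k.
Proof. exact: le_trans (norm1_re _) (proj1 aw k). Qed.

Let ai k : `|im (a k)| <= w k.
Proof. exact: le_trans (norm1_im _) (proj1 aw k). Qed.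

Lemma sseries_tail e : 0 < e -> exists N, forall n x, (N <= n)%N ->
  norm1 (sseries a x - csum a n x) <= e.
Proof.
move=> e0; have e2 : 0 < e / 2 by rewrite divr_gt0.
have [_ /(_ _ e2)[N1 h1]] := psum_limit ar (proj2 aw).
have [_ /(_ _ e2)[N2 h2]] := psum_limit ai (proj2 aw).
exists (maxn N1 N2) => n x; rewrite geq_max => /andP[n1 n2].
rewrite csumE /norm1 !reimE/= [leRHS]splitr lerD//; [exact: h1|exact: h2].
Qed.

Lemma sseries_bound x : norm1 (sseries a x) <= W.
Proof.
apply/ler_addgt0Pl => e e0; have [N /(_ N x (leqnn N)) h] := sseries_tail e0.
rewrite -(subrK (csum a N x) (sseries a x)) (le_trans (norm1D _ _))// lerD//.
exact: csum_bound aw.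
Qed.

Lemma cmeas_sseries : cmeas (sseries a).
Proof.
have mp (c : nat -> R) n : measurable_fun I (psum c n).
  apply: measurable_sum => k; apply: measurable_funM => //.
  exact: measurable_sn.
have [h1 _] := psum_limit ar (proj2 aw); have [h2 _] := psum_limit ai (proj2 aw).
split.
  apply: (measurable_fun_cvg (mp (fun k => re (a k)))) => x xI; exact: h1.
apply: (measurable_fun_cvg (mp (fun k => im (a k)))) => x xI; exact: h2.
Qed.

Lemma cL2_sseries : cL2 (sseries a).
Proof.
apply: cL2_bounded cmeas_sseries _ => x _; exact: sseries_bound.
Qed.

Lemma cint_mul_csum f n : cL1 f ->
  cint (fun x => f x * csum a n x) =
  (pi / 2)%:C * \sum_(k < n) a k * scoef f k /\ cL1 (fun x => f x * csum a n x).
Proof.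
move=> fi; elim: n => [|n [IHn Hn]].
  split.
    rewrite big_ord0 mulr0 -(mul0r (cint f)) -cintZ//.
    by apply: eq_cint => x _; rewrite /csum big_ord0 mulr0 mul0r.
  have := cL1Z 0 fi; congr cL1; apply/funext => x.
  by rewrite /csum big_ord0 mulr0 mul0r.
have E x : f x * csum a n.+1 x = f x * csum a n x + a n * (f x * (sn n x)%:C).
  by rewrite /csum big_ord_recr/= mulrDr; congr (_ + _); rewrite mulrCA.
have fs := cL1_mulsn b n fi.
split; last first.
  have := cL1D Hn (cL1Z (a n) fs); congr cL1; apply/funext => x; exact: esym.
rewrite (eq_cint (g := fun x => f x * csum a n x + a n * (f x * (sn n x)%:C)))//.
rewrite cintD ?cintZ//; last exact: cL1Z.
rewrite IHn big_ord_recr/= mulrDr; congr (_ + _).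
rewrite /sine_coef mulrCA; congr (_ * _); rewrite mulrA.
have -> : (pi / 2)%:C * (2 / pi)%:C = 1 :> C.
  apply: complex_ext; rewrite !reimE; last by rewrite mul0r mulr0 addr0.
  rewrite mulr0 subr0; move: (negbT (gt_eqF (pi_gt0 R))).
  by generalize (pi : R) => P P0; field.
by rewrite mul1r.
Qed.

Lemma cint_mul_sseries f e : cL1 f -> 0 < e -> exists N, forall n, (N <= n)%N ->
  norm1 (cint (fun x => f x * sseries a x)
         - (pi / 2)%:C * \sum_(k < n) a k * scoef f k) <= e.
Proof.
move=> fi e0; pose A := \int[mu]_(x in I) norm1 (f x).
have A0 : 0 <= A by apply: int_ge0 => x _; exact: norm1_ge0.
have eA : 0 < e / (A + 1) by rewrite divr_gt0// ltr_wpDl.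
have [N hN] := sseries_tail eA; exists N => n Nn.
have [<- Sn] := cint_mul_csum n fi.
have fS : cL1 (fun x => f x * sseries a x).
  by apply: (@cL1_mulb _ W) => //; [exact: cmeas_sseries|move=> x _; exact: sseries_bound].
rewrite -cintB//.
apply: (@le_trans _ _ (\int[mu]_(x in I) ((e / (A + 1)) * norm1 (f x)))).
  apply: norm1_cint; [exact: cL1B|exact/L1piZ/L1pi_norm1|].
  move=> x _; rewrite -mulrBr mulrC (le_trans (norm1M _ _))//.
  by rewrite ler_wpM2r ?norm1_ge0// hN.
rewrite intZ; last exact: L1pi_norm1.
by rewrite -/A mulrAC ler_pdivrMr ?ltr_wpDl// ler_wpM2l ?(ltW e0)//; lra.
Qed.

End Summable.

Lemma scoef_sn i j : scoef (fun x => (sn i x)%:C) j = (i == j)%:R.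
Proof.
apply: complex_ext; rewrite ?re_scoef ?im_scoef.
  rewrite int_snsn; case: eqP => _; rewrite ?mulr0//=.
  move: (negbT (gt_eqF (pi_gt0 R))).
  by generalize (pi : R) => P P0; field.
rewrite (eq_int (g := fun x => 0)); last by move=> x _; rewrite /= mul0r.
by rewrite int_cst mul0r mulr0; case: eqP.
Qed.

Lemma cL1_sn i : cL1 (fun x => (sn i x)%:C).
Proof.
apply: cL2_L1; apply: (@cL2_bounded _ 1).
  exact: cmeas_sn.
exact: cbounded_sn.
Qed.

Lemma scoef_sseries a w W j : summable_by a w W -> scoef (sseries a) j = a j.
Proof.
move=> aw; apply/subr0_eq/norm1_eq0; apply/ler_addgt0Pl => e e0; rewrite addr0.
have e1 : 0 < e by [].
have [N hN] := cint_mul_sseries aw (cL1_sn j) e1.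
have := hN (maxn N j.+1) (leq_maxl _ _).
have -> : \sum_(k < maxn N j.+1) a k * scoef (fun x => (sn j x)%:C) k = a j.
  have jm : (j < maxn N j.+1)%N by rewrite leq_max leqnn orbT.
  rewrite (bigD1 (Ordinal jm))//= scoef_sn eqxx mulr1 big1 ?addr0// => k kj.
  rewrite scoef_sn; case: eqP => [jk|_]; last by rewrite mulr0.
  by move: kj; rewrite -val_eqE/= -jk eqxx.
have -> : cint (fun x => (sn j x)%:C * sseries a x) = (pi / 2)%:C * scoef (sseries a) j.
  rewrite /sine_coef mulrA.
  have -> : (pi / 2)%:C * (2 / pi)%:C = 1 :> C.
    apply: complex_ext; rewrite !reimE; last by rewrite mul0r mulr0 addr0.
    rewrite mulr0 subr0; move: (negbT (gt_eqF (pi_gt0 R))).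
    by generalize (pi : R) => P P0; field.
  by rewrite mul1r; apply: eq_cint => x _; rewrite mulrC.
rewrite -mulrBr norm1_realM; apply: le_trans.
rewrite ler_peMl ?norm1_ge0// ger0_norm ?divr_ge0 ?pi_ge0//.
exact: pihalf_ge1.
Qed.

(** Each integral is the limit of pi / 2 times the partial sums of the products
    of coefficients, and by hypothesis these products coincide. *)
Lemma sseries_pairing (a1 a2 : nat -> C) w1 W1 w2 W2 f1 f2 :
  summable_by a1 w1 W1 -> summable_by a2 w2 W2 -> cL1 f1 -> cL1 f2 ->
  (forall k, a2 k * scoef f1 k = a1 k * scoef f2 k) ->
  cint (fun x => f1 x * sseries a2 x) = cint (fun x => f2 x * sseries a1 x).
Proof.
move=> s1 s2 i1 i2 E; apply/subr0_eq/norm1_eq0.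
apply/ler_addgt0Pl => e e0; rewrite addr0.
have e2 : 0 < e / 2 by rewrite divr_gt0.
have [N1 h1] := cint_mul_sseries s2 i1 e2.
have [N2 h2] := cint_mul_sseries s1 i2 e2.
have {h1} := h1 (maxn N1 N2) (leq_maxl _ _).
have {h2} := h2 (maxn N1 N2) (leq_maxr _ _).
under eq_bigr do rewrite -E.
set A := cint _; set B := cint _; set S := _ * _ => hA hB.
have -> : B - A = (B - S) - (A - S) by ring.
by rewrite (le_trans (norm1B _ _))// [leRHS]splitr lerD.
Qed.

Lemma csum_sub a1 a2 n x :
  csum a1 n x - csum a2 n x = csum (fun k => a1 k - a2 k) n x.
Proof. by rewrite /csum -sumrB; apply: eq_bigr => k _; rewrite mulrBl. Qed.

Lemma sseries_dist (a1 a2 : nat -> C) w1 W1 w2 W2 w W x :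
  summable_by a1 w1 W1 -> summable_by a2 w2 W2 ->
  summable_by (fun k => a1 k - a2 k) w W ->
  norm1 (sseries a1 x - sseries a2 x) <= W.
Proof.
move=> s1 s2 s; apply/ler_addgt0Pl => e e0.
have e2 : 0 < e / 2 by rewrite divr_gt0.
have [N1 h1] := sseries_tail s1 e2; have [N2 h2] := sseries_tail s2 e2.
have {h1} := h1 (maxn N1 N2) x (leq_maxl _ _).
have {h2} := h2 (maxn N1 N2) x (leq_maxr _ _).
have := csum_bound (maxn N1 N2) x s; rewrite -csum_sub.
set n := maxn _ _ => h h2 h1.
have -> : sseries a1 x - sseries a2 x = (sseries a1 x - csum a1 n x)
  - (sseries a2 x - csum a2 n x) + (csum a1 n x - csum a2 n x) by ring.
rewrite (le_trans (norm1D _ _))// lerD//.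
by rewrite (le_trans (norm1B _ _))// [leRHS]splitr lerD.
Qed.

Definition kronecker (n k : nat) : C := (n == k)%:R.

Lemma norm1_delta n k : norm1 (kronecker n k) = (n == k)%:R.
Proof. by rewrite /kronecker; case: eqP => _ /=; rewrite ?norm1_1 ?norm1_0. Qed.

Lemma sum_delta (n N : nat) : \sum_(k < N) ((n == k)%:R : R) <= 1.
Proof.
have [nN|Nn] := ltnP n N.
  rewrite (bigD1 (Ordinal nN))//= eqxx big1 ?addr0// => k kn.
  by case: eqP => // nk; move: kn; rewrite -val_eqE/= -nk eqxx.
by rewrite big1// => k _; have := ltn_ord k; case: eqP => // <-; lia.
Qed.

Lemma summable_delta n (c : C) :
  summable_by (fun k => c * kronecker n k) (fun k => norm1 c * (n == k)%:R) (norm1 c).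
Proof.
split=> [k|N].
  by rewrite (le_trans (norm1M _ _))// norm1_delta.
by rewrite -mulr_sumr ler_piMr ?norm1_ge0// sum_delta.
Qed.

Lemma sseries_delta n c x : sseries (fun k => c * kronecker n k) x = c * (sn n x)%:C.
Proof.
apply/subr0_eq/norm1_eq0; apply/ler_addgt0Pl => e e0; rewrite addr0.
have [N h] := sseries_tail (summable_delta n c) e0.
have {h} := h (maxn N n.+1) x (leq_maxl _ _); congr (norm1 (_ - _) <= _).
have nm : (n < maxn N n.+1)%N by rewrite leq_max leqnn orbT.
rewrite /csum (bigD1 (Ordinal nm))//= /kronecker eqxx mulr1 big1 ?addr0// => k kn.
case: eqP => [nk|_]; last by rewrite mulr0 mul0r.
by move: kn; rewrite -val_eqE/= -nk eqxx.
Qed.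

End SineSeries.

(** * Contractions in weighted sequence spaces *)

Section FixedPoint.
Variable R : realType.
Local Notation C := R[i].
Local Notation re := (@complex.Re R).
Local Notation im := (@complex.Im R).

Lemma geometric_cvg0 (K : R) : K / 2 ^+ n @[n --> \oo] --> 0.
Proof.
have h : `|2^-1 : R| < 1 by rewrite ger0_norm; lra.
have := cvg_geometric K h; rewrite /geometric /=.
by under eq_fun do rewrite exprVn.
Qed.

Lemma le_of_geometric (x y K : R) : (forall n, x <= y + K / 2 ^+ n) -> x <= y.
Proof.
move=> H; apply/ler_addgt0Pr => e e0.
move/cvgrPdist_le : (geometric_cvg0 K) => /(_ _ e0)[N _ /(_ N (leqnn N))].
rewrite /= sub0r normrN => h; apply: (le_trans (H N)); rewrite lerD2l.
exact: le_trans (ler_norm _) h.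
Qed.

Lemma norm_reB (z w : C) : `|re z - re w| <= norm1 (z - w).
Proof. by apply: le_trans (norm1_re _); rewrite !reimE. Qed.

Lemma norm_imB (z w : C) : `|im z - im w| <= norm1 (z - w).
Proof. by apply: le_trans (norm1_im _); rewrite !reimE. Qed.

(** Banach's fixed point theorem for the weighted sup norm on a ball centred at
    [e].  Working coordinatewise gives the limit from the completeness of the
    line alone, without a normed space of sequences. *)
Lemma weighted_fixpoint (e : nat -> C) (w : nat -> R) (c : R)
    (T : (nat -> C) -> nat -> C) :
  let ball a := forall j, norm1 (a j - e j) <= c * w j in
  0 <= c -> (forall j, 0 <= w j) ->
  (forall a, ball a -> ball (T a)) ->
  (forall a a' d, 0 <= d -> ball a -> ball a' ->
     (forall j, norm1 (a j - a' j) <= d * w j) ->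
     forall j, norm1 (T a j - T a' j) <= d / 2 * w j) ->
  exists2 a, ball a & forall j, T a j = a j.
Proof.
move=> ball c0 w0 Tb Tc.
pose A n := iter n T e.
have bA n : ball (A n).
  elim: n => [|n IHn]; last exact: Tb.
  by move=> j; rewrite subrr norm1_0 mulr_ge0.
have p0 n : 0 < 2 ^+ n :> R by rewrite exprn_gt0.
have step n j : norm1 (A n.+1 j - A n j) <= c / 2 ^+ n * w j.
  elim: n j => [|n IHn] j.
    by rewrite expr0 divr1; exact: (bA 1%N).
  rewrite exprSr invfM mulrA.
  apply: (Tc (A n.+1) (A n)) => //.
  by rewrite divr_ge0// ltW.
have far n p j : (n <= p)%N ->
    norm1 (A p j - A n j) <= (2 * c / 2 ^+ n - 2 * c / 2 ^+ p) * w j.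
  move=> np; rewrite -(subnKC np); elim: (p - n)%N => [|q IHq].
    by rewrite addn0 !subrr norm1_0 mul0r.
  rewrite addnS -(subrKA (A (n + q)%N j)).
  rewrite (le_trans (norm1D _ _))//; apply: (le_trans (lerD (step _ _) IHq)).
  rewrite -mulrDl ler_wpM2r// [2 ^+ (n + q).+1]exprS.
  have := p0 n; have := p0 (n + q)%N; move: (2 ^+ (n + q)) (2 ^+ n) => P Q P0 Q0.
  by rewrite le_eqVlt; apply/orP; left; apply/eqP; field; rewrite !gt_eqF.
pose K j := 2 * c * w j.
have far' n p j : (n <= p)%N -> norm1 (A p j - A n j) <= K j / 2 ^+ n.
  move=> np; apply: (le_trans (far _ _ j np)).
  rewrite /K [leRHS]mulrAC ler_wpM2r// gerBl divr_ge0 ?mulr_ge0// ltW//.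
pose a j : C := Complex (limn (fun n => re (A n j))) (limn (fun n => im (A n j))).
have lim n j : norm1 (a j - A n j) <= 2 * K j / 2 ^+ n.
  have [_ /(_ n) h1] := @cauchy_modulus _ (fun n => re (A n j)) _
    (fun n p np => le_trans (norm_reB _ _) (far' n p j np)) (geometric_cvg0 (K j)).
  have [_ /(_ n) h2] := @cauchy_modulus _ (fun n => im (A n j)) _
    (fun n p np => le_trans (norm_imB _ _) (far' n p j np)) (geometric_cvg0 (K j)).
  have -> : 2 * K j / 2 ^+ n = K j / 2 ^+ n + K j / 2 ^+ n by ring.
  by rewrite /norm1 !reimE lerD.
have ba : ball a.
  move=> j; apply: (@le_of_geometric _ _ (2 * K j)) => n.
  rewrite -(subrKA (A n j)) addrC (le_trans (norm1D _ _))// lerD//.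
  exact: bA.
exists a => // j.
apply/subr0_eq/norm1_eq0; apply: (@le_of_geometric _ _ (3 * K j)) => n; rewrite add0r.
rewrite -(subrKA (A n.+1 j)).
apply: (le_trans (norm1D _ _)).
have h1 : norm1 (T a j - A n.+1 j) <= K j / 2 ^+ n.
  have h := Tc a (A n) (4 * c / 2 ^+ n); rewrite [A n.+1]iterS.
  have -> : K j / 2 ^+ n = 4 * c / 2 ^+ n / 2 * w j by rewrite /K; field; rewrite gt_eqF.
  apply: h => //; first by rewrite divr_ge0 ?mulr_ge0// ltW.
  move=> i; apply: (le_trans (lim n i)); rewrite /K.
  by rewrite le_eqVlt; apply/orP; left; apply/eqP; field; rewrite gt_eqF.
have h2 : norm1 (A n.+1 j - a j) <= K j / 2 ^+ n.
  rewrite -norm1N opprB; apply: (le_trans (lim n.+1 j)).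
  rewrite exprS invfM [2 * K j]mulrC mulrA -[K j * 2 / 2]mulrA mulfV// mulr1.
  by [].
have K0 : 0 <= K j / 2 ^+ n by rewrite divr_ge0 ?mulr_ge0// ltW.
by apply: (le_trans (lerD h1 h2)); rewrite -mulrA; lra.
Qed.

End FixedPoint.

(** * Sobolev jets and the unperturbed operator *)

Section Jets.
Variable R : realType.
Local Notation C := R[i].
Local Notation mu := (@lebesgue_measure R).
Local Notation I := (@I0pi R).
Local Notation re := (@complex.Re R).
Local Notation im := (@complex.Im R).
Local Notation "r %:C" := (real_complex R r).
Implicit Types (f g u : R -> C).

Lemma cmod_sqr (z : C) : cmod z ^+ 2 = re z ^+ 2 + im z ^+ 2.
Proof. by case: z => x y; rewrite /cmod/= sqr_sqrtr// addr_ge0// sqr_ge0. Qed.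

Lemma L2norm_sqr f :
  (L2norm f `^ 2 = \int[mu]_(x in I) (re (f x) ^+ 2 + im (f x) ^+ 2)%:E)%E.
Proof.
rewrite /L2norm poweR_Lnorm// [RHS]integral_mkcond.
apply: eq_integral => x _; rewrite !patchE; case: ifP => _.
  by rewrite abse_EFin poweR_EFin powR_mulrn// real_normK ?num_real// cmod_sqr.
by rewrite abse0 poweR0r.
Qed.

Lemma L2norm_ge0 f : (0 <= L2norm f)%E.
Proof. exact: Lnorm_ge0. Qed.

Lemma inL2_cL2 f : inL2 f -> cL2 f.
Proof.
case=> mr mi fin.
have : (L2norm f `^ 2 < +oo)%E by rewrite poweR_lty.
rewrite L2norm_sqr => fin2.
have fi : L1pi (fun x => re (f x) ^+ 2 + im (f x) ^+ 2).
  apply/integrableP; split.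
    by apply/measurable_EFinP; apply: measurable_funD; exact: measurable_funX.
  under eq_integral do rewrite abse_EFin ger0_norm ?addr_ge0 ?sqr_ge0//.
  exact: fin2.
split; split => //.
  apply: L1pi_le fi; first exact: measurable_funX.
  by move=> x _; rewrite ger0_norm ?sqr_ge0// lerDl sqr_ge0.
apply: L1pi_le fi; first exact: measurable_funX.
by move=> x _; rewrite ger0_norm ?sqr_ge0// lerDr sqr_ge0.
Qed.

Lemma cL2_inL2 f : cL2 f -> inL2 f.
Proof.
move=> [[mr fr] [mi fi]]; split => //.
have : (L2norm f `^ 2 < +oo)%E.
  rewrite L2norm_sqr.
  have /integrableP[_] := L1piD fr fi.
  by under eq_integral do rewrite /= ger0_norm ?addr_ge0 ?sqr_ge0//.
exact: lty_poweRy.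
Qed.

Lemma L2ball_int (eps : R) f : 0 < eps -> L2ball eps f ->
  cL2 f /\ \int[mu]_(x in I) (re (f x) ^+ 2 + im (f x) ^+ 2) <= eps ^+ 2.
Proof.
move=> e0 [f2 fe]; split; first exact: inL2_cL2.
rewrite -lee_fin; have := inL2_cL2 f2 => -[[_ fr] [_ fi]].
have fin : (\int[mu]_(x in I) (re (f x) ^+ 2 + im (f x) ^+ 2)%:E)%E \is a fin_num.
  have si := L1piD fr fi; exact: (integrable_fin_num (@measurable_I0pi R) si).
rewrite /Rintegral fineK//.
rewrite -L2norm_sqr.
have -> : (eps ^+ 2)%:E = (eps%:E `^ 2)%E :> \bar R.
  by rewrite poweR_EFin powR_mulrn// ltW.
move: fe (L2norm_ge0 f); case: (L2norm f) => [r|//|//].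
rewrite lte_fin lee_fin => re r0; rewrite !poweR_EFin lee_fin.
by rewrite ge0_ler_powR// ?nnegrE ltW.
Qed.

(** The l^1 size of a potential is controlled by its L^2 norm through
    |s| <= (eps + s^2 / eps) / 2. *)
Lemma L2ball_norm1 (eps : R) f : 0 < eps -> L2ball eps f ->
  \int[mu]_(x in I) norm1 (f x) <= 5 * eps.
Proof.
move=> e0 fe; have [f2 fi] := L2ball_int e0 fe.
have [[_ fr] [_ fim]] := f2; have p4 := pihalf_lt2 R.
apply: (@le_trans _ _ (\int[mu]_(x in I) (eps
   + (2 * eps)^-1 * (re (f x) ^+ 2 + im (f x) ^+ 2)))).
  apply: int_le; first exact/L1pi_norm1/cL2_L1.
    by apply: L1piD; [exact: L1pi_cst|apply/L1piZ/L1piD].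
  move=> x _.
  have F (s : R) : `|s| <= eps / 2 + (2 * eps)^-1 * s ^+ 2.
    rewrite -[s ^+ 2]real_normK ?num_real//.
    rewrite -subr_ge0 (_ : _ - _ = (2 * eps)^-1 * (eps - `|s|) ^+ 2).
      by rewrite mulr_ge0 ?sqr_ge0// invr_ge0 mulr_ge0// ltW.
    by field; rewrite gt_eqF.
  have := F (re (f x)); have := F (im (f x)); rewrite /norm1 mulrDr; lra.
rewrite intD; [|exact: L1pi_cst|exact/L1piZ/L1piD].
rewrite intZ; last exact: L1piD.
rewrite int_cst.
have : (2 * eps)^-1 * \int[mu]_(x in I) (re (f x) ^+ 2 + im (f x) ^+ 2) <= eps / 2.
  apply: (@le_trans _ _ ((2 * eps)^-1 * eps ^+ 2)).
    by rewrite ler_wpM2l// invr_ge0 mulr_ge0// ltW.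
  by rewrite le_eqVlt; apply/orP; left; apply/eqP; field; rewrite gt_eqF.
have : eps * pi <= eps * 4 by rewrite ler_wpM2l ?(ltW e0)//; lra.
lra.
Qed.

Lemma primitive_of (F0 : R) (g : R -> R) : L1pi g ->
  primitive0 (fun x => F0 + \int[mu]_(t in `[0, x]) g t) g.
Proof.
move=> gi; split; first exact/integrable_closed.
by move=> x xpi; rewrite set_itv1 Rintegral_set1 addr0.
Qed.

Lemma primitive_AC f g : primitive0 (fun x => re (f x)) (fun x => re (g x)) ->
  primitive0 (fun x => im (f x)) (fun x => im (g x)) -> AC_deriv f g.
Proof.
move=> [g1 f1] [g2 f2]; split; first by split.
move=> x xpi; apply: complex_ext; rewrite reimE/=; [exact: f1|exact: f2].
Qed.

Lemma primitive_scale (r : R) (F g : R -> R) : primitive0 F g ->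
  primitive0 (fun x => r * F x) (fun x => r * g x).
Proof.
move=> Fg; have gi := primitive_L1 Fg; split; first exact/integrable_closed/L1piZ.
move=> x xpi; rewrite (proj2 Fg)// mulrDr RintegralZl//.
exact: integrable_initial.
Qed.

(** Integrate twice; the free constant of the first integration is fixed by the
    condition at pi. *)
Lemma solve_real (b : bool) (f : R -> R) : L1pi f -> exists u u' : R -> R,
  [/\ primitive0 u u', primitive0 u' (fun x => - f x), u 0 = 0
    & (if b then u' pi else u pi) = 0].
Proof.
move=> fi; have nfi := L1piN fi.
pose v x := \int[mu]_(t in `[0, x]) (- f t).
have vp : primitive0 v (fun x => - f x).
  have [h1 h2] := primitive_of 0 nfi; split => // x xpi.
  by have := h2 x xpi; rewrite !add0r.
have vi := L2pi_L1 (primitive_L2 vp).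
pose c := if b then - v pi else - (pi^-1 * \int[mu]_(t in `[0, pi]) v t).
pose u' x := c + v x.
have u'p : primitive0 u' (fun x => - f x).
  split; first exact/integrable_closed.
  by move=> x xpi; rewrite /u' (proj2 vp)// addrA.
have u'i := L2pi_L1 (primitive_L2 u'p).
exists (fun x => 0 + \int[mu]_(t in `[0, x]) u' t), u'; split => //.
- exact: primitive_of.
- by rewrite set_itv1 Rintegral_set1 addr0.
- case: b @c @u' u'p u'i => c u' u'p u'i; first by rewrite /u' /c addNr.
  rewrite add0r -int_closed; last exact: L1pi_measurable.
  rewrite intD ?int_cst//; last exact: L1pi_cst.
  rewrite int_closed ?/c; last exact: L1pi_measurable.
  by rewrite mulNr mulrAC mulVf ?mul1r ?addNr// gt_eqF// pi_gt0.
Qed.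

Definition sturm_bc (b : bool) : nat -> (nat -> R -> C) -> Prop :=
  if b then @dirichlet_neumann R else @dirichlet R.

Lemma sturm_bcP b m (Y : nat -> R -> C) : sturm_bc b m Y <->
  forall i, (i < m)%N -> Y (2 * i)%N 0 = 0 /\
    (if b then Y (2 * i).+1 pi else Y (2 * i)%N pi) = 0.
Proof. by case: b. Qed.

Lemma solve_complex (b : bool) f : cL1 f -> exists u u' : R -> C,
  [/\ AC_deriv u u', AC_deriv u' (fun x => - f x), u 0 = 0
    & (if b then u' pi else u pi) = 0].
Proof.
move=> [f1 f2].
have [u1 [v1 [a1 a2 a3 a4]]] := solve_real b f1.
have [u2 [v2 [b1 b2 b3 b4]]] := solve_real b f2.
exists (fun x => Complex (u1 x) (u2 x)), (fun x => Complex (v1 x) (v2 x)); split.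
- exact: primitive_AC.
- by apply: primitive_AC => /=; [move: a2|move: b2]; congr (primitive0 _ _);
    apply/funext => x; rewrite !reimE.
- by rewrite a3 b3.
- by case: b a4 b4 => -> ->.
Qed.

Lemma AC_derivZ (r : R) f g : AC_deriv f g ->
  AC_deriv (fun x => r%:C * f x) (fun x => r%:C * g x).
Proof.
move=> /AC_deriv_primitive[h1 h2]; apply: primitive_AC.
  by have := primitive_scale r h1; congr (primitive0 _ _); apply/funext => x;
    rewrite reM mul0r subr0.
by have := primitive_scale r h2; congr (primitive0 _ _); apply/funext => x;
  rewrite imM mul0r addr0.
Qed.

Lemma AC_deriv_cL2 f g : AC_deriv f g -> cL2 f.
Proof. by move=> /AC_deriv_primitive[h1 h2]; split; [exact: (primitive_L2 h1)|exact: (primitive_L2 h2)]. Qed.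

Lemma AC_deriv_bounded f g : AC_deriv f g -> exists M, cbounded M f.
Proof.
move=> /AC_deriv_primitive[h1 h2].
exists (`|re (f 0)| + \int[mu]_(t in I) `|re (g t)| +
  (`|im (f 0)| + \int[mu]_(t in I) `|im (g t)|)) => x xI.
have xpi : x \in `[0, pi].
  by move: xI; rewrite /I0pi/= !in_itv/= => /andP[? ?]; rewrite !ltW.
by apply: lerD; [exact: (primitive_bounded h1)|exact: (primitive_bounded h2)].
Qed.

Lemma sign_real (m : nat) : (-1) ^+ m = ((-1) ^+ m)%:C :> C.
Proof. by rewrite rmorphXn rmorphN1. Qed.

(** Inverting minus the second derivative [m] times, with the boundary
    conditions imposed at every step, inverts the unperturbed operator; the
    successive integrals are, up to sign, the even derivatives of the solution. *)
Lemma jets_of (b : bool) (m : nat) f : cL2 f -> exists Y : nat -> R -> C,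
  [/\ sobolev_jet (2 * m) Y, sturm_bc b m Y
    & forall x, Y (2 * m)%N x = (-1) ^+ m * f x].
Proof.
elim: m f => [|m IHm] f f2.
  exists (fun=> f); split.
  - by split => //; exact: cL2_inL2.
  - by apply/sturm_bcP.
  - by move=> x; rewrite expr0 mul1r.
have [u [u' [uu' u'f u0 upi]]] := solve_complex b (cL2_L1 f2).
have [Y [[YAC _] /sturm_bcP Ybc YE]] := IHm u (AC_deriv_cL2 uu').
pose Z k := if (k <= 2 * m)%N then Y k else if k == (2 * m).+1
  then (fun x => (-1) ^+ m * u' x) else (fun x => (-1) ^+ m.+1 * f x).
have ZE k : (k <= 2 * m)%N -> Z k = Y k by rewrite /Z => ->.
have Z1 : Z (2 * m).+1 = fun x => (-1) ^+ m * u' x.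
  by rewrite /Z ltnn eqxx.
have Z2 : Z (2 * m).+2 = fun x => (-1) ^+ m.+1 * f x.
  rewrite /Z (_ : (_ <= _)%N = false); last by lia.
  by rewrite (_ : (_ == _) = false)//; lia.
have Y2 : Y (2 * m)%N = fun x => (-1) ^+ m * u x by apply/funext.
have mE : (2 * m.+1 = (2 * m).+2)%N by lia.
exists Z; split.
- rewrite mE; split; last by rewrite Z2; exact/cL2_inL2/cL2Z.
  move=> k; rewrite ltnS leq_eqVlt => /predU1P[->|].
    rewrite Z1 Z2; have := AC_derivZ ((-1) ^+ m) u'f; rewrite -sign_real.
    by congr (AC_deriv _ _); apply/funext => x; rewrite exprS mulN1r mulrN mulNr.
  rewrite ltnS leq_eqVlt => /predU1P[->|k2m].
    rewrite Z1 ZE// Y2; have := AC_derivZ ((-1) ^+ m) uu'.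
    by rewrite -sign_real.
  by rewrite !ZE ?(ltnW k2m)//; exact: YAC.
- apply/sturm_bcP => i; rewrite ltnS leq_eqVlt => /predU1P[->|im].
    rewrite Z1 ZE// Y2 u0 mulr0; split => //.
    by case: b upi {IHm Ybc} => ->; rewrite mulr0.
  have [h1 h2] := Ybc i im; rewrite !ZE; [by []|lia|lia].
- by move=> x; rewrite mE Z2.
Qed.

(** The sines diagonalise the unperturbed operator on its domain. *)
Lemma jet_scoef (b : bool) (m : nat) (Y : nat -> R -> C) j :
  sobolev_jet (2 * m) Y -> sturm_bc b m Y ->
  (-1) ^+ m * sine_coef b (Y (2 * m)%N) j
  = (unperturbed R b m j)%:C * sine_coef b (Y 0%N) j.
Proof.
move=> [YAC _] /sturm_bcP Ybc; rewrite /unperturbed.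
suff H i : (i <= m)%N -> (-1) ^+ i * sine_coef b (Y (2 * i)%N) j
    = (frequency R b j ^+ (2 * i))%:C * sine_coef b (Y 0%N) j by exact: H.
elim: i => [|i IHi] im; first by rewrite muln0 !expr0.
have [h1 h2] := Ybc i im.
have mE : (2 * i.+1 = (2 * i).+2)%N by lia.
have AC1 : AC_deriv (Y (2 * i)%N) (Y (2 * i).+1) by apply: YAC; lia.
have AC2 : AC_deriv (Y (2 * i).+1) (Y (2 * i).+2) by apply: YAC; lia.
rewrite mE (scoef_second_derivative j AC1 AC2 h1 h2).
have := IHi (ltnW im); set A := sine_coef _ (Y (2 * i)%N) j; set B := sine_coef _ _ j => H.
have -> : (- frequency R b j ^+ 2)%:C = - (frequency R b j ^+ 2)%:C :> C by rewrite rmorphN.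
rewrite (_ : (2 * i).+2 = 2 + 2 * i)%N; last by lia.
have -> : (frequency R b j ^+ (2 + 2 * i))%:C
    = (frequency R b j ^+ 2)%:C * (frequency R b j ^+ (2 * i))%:C :> C.
  by rewrite exprD rmorphM.
rewrite -mulrA -[RHS]/(_ * (_ * B)) -H exprS; ring.
Qed.

End Jets.

(** * Perturbation of a single eigenvalue *)

Section Perturbation.
Variable R : realType.
Variables (b : bool) (m : nat).
Hypothesis m_gt0 : (0 < m)%N.
Local Notation C := R[i].
Local Notation mu := (@lebesgue_measure R).
Local Notation I := (@I0pi R).
Local Notation re := (@complex.Re R).
Local Notation im := (@complex.Im R).
Local Notation "r %:C" := (real_complex R r).
Local Notation sn := (@sn R b).
Local Notation scoef := (@sine_coef R b).
Local Notation sseries := (@sseries R b).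
Local Notation weight := (@weight R b m).
Local Notation weight_sum := (@weight_sum R).
Local Notation Om := (@unperturbed R b m).
Local Notation delta := (@kronecker R).
Implicit Types (q f : R -> C) (al : nat -> C) (lam : C).

(** The eigenvalue equation for the function with sine coefficients [al].  It
    makes sense without derivatives or boundary conditions. *)
Definition eigencoef q lam al : Prop :=
  (exists w W, summable_by al w W) /\
  forall j, (lam - (Om j)%:C) * al j = scoef (fun x => q x * sseries al x) j.

Lemma cbounded_sseries al w W : summable_by al w W -> cbounded W (sseries al).
Proof. by move=> s x _; exact: sseries_bound s x. Qed.

Lemma cL1_mul_sseries q al w W : cL1 q -> summable_by al w W ->
  cL1 (fun x => q x * sseries al x).
Proof.
move=> q1 s; apply: cL1_mulb (cbounded_sseries s) => //; exact: cmeas_sseries s.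
Qed.

Lemma int_norm1_mulb q f (M k : R) : cL1 q -> cmeas f -> cbounded M f ->
  \int[mu]_(x in I) norm1 (q x) <= k -> 0 <= M ->
  \int[mu]_(x in I) norm1 (q x * f x) <= k * M.
Proof.
move=> q1 mf fM qk M0.
apply: (@le_trans _ _ (\int[mu]_(x in I) (M * norm1 (q x)))).
  apply: int_le; [exact/L1pi_norm1/(cL1_mulb q1 mf fM)|exact/L1piZ/L1pi_norm1|].
  by move=> x xI; rewrite (le_trans (norm1M _ _))// mulrC ler_wpM2r ?norm1_ge0// fM.
by rewrite intZ; [rewrite mulrC ler_wpM2r|exact: L1pi_norm1].
Qed.

(** The coefficients of the reduced resolvent at the [n]-th unperturbed
    eigenvalue; the resonant coefficient is 0 since the inverse of 0 is 0. *)
Definition reduced n f (j : nat) : C := ((Om j - Om n)^-1)%:C * scoef f j.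

Lemma reduced_bound n f (k : R) j : cL1 f -> \int[mu]_(x in I) norm1 (f x) <= k ->
  norm1 (reduced n f j) <= k * weight n j.
Proof.
move=> f1 fk; rewrite norm1_realM normfV mulrC ler_wpM2r ?invr_ge0//.
by apply: le_trans fk; apply: scoef_bound => //; exact: L1pi_norm1.
Qed.

Lemma reducedB n f (g : R -> C) j : cL1 f -> cL1 g ->
  reduced n f j - reduced n g j = reduced n (fun x => f x - g x) j.
Proof. by move=> f1 g1; rewrite /reduced -mulrBr scoefB. Qed.

Lemma unperturbed_neq n j : n != j -> Om j - Om n != 0.
Proof.
have H i k : (i < k)%N -> 0 < Om k - Om i.
  move=> ik; apply: lt_le_trans (unperturbed_gap R b m_gt0 ik).
  by rewrite mulr_gt0// ltr0n; lia.
move=> nj; have [lt|lt] : ((n < j) \/ (j < n))%N by lia.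
  by rewrite gt_eqF// H.
by rewrite -oppr_eq0 opprB gt_eqF// H.
Qed.

Lemma reduced_solve n f j (c : C) : n != j ->
  (Om j - Om n)%:C * c = scoef f j -> c = reduced n f j.
Proof.
move=> nj E; rewrite /reduced -E mulrA -rmorphM mulVf ?mul1r//.
exact: unperturbed_neq.
Qed.

Lemma reduced_eq n f j : n != j -> (Om j - Om n)%:C * reduced n f j = scoef f j.
Proof.
move=> nj; rewrite mulrA -rmorphM mulfV ?mul1r//; exact: unperturbed_neq.
Qed.

Lemma pi_le4 : pi <= 4 :> R.
Proof. by have := pihalf_lt2 R; lra. Qed.

Section Residual.
Variables (q : R -> C) (k : R).
Hypothesis q1 : cL1 q.
Hypothesis qk : \int[mu]_(x in I) norm1 (q x) <= k.

Let k0 : 0 <= k.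
Proof. by apply: le_trans qk; apply: int_ge0 => x _; exact: norm1_ge0. Qed.

Lemma residual_bound (d : C) f (D M : R) : cL2 f -> cbounded M f -> 0 <= M ->
  norm1 d <= D ->
  cL1 (fun x => d * f x - q x * f x) /\
  \int[mu]_(x in I) norm1 (d * f x - q x * f x) <= (4 * D + k) * M.
Proof.
move=> f2 fM M0 dD; have f1 := cL2_L1 f2; have mf := cL2_meas f2.
have qf := cL1_mulb q1 mf fM; have df := cL1Z d f1.
split; first exact: cL1B.
apply: (@le_trans _ _ (\int[mu]_(x in I) (D * M + norm1 (q x * f x)))).
  apply: int_le; [exact/L1pi_norm1/cL1B|apply: L1piD (L1pi_cst _) (L1pi_norm1 qf)|].
  move=> x xI; rewrite (le_trans (norm1B _ _))// lerD2r (le_trans (norm1M _ _))//.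
  by rewrite ler_pM ?norm1_ge0// fM.
rewrite intD; [|exact: L1pi_cst|exact: L1pi_norm1].
rewrite int_cst mulrDl; apply: lerD; last exact: int_norm1_mulb.
have DM : 0 <= D * M by rewrite mulr_ge0// (le_trans (norm1_ge0 d)).
by rewrite (_ : 4 * D * M = D * M * 4) ?ler_wpM2l ?pi_le4//; ring.
Qed.

Lemma residual_scoef (d : C) al w W j : summable_by al w W ->
  scoef (fun x => d * sseries al x - q x * sseries al x) j =
  d * al j - scoef (fun x => q x * sseries al x) j.
Proof.
move=> s; have S1 := cL2_L1 (cL2_sseries b s).
rewrite scoefB ?scoefZ//; [|exact: cL1Z|exact: cL1_mul_sseries s].
by rewrite (scoef_sseries b j s).
Qed.

(** Lyapunov-Schmidt reduction: the component along the n-th sine is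
    normalised to 1, the eigenvalue is read off the n-th coefficient, and the
    other coefficients solve a contractive equation. *)
Lemma eigencoef_exists n : k <= 1 / 1000 -> exists lam al,
  [/\ eigencoef q lam al, al n = 1 & norm1 (lam - (Om n)%:C) <= 2 * k].
Proof.
move=> ksmall.
pose dl al : C := scoef (fun x => q x * sseries al x) n.
pose res al x := dl al * sseries al x - q x * sseries al x.
pose T al j := if n == j then 1 else reduced n (res al) j.
pose ball al := forall j, norm1 (al j - delta n j) <= 1 / 10 * weight n j.
have w0 j : 0 <= weight n j by exact: weight_ge0.
have sumw N (c : R) : 0 <= c -> \sum_(j < N) (c * weight n j) <= c * 10.
  move=> c0; rewrite -mulr_sumr ler_wpM2l//.
  exact: le_trans (sum_weight R b m_gt0 n N) (weight_sum_le10 R n).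
have sball al : ball al ->
    summable_by al (fun j => (n == j)%:R + 1 / 10 * weight n j) 2.
  move=> bal; split=> [j|N].
    rewrite -(subrK (delta n j) (al j)) addrC (le_trans (norm1D _ _))//.
    by rewrite lerD// norm1_delta.
  rewrite big_split/=; have h := @sum_delta R n N.
  by have := sumw N (1 / 10) ltac:(lra); lra.
have L2b al : ball al -> cL2 (sseries al).
  by move=> bal; exact: (cL2_sseries b (sball _ bal)).
have b2 al : ball al -> cbounded 2 (sseries al).
  by move=> /sball s; exact: cbounded_sseries s.
have dlb al : ball al -> norm1 (dl al) <= 2 * k.
  move=> bal; have qS := cL1_mul_sseries q1 (sball _ bal).
  apply: (le_trans (scoef_bound b n qS (L1pi_norm1 qS) (fun x _ => lexx _))).
  by rewrite mulrC; apply: int_norm1_mulb => //; [exact/cL2_meas/L2b|exact: b2].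
have resb al : ball al -> cL1 (res al) /\
    \int[mu]_(x in I) norm1 (res al x) <= 18 * k.
  move=> bal; have [r1 r2] := residual_bound (L2b _ bal) (b2 _ bal) (ler0n R 2) (dlb _ bal).
  by split => //; apply: (le_trans r2); lra.
have Tball al : ball al -> ball (T al).
  move=> bal j; rewrite /T /kronecker; case: eqP => [<-|_].
    by rewrite subrr norm1_0 mulr_ge0.
  have [r1 r2] := resb _ bal.
  rewrite subr0 (le_trans (reduced_bound n j r1 r2))// ler_wpM2r//; lra.
have Tcontr al al' d : 0 <= d -> ball al -> ball al' ->
     (forall j, norm1 (al j - al' j) <= d * weight n j) ->
     forall j, norm1 (T al j - T al' j) <= d / 2 * weight n j.
  move=> d0 bal bal' dd j; rewrite /T; case: eqP => _.
    by rewrite subrr norm1_0 mulr_ge0// divr_ge0.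
  have [r1 _] := resb _ bal; have [r1' _] := resb _ bal'.
  have sdist x : norm1 (sseries al x - sseries al' x) <= 10 * d.
    apply: (sseries_dist b x (sball _ bal) (sball _ bal') (w := fun j => d * weight n j)).
    by split => // N; rewrite [10 * d]mulrC; exact: sumw.
  have Sd2 : cL2 (fun x => sseries al x - sseries al' x).
    have := cL2D (L2b _ bal) (cL2Z (-1) (L2b _ bal')).
    by congr cL2; apply/funext => x; rewrite mulN1r.
  have Sdb : cbounded (10 * d) (fun x => sseries al x - sseries al' x) by move=> x _.
  have d10 : 0 <= 10 * d by rewrite mulr_ge0.
  have qS := cL1_mul_sseries q1 (sball _ bal).
  have qS' := cL1_mul_sseries q1 (sball _ bal').
  have ddl : norm1 (dl al - dl al') <= 10 * d * k.
    rewrite /dl -scoefB//.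
    have qd := cL1B qS qS'.
    apply: (le_trans (scoef_bound b n qd (L1pi_norm1 qd) (fun x _ => lexx _))).
    rewrite [leRHS]mulrC; under eq_int do rewrite -mulrBr.
    by apply: int_norm1_mulb => //; exact: cL2_meas.
  have [s1 s2] := residual_bound Sd2 Sdb d10 (dlb _ bal).
  have [t1 t2] : cL1 (fun x => (dl al - dl al') * sseries al' x) /\
     \int[mu]_(x in I) norm1 ((dl al - dl al') * sseries al' x) <= 80 * d * k.
    have c1 := cL1Z (dl al - dl al') (cL2_L1 (L2b _ bal')).
    split => //; apply: (@le_trans _ _ (\int[mu]_(x in I) (20 * d * k))).
      apply: int_le; [exact: L1pi_norm1|exact: L1pi_cst|].
      move=> x xI; rewrite (le_trans (norm1M _ _))//.
      rewrite (_ : 20 * d * k = 10 * d * k * 2); last by ring.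
      by rewrite ler_pM ?norm1_ge0//; exact: b2.
    rewrite int_cst.
    have : 20 * d * k * pi <= 20 * d * k * 4 by rewrite ler_wpM2l ?pi_le4// !mulr_ge0.
    lra.
  have -> : reduced n (res al) j - reduced n (res al') j =
      reduced n (fun x => (dl al * (sseries al x - sseries al' x)
        - q x * (sseries al x - sseries al' x)) +
        (dl al - dl al') * sseries al' x) j.
    rewrite (reducedB n j r1 r1'); congr (reduced n _ j); apply/funext => x.
    rewrite /res; move: (dl al) (dl al') (q x) (sseries al x) (sseries al' x).
    by move=> *; ring.
  apply: (le_trans (reduced_bound n j (cL1D s1 t1) (k := 170 * d * k) _)).
    apply: (@le_trans _ _ (\int[mu]_(x in I) (norm1 (dl al * (sseries al x - sseries al' x)
        - q x * (sseries al x - sseries al' x)) +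
        norm1 ((dl al - dl al') * sseries al' x)))).
      apply: int_le; [exact/L1pi_norm1/cL1D|by apply: L1piD; exact: L1pi_norm1|].
      by move=> x _; exact: norm1D.
    rewrite intD; [|exact: L1pi_norm1..].
    apply: (le_trans (lerD s2 t2)).
    by rewrite le_eqVlt; apply/orP; left; apply/eqP; ring.
  rewrite ler_wpM2r//.
  have : 170 * d * k <= 170 * d * (1 / 1000) by rewrite ler_wpM2l// mulr_ge0.
  lra.
(* The ball of radius 1 / 10 keeps the series bounded by 1 + 10 / 10 = 2, as
   the weights add up to at most 10. *)
have c0 : 0 <= 1 / 10 :> R by lra.
have [al bal fix_al] := weighted_fixpoint c0 w0 Tball Tcontr.
have aln : al n = 1 by rewrite -fix_al /T eqxx.
have sal := sball _ bal.
exists ((Om n)%:C + dl al), al; split => //.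
- split; first by exists (fun j => (n == j)%:R + 1 / 10 * weight n j), 2.
  move=> j; case: (eqVneq n j) => [<-|nj].
    by rewrite aln mulr1 addrAC subrr add0r.
  have : (Om j - Om n)%:C * al j = dl al * al j - scoef (fun x => q x * sseries al x) j.
    rewrite -(residual_scoef (dl al) j sal) -[in LHS]fix_al /T (negbTE nj).
    exact: reduced_eq.
  rewrite rmorphB => E.
  rewrite -[RHS](subKr (dl al * al j)) -E.
  by move: (dl al) (al j) => D A; ring.
- by rewrite addrAC subrr add0r; exact: dlb.
Qed.

Section Localization.
Variables (n : nat) (lam : C) (al : nat -> C).
Hypothesis k_small : k <= 1 / 1000.
Hypothesis lam_near : norm1 (lam - (Om n)%:C) <= 2 * k.
Hypothesis eig : eigencoef q lam al.

(** Off resonance the coefficients of an eigenfunction are those of the reduced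
    resolvent applied to (lam - Om n - q) times the eigenfunction. *)
Lemma eigencoef_reduced (M : R) : 0 <= M -> (forall x, norm1 (sseries al x) <= M) ->
  forall x, norm1 (sseries al x - al n * (sn n x)%:C) <= 9 * k * M * weight_sum n.
Proof.
move=> M0 SM x; have [[w [W sal]] E] := eig.
have bS : cbounded M (sseries al) by move=> y _.
have [r1 r2] := residual_bound (cL2_sseries b sal) bS M0 lam_near.
set res := (fun x => _) in r1 r2.
have r3 : \int[mu]_(x in I) norm1 (res x) <= 9 * k * M by apply: (le_trans r2); lra.
have alj j : n != j -> al j = reduced n res j.
  move=> nj; apply: reduced_solve => //.
  by rewrite (residual_scoef _ _ sal) -E rmorphB; ring.
rewrite -(sseries_delta b n (al n)).
apply: (sseries_dist b x sal (summable_delta n (al n)) (w := fun j => 9 * k * M * weight n j)).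
split=> [j|N].
  rewrite /kronecker; case: (eqVneq n j) => [<-|nj].
    by rewrite mulr1 subrr norm1_0 !mulr_ge0// weight_ge0.
  by rewrite mulr0 subr0 (alj _ nj); exact: reduced_bound.
rewrite -mulr_sumr ler_wpM2l ?mulr_ge0//; exact: sum_weight.
Qed.

(** A bound [M] of the eigenfunction improves to norm1 (al n) + M / 2; iterating
    this removes the initial bound.  In particular the resonant coefficient of a
    nonzero eigenfunction does not vanish. *)
Lemma eigencoef_bound x : norm1 (sseries al x) <= 2 * norm1 (al n).
Proof.
have [[w [W sal]] _] := eig.
have W0 : 0 <= W by apply: le_trans (sseries_bound b sal 0); exact: norm1_ge0.
suff H p y : norm1 (sseries al y) <= 2 * norm1 (al n) + W / 2 ^+ p.
  by apply: (@le_of_geometric _ _ _ W) => p.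
elim: p y => [|p IHp] y.
  rewrite expr0 divr1 (le_trans (sseries_bound b sal y))// lerDr.
  by rewrite mulr_ge0// norm1_ge0.
have p0 : 0 < 2 ^+ p :> R by rewrite exprn_gt0.
set M := 2 * norm1 (al n) + W / 2 ^+ p in IHp.
have M0 : 0 <= M by rewrite addr_ge0 ?mulr_ge0 ?norm1_ge0// divr_ge0// ltW.
have := eigencoef_reduced M0 IHp y => h.
have : 9 * k * M * weight_sum n <= M / 2.
  apply: (@le_trans _ _ (9 * k * M * 10)).
    by rewrite ler_wpM2l ?mulr_ge0// weight_sum_le10.
  have : k * M <= 1 / 1000 * M by rewrite ler_wpM2r.
  lra.
have h2 : norm1 (al n * (sn n y)%:C) <= norm1 (al n).
  by rewrite mulrC norm1_realM ler_piMl ?norm1_ge0// sn_le1.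
have := norm1D (sseries al y - al n * (sn n y)%:C) (al n * (sn n y)%:C).
rewrite subrK.
have -> : W / 2 ^+ p.+1 = W / 2 ^+ p / 2 by rewrite exprSr invfM mulrA.
rewrite /M in h *; lra.
Qed.

(** The bound 2 norm1 (al n) of the whole series is fed back into
    [eigencoef_reduced].  The factor [weight_sum n] makes the remainders
    square-summable in [n], which is what uniqueness requires. *)
Lemma eigencoef_close x :
  norm1 (sseries al x - al n * (sn n x)%:C) <= 18 * k * norm1 (al n) * weight_sum n.
Proof.
have M0 : 0 <= 2 * norm1 (al n) by rewrite mulr_ge0// norm1_ge0.
apply: (le_trans (eigencoef_reduced M0 eigencoef_bound x)).
by rewrite le_eqVlt; apply/orP; left; apply/eqP; ring.
Qed.

End Localization.
End Residual.
End Perturbation.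

(** * Eigenvalues and enumerated spectra *)

Section Spectrum.
Variable R : realType.
Local Notation C := R[i].
Local Notation mu := (@lebesgue_measure R).
Local Notation I := (@I0pi R).
Local Notation re := (@complex.Re R).
Local Notation im := (@complex.Im R).
Local Notation "r %:C" := (real_complex R r).

Definition is_eigenvalue (T : operator R) (z : C) : Prop :=
  exists y w, [/\ T y w, ae_eq0pi w (fun x => z * y x)
    & ~ ae_eq0pi y (fun=> 0)].

(** The last nonzero vector in the chain of a root vector is an
    eigenvector. *)
Lemma ker_pow_eigenvalue (T : operator R) (z : C) k (y : R -> C) :
  ker_pow T z k y -> ~ ae_eq0pi y (fun=> 0) -> is_eigenvalue T z.
Proof.
elim: k y => [|k IHk] y /=; first by case.
move=> [w [Tyw kw]] y0.
have [w0|w0] := pselect (ae_eq0pi (fun x => w x - z * y x) (fun=> 0)); last exact: IHk kw w0.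
exists y, w; split => //.
by apply: ae_imply w0 => x w0 xI; apply/eqP; rewrite -subr_eq0; apply/eqP; exact: w0.
Qed.

Lemma lin_comb_delta d (e : 'I_d -> R -> C) i :
  lin_comb (fun j => (i == j)%:R) e = e i.
Proof.
apply/funext => x; rewrite /lin_comb (bigD1 i)//= eqxx mul1r big1 ?addr0// => j ji.
by rewrite eq_sym (negbTE ji) mul0r.
Qed.

Lemma alg_multiplicity_eigenvalue (T : operator R) (z : C) d : (0 < d)%N ->
  alg_multiplicity T z d -> is_eigenvalue T z.
Proof.
case: d => // d _ [e [er efree _]].
have [k ke] := er ord0; apply: (ker_pow_eigenvalue ke) => e0.
have := efree (fun j => (ord0 == j)%:R); rewrite lin_comb_delta => /(_ e0 ord0).
by rewrite eqxx => /eqP; rewrite oner_eq0.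
Qed.

Lemma eigenvalue_alg_multiplicity (T : operator R) (z : C) d :
  (forall y w, T y w -> inL2 y /\ inL2 w) ->
  is_eigenvalue T z -> alg_multiplicity T z d -> (0 < d)%N.
Proof.
move=> TL2 [y [w [Tyw wz y0]]] [e [_ _ espan]]; rewrite lt0n; apply/eqP => d0.
subst d; apply: y0.
have [y2 w2] := TL2 _ _ Tyw.
have : root_vector T z y.
  exists 1%N, w; split => //; split.
    apply: cL2_inL2.
    have := cL2D (inL2_cL2 w2) (cL2Z (- z) (inL2_cL2 y2)).
    by congr cL2; apply/funext => x; rewrite mulNr.
  by apply: ae_imply wz => x wz xI; rewrite wz// subrr.
move=> /espan[c]; apply: ae_imply => x yc xI; rewrite yc//.
by rewrite /lin_comb big_ord0.
Qed.

(** Multiplicities are positive exactly at eigenvalues, so that an enumerated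
    spectrum determines the set of eigenvalues. *)
Lemma spectrum_eigenvalue (T : operator R) (lam : nat -> C) (z : C) :
  (forall y w, T y w -> inL2 y /\ inL2 w) ->
  spectrum_enum T lam -> is_eigenvalue T z <-> exists n, lam n = z.
Proof.
move=> TL2 [_ /(_ z)[d dm dcard]]; split.
  move=> /(eigenvalue_alg_multiplicity TL2)/(_ dm) d0.
  case: d d0 {dm} dcard => // d _ dcard.
  apply: contrapT => none; move: dcard.
  have -> : [set n | lam n = z] = set0.
    by apply/seteqP; split => // n /= nz; apply: none; exists n.
  rewrite card_eq_sym card_eq0 => /eqP E.
  have : `I_d.+1 0%N by [].
  by rewrite E.
move=> [n nz]; apply: (@alg_multiplicity_eigenvalue _ _ d) => //.
rewrite lt0n; apply/eqP => d0; move: dcard; rewrite d0 II0 card_eq0 => /eqP E.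
have : [set n | lam n = z] n by [].
by rewrite E.
Qed.

Lemma sseriesZ b (c : C) (a : nat -> C) w W x : summable_by a w W ->
  summable_by (fun k => c * a k) (fun k => norm1 c * w k) (norm1 c * W) /\
  sseries b (fun k => c * a k) x = c * sseries b a x.
Proof.
move=> [aw wW].
have s : summable_by (fun k => c * a k) (fun k => norm1 c * w k) (norm1 c * W).
  split=> [k|N]; last by rewrite -mulr_sumr ler_wpM2l ?norm1_ge0.
  by rewrite (le_trans (norm1M _ _))// ler_wpM2l ?norm1_ge0.
split => //; apply/subr0_eq/norm1_eq0; apply/ler_addgt0Pl => e e0; rewrite addr0.
have e2 : 0 < e / 2 by rewrite divr_gt0.
have c0 : 0 < norm1 c + 1 by rewrite ltr_wpDl// norm1_ge0.
have e3 : 0 < e / 2 / (norm1 c + 1) by rewrite divr_gt0.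
have [N1 h1] := sseries_tail b s e2.
have [N2 h2] := sseries_tail b (conj aw wW) e3.
have {h1} := h1 (maxn N1 N2) x (leq_maxl _ _).
have {h2} := h2 (maxn N1 N2) x (leq_maxr _ _).
set n := maxn _ _ => h2 h1.
have E : csum b (fun k => c * a k) n x = c * csum b a n x.
  by rewrite /csum mulr_sumr; apply: eq_bigr => k _; rewrite mulrA.
rewrite E in h1.
have -> : sseries b (fun k => c * a k) x - c * sseries b a x =
  (sseries b (fun k => c * a k) x - c * csum b a n x)
  - c * (sseries b a x - csum b a n x) by ring.
rewrite (le_trans (norm1B _ _))// [leRHS]splitr lerD//.
rewrite (le_trans (norm1M _ _))//.
apply: (le_trans (ler_wpM2l (norm1_ge0 c) h2)).
by rewrite mulrCA ler_piMr ?(ltW e2)// ler_pdivrMr// mul1r lerDl.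
Qed.

Section Operator.
Variables (b : bool) (m : nat).
Hypothesis m_gt0 : (0 < m)%N.
Local Notation Om := (@unperturbed R b m).

Definition sturm_op (q : R -> C) : operator R := diff_operator (sturm_bc b) m q.

Lemma sturm_op_L2 q y w : sturm_op q y w -> inL2 y /\ inL2 w.
Proof. by case. Qed.

(** A solution of the coefficient equation lies in the domain of the operator:
    integrating lam y - q y yields a jet whose function has the same sine
    coefficients as y, hence equals y almost everywhere. *)
Lemma eigencoef_eigenvalue q lam al n : cL2 q ->
  eigencoef b m q lam al -> al n = 1 -> is_eigenvalue (sturm_op q) lam.
Proof.
move=> q2 [[w [W sal]] E] aln; have q1 := cL2_L1 q2.
pose y := sseries b al.
have y2 : cL2 y by exact: cL2_sseries sal.
have yW : cbounded W y by exact: cbounded_sseries sal.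
have qy2 : cL2 (fun x => q x * y x) := cL2_mulb q2 (cL2_meas y2) yW.
pose f x := lam * y x - q x * y x.
have f2 : cL2 f.
  have := cL2D (cL2Z lam y2) (cL2Z (-1) qy2).
  by congr cL2; apply/funext => x; rewrite mulN1r.
have [Y [Yjet Ybc YE]] := jets_of b m f2.
have Y02 : cL2 (Y 0%N).
  case: m m_gt0 Yjet {Ybc YE E} => // p _ [YAC _].
  by apply: (AC_deriv_cL2 (YAC 0%N _)); lia.
have Om_neq0 j : (Om j)%:C != 0 :> C.
  apply/eqP => /(congr1 re); rewrite re_real re0 => /eqP.
  by rewrite gt_eqF// exprn_gt0// freq_gt0.
have sgn : (-1) ^+ m * (-1) ^+ m = 1 :> C.
  by rewrite -exprD addnn -signr_odd odd_double.
have yY : ae_eq0pi y (Y 0%N).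
  apply: (scoef_complete (b := b) y2 Y02) => j.
  apply: (mulfI (Om_neq0 j)); rewrite -(jet_scoef j Yjet Ybc).
  have -> : Y (2 * m)%N = fun x => (-1) ^+ m * f x by apply/funext.
  rewrite scoefZ; last exact: cL2_L1.
  rewrite [RHS]mulrA sgn mul1r.
  rewrite /f scoefB ?scoefZ; [|exact: cL2_L1|exact/cL1Z/cL2_L1|exact: cL2_L1].
  by rewrite -E (scoef_sseries b j sal); ring.
exists y, (fun x => lam * y x); split.
- split; [exact: cL2_inL2|exact/cL2_inL2/cL2Z|].
  exists Y; split => //.
  apply: ae_imply yY => x yY xI; rewrite -yY// YE mulrA sgn.
  by rewrite mul1r /f subrK.
- exact: aeW.
- move=> y0; have : sine_coef b y n = 0.
    rewrite (@scoef_ae_eq _ b _ (fun=> 0 * 0) n (cL2_meas y2) (cmeas_cst _)).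
      by rewrite (@scoefZ _ b 0 (fun=> 0) n) ?mul0r//; split; exact: L1pi_cst.
    by apply: ae_imply y0 => x y0 xI; rewrite y0// mul0r.
  rewrite (scoef_sseries b n sal) aln => /eqP; by rewrite oner_eq0.
Qed.

(** Conversely, near an unperturbed eigenvalue the sine coefficients of an
    eigenfunction are summable, and the function agrees almost everywhere with
    their sine series, which is then normalised at the resonant index. *)
Lemma eigenvalue_eigencoef q (k : R) lam n : cL2 q ->
  \int[mu]_(x in I) norm1 (q x) <= k -> k <= 1 / 1000 ->
  norm1 (lam - (Om n)%:C) <= 2 * k ->
  is_eigenvalue (sturm_op q) lam ->
  exists al, eigencoef b m q lam al /\ al n = 1.
Proof.
move=> q2 qk ksmall near [y [w [[y2 w2 [Y [Yjet Ybc yY wE]]] wlam y0]]].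
have q1 := cL2_L1 q2.
have [AC01 [M YM]] : cL2 (Y 0%N) /\ exists M, cbounded M (Y 0%N).
  case: m m_gt0 Yjet {Ybc wE near} => // p _ [YAC _].
  have AC := YAC 0%N ltac:(lia).
  by split; [exact: AC_deriv_cL2 AC|exact: AC_deriv_bounded AC].
have M0 : 0 <= M.
  have xI : I (pi / 2).
    by rewrite /I0pi/= in_itv/=; have := pi_gt0 R; move=> *; apply/andP; split; lra.
  by apply: le_trans (YM _ xI); exact: norm1_ge0.
have mY := cL2_meas AC01.
have qY1 := cL1_mulb q1 mY YM.
have Y2m := inL2_cL2 (proj2 Yjet).
have coef j : (lam - (Om j)%:C) * sine_coef b (Y 0%N) j
    = sine_coef b (fun x => q x * Y 0%N x) j.
  have : sine_coef b (fun x => lam * Y 0%N x) j =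
      sine_coef b (fun x => (-1) ^+ m * Y (2 * m)%N x + q x * Y 0%N x) j.
    apply: scoef_ae_eq; [exact/cmeasM/mY/cmeas_cst| |].
      by apply: cmeasD; [exact/cmeasM/(cL2_meas Y2m)/cmeas_cst|exact: cL1_meas].
    apply: ae_imply2 (_ : {ae mu, forall x, I x -> y x = Y 0%N x /\ w x = lam * y x}) wE
      => [x + wE xI|].
      by move=> /(_ xI)[yx wx]; rewrite -wE// wx yx.
    by apply: ae_imply2 yY wlam => x h1 h2 xI; split; [exact: h1|exact: h2].
  rewrite scoefD; [|exact/cL1Z/cL2_L1|exact: qY1].
  rewrite scoefZ; last exact: cL2_L1.
  rewrite scoefZ; last exact: cL2_L1.
  rewrite (jet_scoef j Yjet Ybc) => E.
  by rewrite mulrBl E addrAC subrr add0r.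
pose d := lam - (Om n)%:C.
have dk : norm1 d <= norm1 d by [].
have [r1 r2] := residual_bound q1 qk AC01 YM M0 dk.
pose B := (4 * norm1 d + k) * M.
have B0 : 0 <= B.
  by apply: le_trans r2; apply: int_ge0 => x _; exact: norm1_ge0.
pose a := sine_coef b (Y 0%N).
have sa : summable_by a (fun j => norm1 (a n) * (n == j)%:R + B * weight R b m n j)
    (norm1 (a n) * 1 + B * weight_sum R n).
  split=> [j|N].
    case: (eqVneq n j) => [<-|nj].
      by rewrite mulr1 lerDl mulr_ge0// weight_ge0.
    rewrite mulr0 add0r.
    have -> : a j = reduced b m n (fun x => d * Y 0%N x - q x * Y 0%N x) j.
      apply: reduced_solve => //.
      rewrite scoefB; [|exact/cL1Z/cL2_L1|exact: qY1].
      rewrite scoefZ; last exact: cL2_L1.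
      by rewrite -coef rmorphB -/(a j) /d; ring.
    exact: reduced_bound.
  rewrite big_split/= -!mulr_sumr lerD// ler_wpM2l ?norm1_ge0//.
    exact: sum_delta.
  exact: sum_weight.
have S2 := cL2_sseries b sa.
have YS : {ae mu, forall x, I x -> sseries b a x = Y 0%N x}.
  by apply: (scoef_complete (b := b) S2 AC01) => j; rewrite (scoef_sseries b j sa).
have qS1 := cL1_mul_sseries b q1 sa.
have eig : eigencoef b m q lam a.
  split; first by exists (fun j => norm1 (a n) * (n == j)%:R + B * weight R b m n j),
    (norm1 (a n) * 1 + B * weight_sum R n).
  move=> j; rewrite coef; apply: scoef_ae_eq; [exact: cL1_meas|exact: cL1_meas|].
  by apply: ae_imply YS => x h xI; rewrite h.
have an0 : a n != 0.
  apply/eqP => an0; apply: y0; apply: ae_imply2 yY YS => x h1 h2 xI.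
  rewrite h1// -h2//; apply: norm1_eq0.
  by rewrite (le_trans (eigencoef_bound m_gt0 q1 qk ksmall near eig x))// an0 norm1_0 mulr0.
exists (fun j => (a n)^-1 * a j); split; last by rewrite mulVf.
have [_ E] := eig; split.
  have [s _] := sseriesZ b (a n)^-1 0 sa.
  by exists (fun k => norm1 (a n)^-1 * (norm1 (a n) * (n == k)%:R + B * weight R b m n k)),
    (norm1 (a n)^-1 * (norm1 (a n) * 1 + B * weight_sum R n)).
move=> j; rewrite mulrCA E -scoefZ//; congr (sine_coef b _ j); apply/funext => x.
by have [_ ->] := sseriesZ b (a n)^-1 x sa; rewrite mulrCA.
Qed.

End Operator.
End Spectrum.

(** * From equal spectra to equal potentials *)

Section Uniqueness.
Variable R : realType.
Local Notation C := R[i].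
Local Notation mu := (@lebesgue_measure R).
Local Notation I := (@I0pi R).
Local Notation re := (@complex.Re R).
Local Notation im := (@complex.Im R).
Local Notation "r %:C" := (real_complex R r).

Lemma sum_weight_half N : \sum_(K < N) weight_sum R K./2 ^+ 2 <= 600.
Proof.
have H n : \sum_(K < n.*2) weight_sum R K./2 ^+ 2 =
    2 * \sum_(K < n) weight_sum R K ^+ 2.
  elim: n => [|n IHn]; first by rewrite !big_ord0 mulr0.
  rewrite doubleS !big_ord_recr/= IHn uphalf_double doubleK.
  by ring.
apply: (@le_trans _ _ (\sum_(K < N.*2) weight_sum R K./2 ^+ 2)).
  rewrite (big_ord_widen _ (fun K => weight_sum R K./2 ^+ 2) (_ : N <= N.*2)%N);
    last by lia.
  by rewrite big_mkcond/=; apply: ler_sum => K _; case: ifP => // _; rewrite sqr_ge0.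
by rewrite H; have := sum_weight_sum_sqr R N; lra.
Qed.

(** The functions 1 - cos (K x), K >= 1, span up to small errors: square-summable
    defects force the constant coefficient to vanish, after which they are the
    cosine coefficients themselves and Parseval applies. *)
Lemma nearly_orthogonal_small (f : R -> R) (s : R) : L2pi f -> 0 <= s ->
  (forall K, `|coscoef f 0 - coscoef f K.+1| <= s * weight_sum R K./2) ->
  \int[mu]_(x in I) (f x ^+ 2) <= 600 * s ^+ 2.
Proof.
move=> f2 s0 H.
have sq K : (coscoef f 0 - coscoef f K.+1) ^+ 2 <= s ^+ 2 * weight_sum R K./2 ^+ 2.
  rewrite -exprMn -[leLHS]real_normK ?num_real// lerXn2r ?nnegrE//.
  by rewrite mulr_ge0// weight_sum_ge0.
have bound N : \sum_(K < N) s ^+ 2 * weight_sum R K./2 ^+ 2 <= 600 * s ^+ 2.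
  by rewrite -mulr_sumr mulrC ler_wpM2r ?sqr_ge0// sum_weight_half.
have c0 : coscoef f 0 = 0.
  apply: (@coscoef0_eq0 _ f (fun K => coscoef f 0 - coscoef f K.+1) (600 * s ^+ 2)) => // N.
  by apply: le_trans (bound N); apply: ler_sum => K _; exact: sq.
have E0 : 0 <= 600 * s ^+ 2 by apply: mulr_ge0; [exact: ler0n|exact: sqr_ge0].
apply: (@le_trans _ _ (2 / pi * (600 * s ^+ 2))); last first.
  by apply: ler_piMl => //; rewrite ler_pdivrMr ?pi_gt0// mul1r pi_ge2.
apply: (@cos_parseval_le _ f (fun k => if k is K.+1 then
    s ^+ 2 * weight_sum R K./2 ^+ 2 else 0)) => //.
  case=> [|K]; first by rewrite c0 expr0n.
  by have := sq K; rewrite c0 sub0r sqrrN.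
case=> [|N]; first by rewrite big_ord0.
by rewrite big_ord_recl/= add0r; exact: bound.
Qed.

Section Potentials.
Variables (m : nat) (q1 q2 : R -> C) (k : R).
Hypothesis m_gt0 : (0 < m)%N.
Hypothesis q12 : cL2 q1.
Hypothesis q22 : cL2 q2.
Hypothesis q1k : \int[mu]_(x in I) norm1 (q1 x) <= k.
Hypothesis q2k : \int[mu]_(x in I) norm1 (q2 x) <= k.
Hypothesis k_small : k <= 1 / 1000 * (1 / 100).
Hypothesis same_spectra : forall b z,
  is_eigenvalue (sturm_op b m q1) z -> is_eigenvalue (sturm_op b m q2) z.

Let p x := q1 x - q2 x.
Let P := \int[mu]_(x in I) norm1 (p x).

Let p1 : cL1 p. Proof. by apply: cL1B; exact: cL2_L1. Qed.

Let p2 : cL2 p.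
Proof.
have := cL2D q12 (cL2Z (-1) q22).
by congr cL2; apply/funext => x; rewrite mulN1r.
Qed.

Let k0 : 0 <= k.
Proof. by apply: le_trans q1k; apply: int_ge0 => x _; exact: norm1_ge0. Qed.

Let k1 : k <= 1 / 1000. Proof. by move: k_small; lra. Qed.

Let P0 : 0 <= P. Proof. by apply: int_ge0 => x _; exact: norm1_ge0. Qed.

(** Eigenfunctions y1 and y2 of the two operators for a common eigenvalue make
    (q1 - q2) y1 y2 integrate to 0 by symmetry of the unperturbed part, and
    y1 y2 is close to the squared sine. *)
Lemma nearly_orthogonal_sine b n :
  norm1 (cint (fun x => p x * (sn b n x ^+ 2)%:C)) <= 54 * k * weight_sum R n * P.
Proof.
have q11 := cL2_L1 q12; have q21 := cL2_L1 q22.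
have [lam [a1 [e1 a1n near]]] := eigencoef_exists b m_gt0 q11 q1k n k1.
have eig2 := same_spectra (eigencoef_eigenvalue m_gt0 q12 e1 a1n).
have [a2 [e2 a2n]] := eigenvalue_eigencoef m_gt0 q22 q2k k1 near eig2.
have close1 x := eigencoef_close m_gt0 q11 q1k k1 near e1 x.
have close2 x := eigencoef_close m_gt0 q21 q2k k1 near e2 x.
have bound2 x := eigencoef_bound m_gt0 q21 q2k k1 near e2 x.
have [[w1 [W1 s1]] E1] := e1; have [[w2 [W2 s2]] E2] := e2.
pose y1 := sseries b a1; pose y2 := sseries b a2.
pose rho := 18 * k * weight_sum R n.
have {}close1 x : norm1 (y1 x - (sn b n x)%:C) <= rho.
  by have := close1 x; rewrite a1n mul1r norm1_1 mulr1.
have {}close2 x : norm1 (y2 x - (sn b n x)%:C) <= rho.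
  by have := close2 x; rewrite a2n mul1r norm1_1 mulr1.
have {}bound2 x : norm1 (y2 x) <= 2 by have := bound2 x; rewrite a2n norm1_1 mulr1.
have rho0 : 0 <= rho by apply: mulr_ge0; [rewrite mulr_ge0|exact: weight_sum_ge0].
have qy1 := cL1_mul_sseries b q11 s1; have qy2 := cL1_mul_sseries b q21 s2.
have m1 := cmeas_sseries b s1; have m2 := cmeas_sseries b s2.
have B1 := cbounded_sseries b s1; have B2 := cbounded_sseries b s2.
have qyy1 := cL1_mulb qy1 m2 B2; have qyy2 := cL1_mulb qy2 m1 B1.
have orth : cint (fun x => q1 x * y1 x * y2 x - q2 x * y2 x * y1 x) = 0.
  rewrite cintB//; apply/eqP; rewrite subr_eq0; apply/eqP.
  by apply: (sseries_pairing s1 s2 qy1 qy2) => j; rewrite -E1 -E2; ring.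
have ms : cmeas (fun x => (sn b n x)%:C) by exact: cmeas_sn.
have mss : cmeas (fun x => (sn b n x ^+ 2)%:C).
  by have := cmeasM ms ms; congr cmeas; apply/funext => x; rewrite expr2 rmorphM.
have ss1 : cbounded 1 (fun x => (sn b n x ^+ 2)%:C).
  move=> x _; rewrite norm1_real normrX expr_le1 ?normr_ge0//.
  exact: sn_le1.
have pss := cL1_mulb p1 mss ss1.
have -> : cint (fun x => p x * (sn b n x ^+ 2)%:C) =
  cint (fun x => p x * (sn b n x ^+ 2)%:C
     - (q1 x * y1 x * y2 x - q2 x * y2 x * y1 x)).
  by rewrite cintB ?orth ?subr0//; exact: cL1B.
apply: (@le_trans _ _ (\int[mu]_(x in I) (54 * k * weight_sum R n * norm1 (p x)))); last first.
  by rewrite intZ//; exact: L1pi_norm1.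
apply: norm1_cint; [exact/cL1B/cL1B|exact/L1piZ/L1pi_norm1|].
move=> x _.
have -> : p x * (sn b n x ^+ 2)%:C - (q1 x * y1 x * y2 x - q2 x * y2 x * y1 x) =
    - p x * ((y1 x - (sn b n x)%:C) * y2 x + (sn b n x)%:C * (y2 x - (sn b n x)%:C)).
  have -> : (sn b n x ^+ 2)%:C = (sn b n x)%:C * (sn b n x)%:C :> C.
    by rewrite expr2 rmorphM.
  by rewrite /p; move: (q1 x) (q2 x) (y1 x) (y2 x) ((sn b n x)%:C) => u v y z s; ring.
rewrite (le_trans (norm1M _ _))// norm1N mulrC ler_wpM2r ?norm1_ge0//.
rewrite (le_trans (norm1D _ _))//.
have h1 : norm1 ((y1 x - (sn b n x)%:C) * y2 x) <= rho * 2.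
  by rewrite (le_trans (norm1M _ _))// ler_pM ?norm1_ge0.
have h2 : norm1 ((sn b n x)%:C * (y2 x - (sn b n x)%:C)) <= rho.
  rewrite norm1_realM (le_trans _ (close2 x))// ler_piMl ?norm1_ge0//.
  exact: sn_le1.
have -> : 54 * k * weight_sum R n = rho * 2 + rho by rewrite /rho; ring.
exact: lerD.
Qed.

Lemma sn_sqr b n x : sn b n x ^+ 2 =
  2^-1 * (1 - cos ((if b then n.*2.+1 else n.*2.+2)%:R * x)) :> R.
Proof.
have -> : (if b then n.*2.+1 else n.*2.+2)%:R * x = frequency R b n * x + frequency R b n * x.
  have E : n.*2%:R = 2 * n%:R :> R by rewrite -muln2 natrM mulrC.
  by rewrite /frequency; case: b; rewrite -!natr1 E; field.
by rewrite cosD -!expr2 cos2sin2 /sn; field.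
Qed.

Lemma coscoef_component (h : C -> R) b n : L1pi (fun x => h (p x)) ->
  (\int[mu]_(x in I) (h (p x) * sn b n x ^+ 2))
  = 2^-1 * (coscoef (fun x => h (p x)) 0 -
     coscoef (fun x => h (p x)) (if b then n.*2.+1 else n.*2.+2)).
Proof.
move=> h1; rewrite /coscoef -intB; [|exact: L1pi_mulcos..].
rewrite -intZ; last by apply: L1piB; exact: L1pi_mulcos.
by apply: eq_int => x _; rewrite sn_sqr mul0r cos0; ring.
Qed.

(** The doubled frequencies 2 n + 2 of the Dirichlet problem and 2 n + 1 of the
    Dirichlet-Neumann problem together exhaust the positive integers. *)
Lemma half_index K : exists b n,
  K./2 = n /\ K.+1 = if b then n.*2.+1 else n.*2.+2.
Proof.
exists (~~ odd K), (K./2); split => //; have := odd_double_half K.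
by case: (odd K) => /= E; rewrite -{1}E.
Qed.

Lemma difference_small :
  \int[mu]_(x in I) (re (p x) ^+ 2) <= 600 * (108 * k * P) ^+ 2 /\
  \int[mu]_(x in I) (im (p x) ^+ 2) <= 600 * (108 * k * P) ^+ 2.
Proof.
have s0 : 0 <= 108 * k * P by rewrite !mulr_ge0.
have [pr pi2] := p2.
have half n (z : C) (c : R) : norm1 z <= 54 * k * weight_sum R n * P ->
   `|c| <= norm1 z -> `|2 * c| <= 108 * k * P * weight_sum R n.
  by rewrite normrM ger0_norm//; lra.
split; apply: nearly_orthogonal_small => // K; have [b [n [-> ->]]] := half_index K.
  have H := nearly_orthogonal_sine b n.
  have E := coscoef_component b n (L2pi_L1 pr).
  have := half n _ _ H (norm1_re _).
  suff -> : 2 * re (cint (fun x => p x * (sn b n x ^+ 2)%:C))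
     = coscoef (fun x => re (p x)) 0 - coscoef (fun x => re (p x))
        (if b then n.*2.+1 else n.*2.+2) by [].
  have -> : re (cint (fun x => p x * (sn b n x ^+ 2)%:C)) =
    \int[mu]_(x in I) (re (p x) * sn b n x ^+ 2).
    by apply: eq_int => x _; rewrite !reimE mulr0 subr0.
  by rewrite E mulrA mulfV ?mul1r.
have H := nearly_orthogonal_sine b n.
have E := coscoef_component b n (L2pi_L1 pi2).
have := half n _ _ H (norm1_im _).
suff -> : 2 * im (cint (fun x => p x * (sn b n x ^+ 2)%:C))
   = coscoef (fun x => im (p x)) 0 - coscoef (fun x => im (p x))
      (if b then n.*2.+1 else n.*2.+2) by [].
have -> : im (cint (fun x => p x * (sn b n x ^+ 2)%:C)) =
  \int[mu]_(x in I) (im (p x) * sn b n x ^+ 2).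
  by apply: eq_int => x _; rewrite !reimE mulr0 add0r.
by rewrite E mulrA mulfV ?mul1r.
Qed.

(** Cauchy-Schwarz against the constant function. *)
Lemma norm1_difference_sqr : P ^+ 2 <= 8 * (\int[mu]_(x in I) (re (p x) ^+ 2)
  + \int[mu]_(x in I) (im (p x) ^+ 2)).
Proof.
have [[mr fr] [mi fi]] := p2; have pi0 := pi_gt0 R; have pi4 := pi_le4 R.
set A := \int[mu]_(x in I) _; set B := \int[mu]_(x in I) _.
have np := L1pi_norm1 p1.
have c1 : L1pi (fun=> (P / pi) ^+ 2 : R) by exact: L1pi_cst.
have : \int[mu]_(x in I) (2 * (P / pi) * norm1 (p x)) <=
    \int[mu]_(x in I) (2 * (re (p x) ^+ 2 + im (p x) ^+ 2) + (P / pi) ^+ 2).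
  apply: int_le; [exact: L1piZ|by apply: L1piD => //; exact/L1piZ/L1piD|].
  move=> x _.
  have -> : 2 * (re (p x) ^+ 2 + im (p x) ^+ 2) =
     2 * (`|re (p x)| ^+ 2 + `|im (p x)| ^+ 2).
    by rewrite !real_normK ?num_real.
  rewrite /norm1; set u := `|re _|; set v := `|im _|; set t := P / pi.
  rewrite -subr_ge0 (_ : _ - _ = (u + v - t) ^+ 2 + (u - v) ^+ 2).
    by rewrite addr_ge0// sqr_ge0.
  by move: u v t => u v t; ring.
have sq := L1piD fr fi.
rewrite (intZ _ np) (intD (L1piZ 2 sq) c1) (intZ 2 sq) (intD fr fi) int_cst.
rewrite -/P -/A -/B.
have -> : (P / pi) ^+ 2 * pi = P ^+ 2 / pi.
  by move: (negbT (gt_eqF pi0)); generalize (pi : R) => Q Q0; field.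
have -> : 2 * (P / pi) * P = 2 * (P ^+ 2 / pi).
  by move: (negbT (gt_eqF pi0)); generalize (pi : R) => Q Q0; field.
move=> h; have {h} : P ^+ 2 / pi <= 2 * (A + B) by lra.
rewrite ler_pdivrMr// => /le_trans; apply.
have AB : 0 <= A + B by rewrite addr_ge0// int_ge0// => x _; exact: sqr_ge0.
have : 2 * (A + B) * pi <= 2 * (A + B) * 4 by rewrite ler_wpM2l// mulr_ge0.
lra.
Qed.

(** With A + B the squared L^2 norm of the difference, the previous bounds give
    A + B <= 9600 (108 k)^2 (A + B), and the factor is less than 1. *)
Lemma potentials_eq : {ae mu, forall x, I x -> q1 x = q2 x}.
Proof.
have [hr hi] := difference_small; have hP := norm1_difference_sqr.
have [pr pi2] := p2.
set A := \int[mu]_(x in I) _ in hr hP; set B := \int[mu]_(x in I) _ in hi hP.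
have A0 : 0 <= A by apply: int_ge0 => x _; exact: sqr_ge0.
have B0 : 0 <= B by apply: int_ge0 => x _; exact: sqr_ge0.
have s : (108 * k) ^+ 2 <= (1 / 200) ^+ 2.
  rewrite lerXn2r ?nnegrE ?mulr_ge0//; move: k_small; lra.
have PP0 := sqr_ge0 P.
have sP : (108 * k * P) ^+ 2 <= (1 / 200) ^+ 2 * P ^+ 2.
  by rewrite exprMn ler_wpM2r.
have e2 : (1 / 200) ^+ 2 = 1 / 200 * (1 / 200) :> R by rewrite expr2.
rewrite e2 in sP.
have A1 : A = 0 by lra.
have B1 : B = 0 by lra.
apply: ae_imply2 (int_sqr_eq0 pr A1) (int_sqr_eq0 pi2 B1) => x h1 h2 xI.
by apply/eqP; rewrite -subr_eq0; apply/eqP/complex_ext; [exact: h1|exact: h2].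
Qed.

End Potentials.
End Uniqueness.

Theorem theorem1p1 (R : realType) (m : nat) (hm : (1 <= m)%N) :
  exists2 eps : R, 0 < eps &
    forall q1 q2 : R -> R[i],
      L2ball eps q1 -> L2ball eps q2 ->
    forall lam1 lam2 mu1 mu2 : nat -> R[i],
      spectrum_enum (opL1 m q1) lam1 -> spectrum_enum (opL1 m q2) lam2 ->
      spectrum_enum (opL2 m q1) mu1 -> spectrum_enum (opL2 m q2) mu2 ->
      (forall n, lam1 n = lam2 n) -> (forall n, mu1 n = mu2 n) ->
    {ae @lebesgue_measure R, forall x, x \in `]0, pi[ -> q1 x = q2 x}.
Proof.
pose k : R := 1 / 1000 * (1 / 100).
have eps0 : 0 < k / 5 by rewrite /k; lra.
(* The radius is k / 5 because int norm1 q <= 5 eps on the ball of radius eps. *)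
exists (k / 5) => // q1 q2 b1 b2 lam1 lam2 mu1 mu2 L11 L12 L21 L22 lamE muE.
have [q12 _] := L2ball_int eps0 b1; have [q22 _] := L2ball_int eps0 b2.
have q1k := L2ball_norm1 eps0 b1; have q2k := L2ball_norm1 eps0 b2.
have kE : 5 * (k / 5) = k by field.
rewrite kE in q1k q2k.
apply: (@potentials_eq R m q1 q2 k hm q12 q22 q1k q2k) => // b z.
have TL2 b' q := @sturm_op_L2 R b' m q.
case: b.
  move=> /(spectrum_eigenvalue z (TL2 true q1) L21)[n <-].
  by apply/(spectrum_eigenvalue _ (TL2 true q2) L22); exists n.
move=> /(spectrum_eigenvalue z (TL2 false q1) L11)[n <-].
by apply/(spectrum_eigenvalue _ (TL2 false q2) L12); exists n.
Qed.
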